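(* Let $\Phi$ be a reduced irreducible root system with $\operatorname{rk}(\Phi)\ge 2$, and let $R$ be a commutative ring. When $\Phi=\mathrm B_2$ or $\Phi=\mathrm G_2$, assume moreover that $R$ has no residue fields $\mathbb F_2$ of $2$ elements. Let $\mathfrak a,\mathfrak b\unlhd R$ be two comaximal ideals of $R$, i.e. $\mathfrak a+\mathfrak b=R$. Then $$[E(\Phi,R,\mathfrak a),E(\Phi,R,\mathfrak b)]=E(\Phi,R,\mathfrak a\mathfrak b).$$
   Context: Rings are commutative with $1$. $G(\Phi,R)=G_P(\Phi,R)$ is the Chevalley group of type $(\Phi,P)$ over $R$ (the $R$-points of the split Chevalley–Demazure group scheme), where $P$ is any lattice between the root lattice and the weight lattice of $\Phi$; $P$ is fixed and suppressed in the notation. With respect to a fixed split maximal torus, $x_\alpha(a)$, $\alpha\in\Phi$, $a\in R$, denote the elementary root unipotents. The types $\mathrm B_2$ and $\mathrm C_2$ are identified. $E(\Phi,R)$ is the subgroup generated by all $x_\alpha(a)$, $\alpha\in\Phi$, $a\in R$. For an ideal $\mathfrak a\unlhd R$, $E(\Phi,\mathfrak a)$ is the subgroup generated by all $x_\alpha(a)$, $\alpha\in\Phi$, $a\in\mathfrak a$, and $E(\Phi,R,\mathfrak a)$ is the normal closure of $E(\Phi,\mathfrak a)$ in $E(\Phi,R)$. For subgroups $H,K$ of a group, $[H,K]$ is the subgroup generated by all $[h,k]=hkh^{-1}k^{-1}$, $h\in H$, $k\in K$. *)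

(* Defs.v *)
From HB Require Import structures.
From mathcomp Require Import all_boot all_order all_algebra.
From mathcomp Require Import boolp classical_sets.
Set Implicit Arguments.
Unset Strict Implicit.
Unset Printing Implicit Defensive.
Import Order.TTheory GRing.Theory Num.Theory.
Local Open Scope classical_set_scope.
Local Open Scope ring_scope.

(** * Root systems *)

Definition pairing l (v : 'rV[rat]_l) (f : 'cV[rat]_l) : rat := (v *m f) 0 0.

(* A root system in Bourbaki's sense, in the rational vector space rat ^ l of
   row vectors; its rank is l because the roots span. Coroots are linear forms,
   i.e. column vectors; [coroot] is only meaningful on roots. *)
Record rootSystem (l : nat) := RootSystem {
  roots :> seq 'rV[rat]_l;
  coroot : 'rV[rat]_l -> 'cV[rat]_l;
  roots_span : <<roots>>%VS = fullv;
  roots_neq0 : 0 \notin roots;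
  coroot2 : forall a, a \in roots -> pairing a (coroot a) = 2;
  reflection_root : forall a b, a \in roots -> b \in roots ->
    b - pairing b (coroot a) *: a \in roots;
  pairing_int : forall a b, a \in roots -> b \in roots ->
    pairing b (coroot a) \is a Num.int }.

Section RootSystems.
Variables (l : nat) (Phi : rootSystem l).
Implicit Types (a b : 'rV[rat]_l).

Definition reduced : Prop :=
  forall a (c : rat), a \in roots Phi -> c *: a \in roots Phi -> c = 1 \/ c = -1.

(* Phi is nonempty and is not a disjoint union of two nonempty orthogonal
   subsets (S and its complement). *)
Definition irreducible : Prop :=
  (exists a, a \in roots Phi) /\
  forall S : pred 'rV[rat]_l,
    (forall a b, a \in roots Phi -> b \in roots Phi -> S a -> ~~ S b ->
       pairing a (coroot Phi b) = 0 /\ pairing b (coroot Phi a) = 0) ->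
    (forall a, a \in roots Phi -> S a) \/ (forall a, a \in roots Phi -> ~~ S a).

Definition is_base m (D : m.-tuple 'rV[rat]_l) : Prop :=
  [/\ basis_of fullv D, {subset D <= roots Phi} &
      forall a, a \in roots Phi -> exists c : 'I_m -> nat,
        a = \sum_(i < m) tnth D i *+ c i \/ a = - \sum_(i < m) tnth D i *+ c i].

(* Rank two, with Cartan integers -1 and -m for some base. *)
Definition rank2_type (m : nat) : Prop :=
  exists a b, is_base [tuple a; b] /\
    pairing a (coroot Phi b) = -1 /\ pairing b (coroot Phi a) = - m%:R.
Definition is_B2 : Prop := rank2_type 2.
Definition is_G2 : Prop := rank2_type 3.

Definition root_lattice : set 'rV[rat]_l := inIntSpan (in_tuple (roots Phi)).
Definition weight_lattice : set 'rV[rat]_l :=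
  [set v | forall a, a \in roots Phi -> pairing v (coroot Phi a) \is a Num.int].

Definition intermediate_lattice (P : set 'rV[rat]_l) : Prop :=
  [/\ P 0, forall u v, P u -> P v -> P (u - v),
      root_lattice `<=` P & P `<=` weight_lattice].

(* p is the largest integer such that b - p a is a root. *)
Definition string_length a b (p : nat) : Prop :=
  b - a *+ p \in roots Phi /\
  forall q : nat, b - a *+ q \in roots Phi -> (q <= p)%N.

End RootSystems.

(** * Chevalley groups *)

Definition lie n (A B : 'M[rat]_n) : 'M[rat]_n := A *m B - B *m A.

(* The data from which the Chevalley-Demazure group scheme of type (Phi, P) is
   built: a finite-dimensional representation of the split semisimple Lie
   algebra of type Phi whose weights generate P, together with an admissible
   lattice. An admissible lattice is the direct sum of its weight components,
   so it has a Z-basis of weight vectors; in that basis the lattice is Z ^ rdim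
   (columns, matrices acting on the left), wt i is the weight of the i-th basis
   vector, the coroot h_a is [cartan_mx] and the root vector e_a is the integral
   matrix [rvec a]. The matrices h_a, e_a form a Chevalley basis (of a Lie
   algebra which is faithfully represented, since P contains the roots), and
   admissibility says that all e_a ^ k / k! are integral.

   The scheme G_P(Phi, -) is the schematic closure in GL_rdim over Z of its
   generic fibre, the split group over rat generated by all exp(t e_a). Hence
   G_P(Phi, R) is a subgroup of GL_rdim(R), and the subgroups of G_P(Phi, R)
   generated by given elements can be computed in GL_rdim(R). *)
Definition cartan_mx l (Phi : rootSystem l) n (wt : 'I_n -> 'rV[rat]_l)
    (a : 'rV[rat]_l) : 'M[rat]_n :=
  diag_mx (\row_i pairing (wt i) (coroot Phi a)).

Definition ratmx n (A : 'M[int]_n) : 'M[rat]_n := map_mx intr A.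

Record chevalleyRep l (Phi : rootSystem l) (P : set 'rV[rat]_l) :=
    ChevalleyRep {
  rdim : nat;
  wt : 'I_rdim -> 'rV[rat]_l;
  rvec : 'rV[rat]_l -> 'M[int]_rdim;
  weights_generate : forall v, P v <-> inIntSpan [tuple wt i | i < rdim] v;
  lie_cartan_root : forall a b, a \in roots Phi -> b \in roots Phi ->
    lie (cartan_mx Phi wt b) (ratmx (rvec a)) =
      pairing a (coroot Phi b) *: ratmx (rvec a);
  lie_root_opp : forall a, a \in roots Phi ->
    lie (ratmx (rvec a)) (ratmx (rvec (- a))) = cartan_mx Phi wt a;
  lie_root_root : forall a b p, a \in roots Phi -> b \in roots Phi ->
    a + b \in roots Phi -> string_length Phi a b p ->
    exists s : bool, lie (ratmx (rvec a)) (ratmx (rvec b)) =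
      ((-1) ^+ s * p.+1%:R) *: ratmx (rvec (a + b));
  lie_root_root0 : forall a b, a \in roots Phi -> b \in roots Phi ->
    a + b \notin roots Phi -> a + b != 0 ->
    lie (ratmx (rvec a)) (ratmx (rvec b)) = 0;
  admissible : forall a, a \in roots Phi -> forall (k : nat) i j,
    (k`!%:Z %| (rvec a ^+ k) i j)%Z }.

(** ** The general linear group over a commutative ring *)

Section GeneralLinear.
Variables (R : pzRingType) (n : nat).

(* Pairs of mutually inverse matrices. *)
Definition GL := {p : 'M[R]_n * 'M[R]_n |
  (p.1 *m p.2 == 1%:M) && (p.2 *m p.1 == 1%:M)}.
HB.instance Definition _ := Choice.on GL.

Definition GLmx (g : GL) : 'M[R]_n := (val g).1.

Lemma GLmx_inj : injective GLmx.
Proof.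
move=> [[A A'] /= pA] [[B B'] /= pB]; rewrite /GLmx /= => eAB.
apply: val_inj => /=; move: pA pB; rewrite /= {}eAB.
move=> /andP[_ /eqP A'B] /andP[/eqP BB' _]; congr (_, _).
by rewrite -[A']mulmx1 -BB' mulmxA A'B mul1mx.
Qed.

Definition GLof (A B : 'M[R]_n) (AB : A *m B = 1%:M) (BA : B *m A = 1%:M) : GL :=
  exist _ (A, B) (introT andP (conj (introT eqP AB) (introT eqP BA))).

Lemma GLmxV (g : GL) : (val g).1 *m (val g).2 = 1%:M.
Proof. by case: g => p /= /andP[/eqP]. Qed.

Lemma GLVmx (g : GL) : (val g).2 *m (val g).1 = 1%:M.
Proof. by case: g => p /= /andP[_ /eqP]. Qed.

Definition GL1 : GL := GLof (mulmx1 1%:M) (mulmx1 1%:M).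
Definition GLinv (g : GL) : GL := GLof (GLVmx g) (GLmxV g).

Fact GLmul_subproof (g h : GL) :
  ((val g).1 *m (val h).1) *m ((val h).2 *m (val g).2) = 1%:M.
Proof. by rewrite mulmxA -(mulmxA _ (val h).1) GLmxV mulmx1 GLmxV. Qed.

Fact GLmul_subproofV (g h : GL) :
  ((val h).2 *m (val g).2) *m ((val g).1 *m (val h).1) = 1%:M.
Proof. by rewrite mulmxA -(mulmxA _ (val g).2) GLVmx mulmx1 GLVmx. Qed.

Definition GLmul (g h : GL) : GL :=
  GLof (GLmul_subproof g h) (GLmul_subproofV g h).

Fact GLmulA : associative GLmul.
Proof. by move=> g h k; apply: GLmx_inj; rewrite /GLmx /= mulmxA. Qed.
Fact GLmul1g : left_id GL1 GLmul.
Proof. by move=> g; apply: GLmx_inj; rewrite /GLmx /= mul1mx. Qed.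
Fact GLmulg1 : right_id GL1 GLmul.
Proof. by move=> g; apply: GLmx_inj; rewrite /GLmx /= mulmx1. Qed.
Fact GLmulVg : left_inverse GL1 GLinv GLmul.
Proof. by move=> g; apply: GLmx_inj; rewrite /GLmx /= GLVmx. Qed.
Fact GLmulgV : right_inverse GL1 GLinv GLmul.
Proof. by move=> g; apply: GLmx_inj; rewrite /GLmx /= GLmxV. Qed.

HB.instance Definition _ :=
  isGroup.Build GL GLmulA GLmul1g GLmulg1 GLmulVg GLmulgV.

End GeneralLinear.

(** ** Elementary root unipotents *)

Section RootUnipotents.
Variables (l : nat) (Phi : rootSystem l) (P : set 'rV[rat]_l).
Variable (D : chevalleyRep Phi P).
Implicit Types (a : 'rV[rat]_l) (k : nat).

Definition divided_power a k : 'M[int]_(rdim D) :=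
  map_mx (fun z => z %/ k`!%:Z)%Z (rvec D a ^+ k).

(* x_a(t) = exp(t e_a); the divided powers with k >= rdim vanish. *)
Definition root_mx (R : comPzRingType) a (t : R) : 'M[R]_(rdim D) :=
  \sum_(k < (rdim D).+1) t ^+ k *: map_mx intr (divided_power a k).

Lemma divided_powerE a k : a \in roots Phi ->
  k`!%:Z *: divided_power a k = rvec D a ^+ k.
Proof.
move=> aP; apply/matrixP => i j; rewrite !mxE mulrC divzK //.
exact: admissible.
Qed.

Lemma divided_powerM a i j : a \in roots Phi ->
  divided_power a i *m divided_power a j =
    'C(i + j, i)%:Z *: divided_power a (i + j).
Proof.
move=> aP.
have inj m (A B : 'M[int]_(rdim D)) : m`!%:Z *: A = m`!%:Z *: B -> A = B.
  move=> /matrixP AB; apply/matrixP => x y; have := AB x y; rewrite !mxE.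
  by apply: mulfI; rewrite eqz_nat -lt0n fact_gt0.
apply: (inj i); apply: (inj j).
rewrite scalemxAl scalemxAr !divided_powerE //.
rewrite !scalerA -!PoszM.
have -> : (j`! * i`! * 'C(i + j, i) = (i + j)`!)%N.
  by rewrite mulnC -(bin_fact (leq_addr j i)) addKn [(j`! * _)%N]mulnC.
by rewrite divided_powerE // exprD.
Qed.

Lemma rvec_exp_nilp a k i j : a \in roots Phi ->
  (rvec D a ^+ k) i j != 0 -> (k < rdim D)%N.
Proof.
move=> aP; pose f (x : 'I_(rdim D)) := pairing (wt x) (coroot Phi a).
have step x y : rvec D a x y != 0 -> (f y < f x)%R.
  move=> nz; have /matrixP/(_ x y) := lie_cartan_root D aP aP.
  rewrite coroot2 // /lie /cartan_mx !mxE.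
  rewrite (bigD1 x) //= big1 ?addr0; last first.
    by move=> z zx; rewrite !mxE eq_sym (negbTE zx) mulr0n mul0r.
  rewrite (bigD1 y) //= big1 ?addr0; last first.
    by move=> z zy; rewrite !mxE (negbTE zy) mulr0n mulr0.
  rewrite !mxE !eqxx !mulr1n [_ * pairing _ _]mulrC -mulrBl -/(f x) -/(f y).
  move/(mulIf (_ : (rvec D a x y)%:~R != 0 :> rat)).
  by rewrite intr_eq0 => /(_ nz) fxy; rewrite -subr_gt0 fxy.
suff bnd : (rvec D a ^+ k) i j != 0 -> (k <= #|[pred x | (f x < f i)%R]|)%N.
  move=> /bnd /leq_ltn_trans; apply.
  rewrite -[X in (_ < X)%N]card_ord; apply: proper_card.
  apply/properP; split; first by apply/fintype.subsetP.
  by exists i; rewrite !inE ?ltxx.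
elim: k i => [//|k IHk] i; rewrite exprS !mxE => nz.
have /existsP[m] : [exists m, rvec D a i m * (rvec D a ^+ k) m j != 0].
  apply: contraR nz => /existsPn z0.
  by rewrite big1 // => m _; apply/eqP; apply: negbNE.
rewrite mulf_eq0 negb_or => /andP[/step fmi /IHk/leq_ltn_trans]; apply.
apply: proper_card; apply/properP; split.
  by apply/fintype.subsetP => x; rewrite !inE => /lt_trans; apply.
by exists m; rewrite !inE ?ltxx.
Qed.

Lemma divided_power_eq0 a k : a \in roots Phi ->
  (rdim D <= k)%N -> divided_power a k = 0.
Proof.
move=> aP; rewrite leqNgt => lek; apply/matrixP => i j; rewrite !mxE.
by case: (eqVneq ((rvec D a ^+ k) i j) 0) => [->|/(rvec_exp_nilp aP)];
  rewrite ?div0z // (negbTE lek).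
Qed.

Lemma root_mx_widen (R : comPzRingType) a (t : R) m : a \in roots Phi ->
  (rdim D <= m)%N ->
  root_mx a t = \sum_(0 <= k < m.+1) t ^+ k *: map_mx intr (divided_power a k).
Proof.
move=> aP lem; rewrite (big_cat_nat (n := (rdim D).+1)) //= big_mkord.
rewrite [X in _ + X]big_nat_cond [X in _ + X]big1 ?addr0 //.
move=> k /andP[/andP[lk _] _].
by rewrite divided_power_eq0 ?(ltnW lk) // map_mx0 scaler0.
Qed.

Lemma root_mxD (R : comPzRingType) a (s t : R) : a \in roots Phi ->
  root_mx a s *m root_mx a t = root_mx a (s + t).
Proof.
move=> aP; pose F := divided_power a; set d := rdim D.
pose I k : 'M[R]_d := map_mx intr (F k).
have IM i j : I i *m I j = 'C(i + j, i)%:R *: I (i + j)%N.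
  rewrite /I -map_mxM divided_powerM //; apply/matrixP => x y.
  by rewrite !mxE rmorphM.
have I0 k : (d <= k)%N -> I k = 0.
  by move=> dk; rewrite /I /F divided_power_eq0 // map_mx0.
pose G i j : 'M[R]_d := (s ^+ i * t ^+ j * 'C(i + j, i)%:R) *: I (i + j)%N.
rewrite (root_mx_widen (s + t) (m := d + d) aP) ?leq_addr // /root_mx.
rewrite mulmx_suml.
transitivity (\sum_(i < d.+1) \sum_(j < d.+1) G i j).
  apply: eq_bigr => i _; rewrite mulmx_sumr; apply: eq_bigr => j _.
  by rewrite -scalemxAl -scalemxAr scalerA -/(I i) -/(I j) IM scalerA.
pose N := (d + d).+1.
transitivity (\sum_(0 <= i < N) \sum_(0 <= k < N | (i <= k)%N) G i (k - i)%N).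
  rewrite [RHS](big_cat_nat (n := d.+1)) ?ltnS ?leq_addr //=.
  rewrite [X in _ = _ + X]big_nat [X in _ = _ + X]big1 ?addr0; last first.
    move=> i /andP[di _]; rewrite big1 // => k ik.
    by rewrite /G subnKC // I0 ?scaler0 // (leq_trans (ltnW di)).
  rewrite big_mkord; apply: eq_bigr => i _.
  rewrite -(big_mkord xpredT (G i)).
  have iN : (i <= N)%N by rewrite (leq_trans (ltnW (ltn_ord i))) // ltnS leq_addr.
  rewrite [RHS](big_cat_nat (n := i)) //=.
  rewrite [X in _ = X + _]big_nat_cond [X in _ = X + _]big1 ?add0r; last first.
    by move=> k /andP[/andP[_ ki]]; rewrite leqNgt ki.
  rewrite [RHS]big_nat_cond.
  rewrite [RHS](eq_bigl (fun k => (i <= k < N)%N)); last first.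
    by move=> k; case: (leqP i k); rewrite ?andbT ?andbF.
  rewrite -[RHS]big_nat -[X in index_iota X N]add0n [RHS]big_addn.
  rewrite [RHS](big_cat_nat (n := d.+1)) //=; last first.
    by rewrite leq_subRL // /N addnS !ltnS leq_add2r -ltnS.
  rewrite [X in _ = _ + X]big_nat [X in _ = _ + X]big1 ?addr0.
    by apply: eq_bigr => j _; rewrite addnK.
  move=> j /andP[dj _]; rewrite /G addnK I0 ?scaler0 //.
  by rewrite (leq_trans (ltnW dj)) // leq_addl.
rewrite (exchange_big_dep_nat xpredT) //=.
apply: eq_big_nat => k /andP[_ kN].
transitivity (\sum_(0 <= i < k.+1) G i (k - i)%N).
  by rewrite (big_nat_widen _ _ _ _ _ (kN : (k.+1 <= N)%N)).
rewrite [s + t]addrC exprDn scaler_suml big_mkord; apply: eq_bigr => i _.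
have ik : (i <= k)%N by rewrite -ltnS.
by rewrite /G subnKC // -/(I k) [t ^+ _ * _]mulrC mulr_natr.
Qed.

Lemma root_mx0 (R : comPzRingType) a : root_mx a (0 : R) = 1%:M.
Proof.
rewrite /root_mx big_ord_recl expr0 scale1r big1 ?addr0; last first.
  by move=> k _; rewrite expr0n /= scale0r.
apply/matrixP => i j; rewrite !mxE /= divz1.
by case: eqP => _; rewrite ?rmorph1 ?rmorph0.
Qed.

Lemma root_mxN (R : comPzRingType) a (t : R) : a \in roots Phi ->
  root_mx a t *m root_mx a (- t) = 1%:M.
Proof. by move=> aP; rewrite root_mxD // subrr root_mx0. Qed.

Fact root_mxVN (R : comPzRingType) a (t : R) : a \in roots Phi ->
  root_mx a (- t) *m root_mx a t = 1%:M.
Proof. by move=> aP; rewrite root_mxD // addNr root_mx0. Qed.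

Definition root_elt (R : comPzRingType) a (aP : a \in roots Phi) (t : R) :
    GL R (rdim D) :=
  GLof (root_mxN t aP) (root_mxVN t aP).

End RootUnipotents.

(** * Subgroups *)

Section Subgroups.
Variable G : groupType.
Local Open Scope group_scope.
Implicit Types (S H K : set G).

Definition subgroup H : Prop :=
  [/\ H 1, forall g h, H g -> H h -> H (g * h) & forall g, H g -> H g^-1].

Definition generated S : set G := smallest subgroup S.

Definition normal_closure K H : set G :=
  generated [set k * h * k^-1 | k in K & h in H].

(* The convention [h, k] = h k h^-1 k^-1 differs from mathcomp's [~ h, k]. *)
Definition commutator_subgroup H K : set G :=
  generated [set h * k * h^-1 * k^-1 | h in H & k in K].

End Subgroups.

(** * Ideals *)

Section Ideals.
Variable R : comPzRingType.
Implicit Types (I J m : set R).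

(* Not necessarily proper, unlike mathcomp's [idealr_closed]. *)
Definition ideal I : Prop :=
  [/\ I 0, forall x y, I x -> I y -> I (x + y) & forall r x, I x -> I (r * x)].

Definition maximal_ideal m : Prop :=
  [/\ ideal m, m != setT &
      forall J, ideal J -> m `<=` J -> J = m \/ J = setT].

Definition ideal_sum I J : set R := [set x + y | x in I & y in J].

Definition ideal_prod I J : set R := smallest ideal [set x * y | x in I & y in J].

Definition comaximal I J : Prop := ideal_sum I J = setT.

(* Some residue field R / m is isomorphic to k. *)
Definition has_residue_field (k : fieldType) : Prop :=
  exists2 m, maximal_ideal m &
  exists f : {rmorphism R -> k},
    (forall y, exists x, f x = y) /\ (forall x, f x = 0 <-> m x).

End Ideals.

(** * Elementary subgroups *)

Section Elementary.
Variables (l : nat) (Phi : rootSystem l) (P : set 'rV[rat]_l).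
Variables (D : chevalleyRep Phi P) (R : comPzRingType).

(* E(Phi, I); E(Phi, R) is the case I = setT. *)
Definition elementary (I : set R) : set (GL R (rdim D)) :=
  generated [set g | exists a (aP : a \in roots Phi) (t : R),
                       I t /\ g = root_elt D aP t].

(* E(Phi, R, I) *)
Definition relative_elementary (I : set R) : set (GL R (rdim D)) :=
  normal_closure (elementary setT) (elementary I).

End Elementary.

Arguments elementary {l Phi P} D {R} I.
Arguments relative_elementary {l Phi P} D {R} I.

(* Main.v *)
Require Import Defs.
From HB Require Import structures.
From mathcomp Require Import all_boot all_order all_algebra.
From mathcomp Require Import boolp classical_sets.
From mathcomp Require Import zify ring lra.
Import Defs.
Set Implicit Arguments.
Unset Strict Implicit.
Unset Printing Implicit Defensive.
Import Order.TTheory GRing.Theory Num.Theory.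
Local Open Scope ring_scope.

(** Modulo E(R, IJ), elements x_a(s) with s in I and x_b(t) with t in J commute
    for b <> -a by the Chevalley commutator formula, whose parameters are
    multiples of s^i t^j. For b = -a, write a = c + k d with c at the bottom of
    a d-string and 1 = s0 + t0 with s0 in I and t0 in J; then x_a(s s0^k) is, up
    to inversion, a factor of [x_c(s), x_d(s0)] and the other factors belong to
    roots different from a, hence commute with x_(-a)(t), while
    s - s s0^k lies in IJ. As x_a(r) = x_a(r s0) x_a(r t0), conjugation by E(R)
    reduces to conjugation by E(I) and E(J).

    Conversely let C be the commutator subgroup. Two roots of equal length at an
    angle of 2 pi / 3 whose difference is not a root give x_(c+d)(st) in C. In a
    B2 configuration, short roots give x_m(s t^2) and x_m(s^2 t) for the long
    root m, and (s0 + t0)^3 = 1 turns these into x_m(st); long roots give short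
    ones. So in an irreducible system without a G2 configuration all roots are
    obtained as soon as one is, and a first one comes from a pair of
    non-orthogonal roots of equal length, except in type B2. There, and for the
    short roots of G2, comparing [x_c(rs), x_d(t)] with [x_c(s), x_d(rt)]
    isolates x_(c+2d)((r^2 - r) s t^2), and the elements r^2 - r generate the
    unit ideal when no residue field is F_2.

    The commutator formula itself is proved over the integers. The entry (x, y)
    of a product of the x_(ia+jb) is graded by wt x - wt y = i a + j b. If g is
    such a product and h is a diagonal matrix given by a linear form on weights,
    then g h g^-1 - h lies in the span of the root vectors; so the lowest
    component of g - 1 is a multiple of a root vector, by an integer because
    root vectors are primitive, and it can be removed by induction. Parameters in R
    are put back by multiplying the entries of degree (i, j) by s^i t^j. *)

(** * Geometry of root systems *)

Section InvariantForm.
Variables (l : nat) (Phi : rootSystem l).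
Implicit Types (a b c u v w : 'rV[rat]_l).

(** The quadratic form sum of [pairing a f ^+ 2] over the roots, on linear forms. It is
    Weyl-invariant; [undup] makes the sum run over a set. *)
Definition coform : 'M[rat]_l := \sum_(a <- undup (roots Phi)) a^T *m a.

Lemma coformE (f : 'cV[rat]_l) :
  (f^T *m coform *m f) 0 0 = \sum_(a <- undup (roots Phi)) pairing a f ^+ 2.
Proof.
rewrite /coform mulmx_sumr mulmx_suml summxE; apply: eq_bigr => a _.
by rewrite mulmxA -trmx_mul -mulmxA mxE big_ord1 mxE expr2.
Qed.

Lemma coform_sym : coform^T = coform.
Proof.
rewrite /coform raddf_sum; apply: eq_bigr => a _ /=.
by rewrite trmx_mul trmxK.
Qed.

Lemma pairing_roots_eq0 (f : 'cV[rat]_l) :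
  (forall a, a \in roots Phi -> pairing a f = 0) -> f = 0.
Proof.
move=> f0.
pose phi : 'Hom('rV[rat]_l, 'M[rat]_(1,1)) := linfun (mulmxr f).
have: (<<roots Phi>> <= lker phi)%VS.
  apply/span_subvP => a aP; rewrite memv_ker lfunE /=.
  by apply/eqP/matrixP => i j; rewrite !ord1 [LHS]f0 // mxE.
rewrite roots_span => /subvP kerT; apply/matrixP => i j.
have := kerT (delta_mx 0 i) (memvf _); rewrite memv_ker lfunE /= => /eqP.
by rewrite -rowE => /matrixP/(_ 0 j); rewrite !mxE.
Qed.

Lemma coform_ge0 (f : 'cV[rat]_l) : 0 <= (f^T *m coform *m f) 0 0.
Proof. by rewrite coformE sumr_ge0 // => a _; rewrite sqr_ge0. Qed.

Lemma coform_eq0 (f : 'cV[rat]_l) : (f^T *m coform *m f) 0 0 = 0 -> f = 0.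
Proof.
rewrite coformE => /eqP; rewrite psumr_eq0 => [/allP f0|a _]; last exact: sqr_ge0.
apply: pairing_roots_eq0 => a aP.
by have := f0 a; rewrite mem_undup => /(_ aP) /=; rewrite sqrf_eq0 => /eqP.
Qed.

Lemma coform_unit : coform \in unitmx.
Proof.
rewrite -row_free_unit -kermx_eq0; apply/rowV0P => v /sub_kermxP v0.
apply: trmx_inj; rewrite trmx0; apply: coform_eq0.
by rewrite trmxK v0 mul0mx mxE.
Qed.

(** The reflection in [a] permutes the roots, so it preserves [coform]. As it differs from the
    identity by the rank one matrix [c *m a], invariance makes [coform *m c] proportional to
    [a^T]. *)
Lemma coform_coroot a : a \in roots Phi ->
  exists2 k, 0 < k & coform *m coroot Phi a = k *: a^T.
Proof.
move=> aP; set c := coroot Phi a.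
have ac : a *m c = 2%:M.
  by apply/matrixP => i j; rewrite !ord1 [LHS](coroot2 aP) mxE.
pose S : 'M[rat]_l := 1%:M - c *m a.
have SS : S *m S = 1%:M.
  rewrite {1}/S mulmxBl mul1mx /S mulmxBr mulmx1 mulmxA -(mulmxA c a c) ac.
  by rewrite mul_mx_scalar -scalemxAl scaler_nat mulr2n opprB addrK subrK.
have SE b : b *m S = b - pairing b c *: a.
  rewrite /S mulmxBr mulmx1 mulmxA; congr (_ - _).
  by rewrite (mx11_scalar (b *m c)) mul_scalar_mx.
have permS : perm_eq (map (mulmxr S) (undup (roots Phi))) (undup (roots Phi)).
  have injS : injective (mulmxr S : 'rV[rat]_l -> 'rV[rat]_l).
    by move=> u v /= /(congr1 (mulmxr S)) /=; rewrite -!mulmxA SS !mulmx1.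
  have uS : uniq (map (mulmxr S) (undup (roots Phi))).
    by rewrite map_inj_uniq ?undup_uniq.
  apply: uniq_perm; rewrite ?undup_uniq //.
  apply: (uniq_min_size uS _ _).2; last by rewrite size_map.
  move=> _ /mapP[b bP ->] /=; rewrite mem_undup SE.
  by rewrite mem_undup in bP; apply: reflection_root.
have inv : S^T *m coform *m S = coform.
  rewrite {1}/coform mulmx_sumr mulmx_suml /coform -[RHS](perm_big _ permS).
  rewrite big_map; apply: eq_bigr => b _ /=.
  by rewrite trmx_mul !mulmxA.
have GS : S^T *m coform = coform *m S.
  by rewrite -{2}inv -mulmxA SS mulmx1.
have h : a^T *m (c^T *m coform) = coform *m c *m a.
  move: GS; rewrite /S raddfB /= trmx1 mulmxBl mulmxBr mul1mx mulmx1 trmx_mul.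
  by move/addrI/oppr_inj; rewrite !mulmxA.
pose k := (c^T *m coform *m c) 0 0.
have k0 : 0 < k.
  rewrite lt_neqAle coform_ge0 andbT eq_sym; apply/eqP => /coform_eq0 c0.
  by move: (coroot2 aP); rewrite -/c c0 /pairing mulmx0 mxE => /eqP; rewrite eq_sym pnatr_eq0.
exists (k / 2); first by rewrite divr_gt0.
move/(congr1 (mulmxr c)): h => /=; rewrite -mulmxA (mx11_scalar (_ *m c)) -/k.
rewrite -[RHS]mulmxA ac !mul_mx_scalar => ha.
have -> : coform *m c = 2^-1 *: (2 *: (coform *m c)).
  by rewrite scalerA mulVf ?scale1r.
by rewrite -ha scalerA mulrC.
Qed.

(** The inverse of [coform]: an invariant scalar product, by which lengths and angles of roots are
    measured. *)
Definition rform u v : rat := (u *m invmx coform *m v^T) 0 0.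

Lemma rformDl u v w : rform (u + v) w = rform u w + rform v w.
Proof. by rewrite /rform !mulmxDl mxE. Qed.
Lemma rformZl k u v : rform (k *: u) v = k * rform u v.
Proof. by rewrite /rform -!scalemxAl mxE. Qed.
Lemma rformC u v : rform u v = rform v u.
Proof.
rewrite /rform -[RHS]trace_mx11 -mxtrace_tr trace_mx11 !trmx_mul trmxK trmx_inv.
by rewrite coform_sym mulmxA.
Qed.

Lemma rformDr u v w : rform u (v + w) = rform u v + rform u w.
Proof. by rewrite rformC rformDl !(rformC u). Qed.
Lemma rformZr k u v : rform u (k *: v) = k * rform u v.
Proof. by rewrite rformC rformZl (rformC u). Qed.
Lemma rformNl u v : rform (- u) v = - rform u v.
Proof. by rewrite -scaleN1r rformZl mulN1r. Qed.
Lemma rformNr u v : rform u (- v) = - rform u v.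
Proof. by rewrite rformC rformNl rformC. Qed.
Lemma rformMnl u v n : rform (u *+ n) v = n%:R * rform u v.
Proof. by rewrite -scaler_nat rformZl. Qed.
Lemma rformMnr u v n : rform u (v *+ n) = n%:R * rform u v.
Proof. by rewrite rformC rformMnl rformC. Qed.

Definition rformE := (rformDl, rformDr, rformZl, rformZr, rformNl, rformNr,
  rformMnl, rformMnr).

Lemma rform_coform u : let w := invmx coform *m u^T in
  rform u u = (w^T *m coform *m w) 0 0.
Proof.
by rewrite /= trmx_mul trmxK trmx_inv coform_sym -!mulmxA (mulKVmx coform_unit) /rform mulmxA.
Qed.

Lemma rform_ge0 u : 0 <= rform u u.
Proof. by rewrite rform_coform coform_ge0. Qed.

Lemma rform_eq0 u : rform u u = 0 -> u = 0.
Proof.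
rewrite rform_coform => /coform_eq0 u0; apply: trmx_inj.
by rewrite -[LHS](mulKVmx coform_unit) u0 mulmx0 trmx0.
Qed.

Lemma rform_gt0 u : u != 0 -> 0 < rform u u.
Proof.
move=> u0; rewrite lt_neqAle rform_ge0 andbT eq_sym.
by apply: contra_neq u0 => /rform_eq0.
Qed.

Lemma root_neq0 a : a \in roots Phi -> a != 0.
Proof. by move=> aP; apply: contraNneq (roots_neq0 Phi) => <-. Qed.

Lemma root_norm_gt0 a : a \in roots Phi -> 0 < rform a a.
Proof. by move=> /root_neq0/rform_gt0. Qed.

Lemma pairingE a v : a \in roots Phi ->
  pairing v (coroot Phi a) = 2 * rform v a / rform a a.
Proof.
move=> aP; have [k k0 Ek] := coform_coroot aP.
have E u : rform u a = k^-1 * pairing u (coroot Phi a).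
  rewrite /rform /pairing -[a^T](scalerK (lt0r_neq0 k0)) -Ek -scalemxAr mxE.
  by rewrite mulmxA mulmxKV ?coform_unit.
by rewrite !E coroot2 //; field; rewrite lt0r_neq0.
Qed.

Lemma pairing_form a v : a \in roots Phi ->
  2 * rform v a = pairing v (coroot Phi a) * rform a a.
Proof. by move=> aP; rewrite pairingE // divfK // lt0r_neq0 // root_norm_gt0. Qed.

Lemma root_opp a : a \in roots Phi -> - a \in roots Phi.
Proof.
move=> aP; have := reflection_root aP aP; rewrite coroot2 //.
by rewrite scaler_nat mulr2n opprD addNKr.
Qed.

Lemma root_oppE a : (- a \in roots Phi) = (a \in roots Phi).
Proof. by apply/idP/idP => /root_opp; rewrite ?opprK. Qed.

Lemma rform_nondeg v : (forall b, b \in roots Phi -> rform v b = 0) -> v = 0.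
Proof.
move=> v0; have /(congr1 (mulmx coform)) : invmx coform *m v^T = 0.
  by apply: pairing_roots_eq0 => b /v0; rewrite rformC /rform /pairing mulmxA.
by rewrite mulKVmx ?coform_unit // mulmx0 => /(congr1 trmx); rewrite trmxK trmx0.
Qed.

Hypothesis Phi_reduced : reduced Phi.

Lemma root_prop a k : a \in roots Phi -> k *: a \in roots Phi ->
  k *: a = a \/ k *: a = - a.
Proof.
by move=> aP /(Phi_reduced aP)[->|->]; [left; rewrite scale1r|right; rewrite scaleN1r].
Qed.

Lemma rform_cauchy a b : a \in roots Phi -> b \in roots Phi ->
  b != a -> b != - a -> rform a b ^+ 2 < rform a a * rform b b.
Proof.
(* Up to a factor, [w] is the component of [b] orthogonal to [a]; it is nonzero because [b] is not
   proportional to [a] in a reduced system. *)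
move=> aP bP ba bNa; have a0 := root_norm_gt0 aP.
pose w := rform a a *: b - rform a b *: a.
have w0 : w != 0.
  apply/eqP => /eqP; rewrite subr_eq0 => /eqP/(congr1 ( *:%R (rform a a)^-1)).
  rewrite scalerK ?lt0r_neq0 // scalerA => E.
  by move: bP ba bNa; rewrite E => /(root_prop aP)[]->; rewrite eqxx.
have := rform_gt0 w0; rewrite /w !rformE (rformC b a).
set e := (X in 0 < X); have -> : e = rform a a * (rform a a * rform b b - rform a b ^+ 2).
  by rewrite /e; ring.
by rewrite pmulr_rgt0 // subr_gt0.
Qed.

(** The Cartan integers [m] and [n] are positive and [m * n < 4] by Cauchy-Schwarz, so one of them
    is 1 and the other is the ratio of the square lengths. *)
Lemma angle a b : a \in roots Phi -> b \in roots Phi -> b != a ->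
  0 < rform a b -> exists2 k : nat, (0 < k <= 3)%N &
   2 * rform a b = rform b b /\ rform b b = k%:R * rform a a \/
   2 * rform a b = rform a a /\ rform a a = k%:R * rform b b.
Proof.
move=> aP bP ba ab0; have a0 := root_norm_gt0 aP; have b0 := root_norm_gt0 bP.
have bNa : b != - a.
  by apply: contraTneq ab0 => ->; rewrite rformNr oppr_gt0 lt_gtF.
have /intrP[m Em] := pairing_int bP aP; have /intrP[n En] := pairing_int aP bP.
have Fm := pairing_form a bP; have Fn := pairing_form b aP.
rewrite Em in Fm; rewrite En (rformC b) in Fn.
have m0 : 0 < m.
  by rewrite -(ltr0z rat) -(pmulr_lgt0 _ b0) -Fm mulr_gt0.
have n0 : 0 < n.
  by rewrite -(ltr0z rat) -(pmulr_lgt0 _ a0) -Fn mulr_gt0.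
have mn : m * n < 4.
  rewrite -(ltr_int rat) rmorphM /= -(ltr_pM2r (mulr_gt0 a0 b0)).
  have := rform_cauchy aP bP ba bNa.
  have -> : m%:~R * n%:~R * (rform a a * rform b b) = 4 * rform a b ^+ 2.
    have -> : 4 * rform a b ^+ 2 = (2 * rform a b) * (2 * rform a b) by ring.
    by rewrite {1}Fm Fn; ring.
  by move=> ?; rewrite ltr_pM2l.
have [m1|m1] := eqVneq m 1.
  exists `|n|%N; first by nia.
  left; rewrite Fm m1 mul1r; split=> //.
  by rewrite pmulrn gez0_abs ?ltW // -Fn Fm m1 mul1r.
have n1 : n = 1 by nia.
exists `|m|%N; first by nia.
right; rewrite Fn n1 mul1r; split=> //.
by rewrite pmulrn gez0_abs ?ltW // -Fm Fn n1 mul1r.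
Qed.

Lemma reflect_root a b : a \in roots Phi -> b \in roots Phi ->
  b - (2 * rform b a / rform a a) *: a \in roots Phi.
Proof. by move=> aP bP; rewrite -pairingE //; apply: reflection_root. Qed.

Lemma root_sub a b : a \in roots Phi -> b \in roots Phi -> b != a ->
  0 < rform a b -> a - b \in roots Phi.
Proof.
move=> aP bP ba ab0; have a0 := root_norm_gt0 aP; have b0 := root_norm_gt0 bP.
have [k _ [[E _]|[E _]]] := angle aP bP ba ab0.
  by have := reflect_root bP aP; rewrite E divff ?lt0r_neq0 // scale1r.
rewrite -root_oppE opprB.
by have := reflect_root aP bP; rewrite rformC E divff ?lt0r_neq0 // scale1r.
Qed.

Lemma root_add a b : a \in roots Phi -> b \in roots Phi -> b != - a ->
  rform a b < 0 -> a + b \in roots Phi.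
Proof.
move=> aP bP ba ab0; rewrite -[b]opprK; apply: root_sub; rewrite ?root_oppE //.
  by rewrite -[a in X in _ != X]opprK (inj_eq oppr_inj).
by rewrite rformNr oppr_gt0.
Qed.

Lemma string_notprop a b k : a \in roots Phi -> b \in roots Phi ->
  b != a -> b != - a -> (b + k *: a != a) && (b + k *: a != - a).
Proof.
move=> aP bP ba bNa.
have gen (c : rat) : b = c *: a -> False.
  by move=> E; move: bP ba bNa; rewrite E => /(root_prop aP)[]->; rewrite eqxx.
apply/andP; split; apply/eqP => E.
  by apply: (gen (1 - k)); rewrite scalerBl scale1r -[X in X - _]E addrK.
by apply: (gen (- 1 - k)); rewrite scalerBl scaleN1r -[X in X - _]E addrK.
Qed.

(** At an obtuse angle the sum is a root at once. Otherwise the later vectors all have a positive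
    product with [a], and subtracting [a] repeatedly leads down to [b + a]. *)
Lemma string_step a b q : a \in roots Phi -> b \in roots Phi ->
  b != a -> b != - a -> b + a *+ q.+1 \in roots Phi -> b + a \in roots Phi.
Proof.
move=> aP bP ba bNa; have a0 := root_norm_gt0 aP.
have [ab|ab] := ltP (rform b a) 0.
  by move=> _; apply: root_add => //; apply: contra_neq bNa => ->; rewrite opprK.
elim: q => [|q IHq]; first by rewrite mulr1n.
move=> cP; apply: IHq.
have /andP[ca cNa] := string_notprop q.+2%:R aP bP ba bNa.
rewrite scaler_nat in ca cNa.
have -> : b + a *+ q.+1 = (b + a *+ q.+2) - a by rewrite (mulrSr a q.+1) addrA addrK.
by apply: root_sub; rewrite // 1?eq_sym // !rformE ltr_wpDl // mulr_gt0.
Qed.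

Lemma string_unbroken a b q i : a \in roots Phi -> b \in roots Phi ->
  b != a -> b != - a -> b + a *+ q \in roots Phi -> (i <= q)%N ->
  b + a *+ i \in roots Phi.
Proof.
move=> aP bP ba bNa qP; elim: i => [|i IHi] iq; first by rewrite mulr0n addr0.
have /andP[ca cNa] := string_notprop i%:R aP bP ba bNa.
rewrite scaler_nat in ca cNa.
rewrite mulrSr addrA; apply: (@string_step _ _ (q - i.+1)) => //.
  exact/IHi/ltnW.
by rewrite -addrA -mulrnDr addnS -addSn subnKC.
Qed.

Lemma string_length_bottom a b j : a \in roots Phi -> b \in roots Phi ->
  b != a -> b != - a -> b - a \notin roots Phi -> b + a *+ j \in roots Phi ->
  string_length Phi a (b + a *+ j) j.
Proof.
move=> aP bP ba bNa baP bjP; split; first by rewrite addrK.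
move=> q; rewrite leqNgt; apply: contraL => jq; apply: contraNN baP => cP.
have E : b + (- a) *+ (q - j.+1).+1 = b + a *+ j - a *+ q.
  by rewrite subnSK // mulNrn mulrnBr ?(ltnW jq) // opprB addrA.
apply: (@string_step (- a) b (q - j.+1)); rewrite ?root_oppE ?opprK //.
by rewrite E.
Qed.

Lemma string_length_exists a b : a \in roots Phi -> b \in roots Phi ->
  exists p, string_length Phi a b p.
Proof.
move=> aP bP; have a0 := root_norm_gt0 aP.
(* [f] recovers p from the vector b - p a by comparing products with [a]; its maximum over the
   finite list of roots bounds p. *)
pose f c := Num.truncn ((rform b a - rform c a) / rform a a).
have ex : exists p, b - a *+ p \in roots Phi by exists 0; rewrite mulr0n subr0.
have bnd p : b - a *+ p \in roots Phi -> (p <= \max_(c <- roots Phi) f c)%N.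
  move=> cP; have <- : f (b - a *+ p) = p.
    rewrite /f !rformE (_ : _ / _ = p%:R) ?natrK //; field; exact: lt0r_neq0.
  exact: leq_bigmax_seq.
by exists (ex_maxn ex bnd); case: ex_maxnP => p pP pmax; split.
Qed.

End InvariantForm.

(** * Weight supports and primitivity of root vectors *)

Lemma triangle_sum (V : nmodType) (f : nat -> nat -> V) N :
  (forall i j, (N <= i + j)%N -> f i j = 0) ->
  \sum_(i < N) \sum_(j < N) f i j = \sum_(k < N) \sum_(i < k.+1) f i (k - i)%N.
Proof.
move=> f0.
transitivity (\sum_(i < N) \sum_(j < N) \sum_(k < N | k == (i + j)%N :> nat) f i j).
  apply: eq_bigr => i _; apply: eq_bigr => j _.
  have [ij|ij] := ltnP (i + j) N; last by rewrite f0 // big1.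
  by rewrite (big_pred1 (Ordinal ij)).
under eq_bigr => i _ do rewrite (exchange_big_dep xpredT) //=.
rewrite exchange_big /=; apply: eq_bigr => k _.
rewrite -(big_mkord xpredT (fun i => \sum_(j < N | k == (i + j)%N :> nat) f i j)).
rewrite (big_cat_nat (n := k.+1)) //= [X in _ + X]big_nat_cond [X in _ + X]big1 ?addr0.
  rewrite big_mkord; apply: eq_bigr => i _.
  have ik : (i <= k)%N by rewrite -ltnS.
  have kiN : (k - i < N)%N by rewrite (leq_ltn_trans (leq_subr _ _)).
  rewrite (big_pred1 (Ordinal kiN)) // => j.
  apply/eqP/eqP => [Ek|->]; last by rewrite /= subnKC.
  by apply: val_inj => /=; move: Ek; lia.
move=> i /andP[/andP[ki _] _]; rewrite big1 // => j /eqP E.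
by move: ki; rewrite E; lia.
Qed.

Lemma ratmx_inj n : injective (@ratmx n).
Proof.
by move=> A B /matrixP AB; apply/matrixP => i j; have := AB i j; rewrite !mxE => /intr_inj.
Qed.
Lemma ratmxM n (A B : 'M[int]_n) : ratmx (A *m B) = ratmx A *m ratmx B.
Proof. exact: map_mxM. Qed.
Lemma ratmxB n (A B : 'M[int]_n) : ratmx (A - B) = ratmx A - ratmx B.
Proof. exact: map_mxB. Qed.
Lemma ratmxZ n (c : int) (A : 'M[int]_n) : ratmx (c *: A) = c%:~R *: ratmx A.
Proof. exact: map_mxZ. Qed.

(** For even [d] half of [d * d] is still a multiple of [d]; for odd [d] the factor [q] must be
    even. *)
Lemma dvdz_sq_double (d q z : int) : 2 * z = q * (d * d) -> (d %| z)%Z.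
Proof.
have [e [->|->]] : exists e : int, d = 2 * e \/ d = 2 * e + 1.
- by exists (d %/ 2)%Z; lia.
- move=> Eq; apply/dvdzP; exists (q * e).
  by apply: (@mulfI _ (2 : int)) => //; rewrite Eq; ring.
have [r [->|->]] : exists r : int, q = 2 * r \/ q = 2 * r + 1.
- by exists (q %/ 2)%Z; lia.
- move=> Eq; apply/dvdzP; exists (r * (2 * e + 1)).
  by apply: (@mulfI _ (2 : int)) => //; rewrite Eq; ring.
move=> Eq; have : 2 * (z - (2 * r * e * e + 2 * r * e + r + 2 * e * e + 2 * e)
   - (r * (2 * e + 1) * (2 * e + 1) - 2 * r * e * e - 2 * r * e - r)) = 1.
  by rewrite !mulrBr Eq; ring.
by lia.
Qed.

Section Rep.
Variables (l : nat) (Phi : rootSystem l) (P : set 'rV[rat]_l).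
Variable (D : chevalleyRep Phi P).
Hypothesis Phi_reduced : reduced Phi.
Local Notation n := (rdim D).
Local Notation E a := (ratmx (rvec D a)).
Implicit Types (a b u v : 'rV[rat]_l) (S T U : 'rV[rat]_l -> Prop).

Definition wtd (x y : 'I_n) := wt x - wt y.

Lemma wtdD x y z : wtd x y + wtd y z = wtd x z.
Proof. by rewrite /wtd addrA subrK. Qed.

(** Matrices are graded by weight differences, and [S] is the set of degrees allowed; degrees add in
    products. *)
Definition supp (R : nmodType) S (A : 'M[R]_n) :=
  forall x y, A x y != 0 -> S (wtd x y).

Lemma suppS (R : nmodType) S T (A : 'M[R]_n) :
  supp S A -> (forall v : 'rV[rat]_l, S v -> T v) -> supp T A.
Proof. by move=> SA ST x y /SA/ST. Qed.

Lemma supp0 (R : nmodType) S : supp S (0 : 'M[R]_n).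
Proof. by move=> x y; rewrite mxE eqxx. Qed.

Lemma suppD (R : nmodType) S (A B : 'M[R]_n) : supp S A -> supp S B -> supp S (A + B).
Proof.
move=> SA SB x y; rewrite mxE; have [A0|/SA //] := eqVneq (A x y) 0.
by rewrite A0 add0r => /SB.
Qed.

Lemma suppN (R : zmodType) S (A : 'M[R]_n) : supp S A -> supp S (- A).
Proof. by move=> SA x y; rewrite mxE oppr_eq0 => /SA. Qed.

Lemma suppB (R : zmodType) S (A B : 'M[R]_n) : supp S A -> supp S B -> supp S (A - B).
Proof. by move=> SA SB; apply: suppD => //; apply: suppN. Qed.

Lemma supp_sum (R : nmodType) S (I : eqType) (s : seq I) (Q : pred I) (F : I -> 'M[R]_n) :
  (forall i, i \in s -> Q i -> supp S (F i)) -> supp S (\sum_(i <- s | Q i) F i).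
Proof.
move=> SF; rewrite big_seq_cond; elim/big_ind: _ => [|A B|i /andP[]].
- exact: supp0. - exact: suppD. - exact: SF.
Qed.

Lemma suppZ (R : pzSemiRingType) S (c : R) (A : 'M[R]_n) : supp S A -> supp S (c *: A).
Proof.
by move=> SA x y; rewrite mxE; have [->|/SA //] := eqVneq (A x y) 0; rewrite mulr0 eqxx.
Qed.

Lemma suppM (R : pzSemiRingType) S T U (A B : 'M[R]_n) :
  (forall u v, S u -> T v -> U (u + v)) ->
  supp S A -> supp T B -> supp U (A *m B).
Proof.
move=> STU SA TB x y; rewrite mxE => nz.
have /existsP[z] : [exists z, A x z * B z y != 0].
  apply: contraR nz => /existsPn z0.
  by rewrite big1 // => m _; apply/eqP; apply: negbNE.
have [->|/SA Sxz] := eqVneq (A x z) 0; first by rewrite mul0r eqxx.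
have [->|/TB Tzy] := eqVneq (B z y) 0; first by rewrite mulr0 eqxx.
by rewrite -(wtdD x z) => _; apply: STU.
Qed.

Lemma supp_diag (R : nmodType) (d : 'rV[R]_n) : supp (eq 0) (diag_mx d).
Proof.
move=> x y; rewrite mxE; case: (eqVneq x y) => [->|]; last by rewrite eqxx.
by rewrite /wtd subrr.
Qed.

Lemma supp_scalar (R : nmodType) (c : R) : supp (eq 0) (c%:M : 'M[R]_n).
Proof. by rewrite -diag_const_mx; apply: supp_diag. Qed.

Lemma supp_map (R R' : nmodType) (f : R -> R') S (A : 'M[R]_n) :
  f 0 = 0 -> supp S A -> supp S (map_mx f A).
Proof.
by move=> f0 SA x y; rewrite mxE; have [->|/SA //] := eqVneq (A x y) 0; rewrite f0 eqxx.
Qed.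

(** By the brackets with the [cartan_mx], the weight difference of a nonzero entry and [a] have the
    same pairing with every coroot, so they agree by nondegeneracy. *)
Lemma supp_rvec a : a \in roots Phi -> supp (eq a) (rvec D a).
Proof.
move=> aP x y nz; apply/esym/subr0_eq/rform_nondeg => b bP.
have /matrixP/(_ x y) := lie_cartan_root D aP bP.
rewrite /lie /cartan_mx !mxE.
rewrite (bigD1 x) //= big1 ?addr0; last first.
  by move=> z zx; rewrite !mxE eq_sym (negbTE zx) mulr0n mul0r.
rewrite (bigD1 y) //= big1 ?addr0; last first.
  by move=> z zy; rewrite !mxE (negbTE zy) mulr0n mulr0.
rewrite !mxE !eqxx !mulr1n [_ * pairing _ _]mulrC -mulrBl !pairingE //.
move/(mulIf (_ : (rvec D a x y)%:~R != 0 :> rat)).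
rewrite intr_eq0 => /(_ nz); rewrite -mulrBl.
move/(mulIf _)=> E; have {}/E E : (rform Phi b b)^-1 != 0.
  by rewrite invr_eq0 lt0r_neq0 // root_norm_gt0.
by rewrite !rformE; lra.
Qed.

Lemma supp_rvec_exp a k : a \in roots Phi -> supp (eq (a *+ k)) (rvec D a ^+ k).
Proof.
move=> aP; elim: k => [|k IHk]; first by rewrite expr0 mulr0n; apply: supp_scalar.
rewrite exprS mulrS; apply: suppM (supp_rvec aP) IHk.
by move=> u v <- <-.
Qed.

Lemma supp_divided_power a k : a \in roots Phi ->
  supp (eq (a *+ k)) (divided_power D a k).
Proof. by move=> aP; apply: supp_map; [rewrite div0z|apply: supp_rvec_exp]. Qed.

Lemma divided_power0 a : divided_power D a 0 = 1%:M.
Proof. by apply/matrixP => i j; rewrite !mxE divz1. Qed.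

Lemma divided_power1 a : divided_power D a 1 = rvec D a.
Proof. by apply/matrixP => i j; rewrite !mxE expr1 divz1. Qed.

Lemma root_mx_map (R R' : comPzRingType) (f : {rmorphism R -> R'}) a t :
  map_mx f (root_mx D a t) = root_mx D a (f t).
Proof.
rewrite /root_mx raddf_sum /=; apply: eq_bigr => k _.
by apply/matrixP => i j; rewrite !mxE rmorphM rmorphXn /= rmorph_int.
Qed.

Hypothesis P_lattice : intermediate_lattice Phi P.

Lemma root_weight_span b : b \in roots Phi ->
  inIntSpan [tuple wt i | i < n] b.
Proof.
move=> bP; apply/(weights_generate D).
have [_ _ + _] := P_lattice; apply.
have bi : (index b (roots Phi) < size (roots Phi))%N by rewrite index_mem.
exists [ffun i => (i == Ordinal bi)%:Z].
rewrite (bigD1 (Ordinal bi)) //= big1 => [|i /negbTE iF].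
  by rewrite ffunE eqxx mulr1z addr0 nth_index.
by rewrite ffunE iF mulr0z.
Qed.

Lemma pairing_weights_dvd a b (d : int) : b \in roots Phi ->
  (forall x : 'I_n, exists z : int, pairing (wt x) (coroot Phi a) = (d * z)%:~R) ->
  exists z : int, pairing b (coroot Phi a) = (d * z)%:~R.
Proof.
move=> /root_weight_span[m ->] wd.
exists (\sum_i m i * sval (cid (wd i))).
rewrite /pairing mulmx_suml summxE mulr_sumr rmorph_sum /=.
apply: eq_bigr => i _; case: cid => z /= Ez.
rewrite (nth_map i) ?size_enum_ord // nth_ord_enum -scaler_int -scalemxAl mxE.
by rewrite [X in _ * X]Ez -rmorphM /=; congr (_%:~R); ring.
Qed.

(** The diagonal of [e_a, e_(-a)] = h_a consists of the pairings of the weights with the coroot of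
    [a]. A divisor of e_a divides all of them, hence also the pairings of roots, which are integral
    combinations of weights. *)
Lemma rvec_dvd_pairing a b (d : int) : a \in roots Phi -> b \in roots Phi ->
  (forall x y, (d %| rvec D a x y)%Z) ->
  exists z : int, pairing b (coroot Phi a) = (d * z)%:~R.
Proof.
move=> aP bP dvd; apply: pairing_weights_dvd => // x.
have dvd_lie : (d %| (rvec D a *m rvec D (- a) - rvec D (- a) *m rvec D a)%R x x)%Z.
  rewrite 2!mxE [X in _ + X]mxE mxE; apply: rpredB; apply: rpred_sum => z _.
    exact: dvdz_mulr.
  exact: dvdz_mull.
have [z Ez] := dvdzP dvd_lie.
exists z; rewrite mulrC -Ez; have := lie_root_opp D aP.
rewrite /lie /ratmx -!map_mxM -map_mxB => /matrixP/(_ x x).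
by rewrite [in LHS]mxE => ->; rewrite !mxE eqxx.
Qed.

Lemma rvec_neq0 a : a \in roots Phi -> E a != 0.
Proof.
move=> aP; apply/eqP => E0.
have [x y|z] := @rvec_dvd_pairing a a 0 aP aP.
  by move/matrixP/(_ x y): E0; rewrite !mxE => /eqP; rewrite intr_eq0 => /eqP->.
by rewrite mul0r coroot2 // => /eqP; rewrite pnatr_eq0.
Qed.

Lemma rvec_primitive1 a b (d : int) : a \in roots Phi -> b \in roots Phi ->
  pairing b (coroot Phi a) = 1 -> (forall x y, (d %| rvec D a x y)%Z) -> (d %| 1)%Z.
Proof.
move=> aP bP ab1 dvd; have [z] := rvec_dvd_pairing aP bP dvd.
rewrite ab1 => /eqP; rewrite -[1]/(1%:~R) eqr_int => /eqP E1.
by rewrite -[X in (_ %| X)%Z]/(1%R : int) E1 dvdz_mulr.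
Qed.

Lemma string_length_lie a b p : a \in roots Phi -> b \in roots Phi ->
  b != a -> b != - a -> b - a \notin roots Phi -> b + a *+ p.+1 \in roots Phi ->
  exists s : bool, lie (E a) (E (b + a *+ p)) =
    ((-1) ^+ s * p.+1%:R) *: E (b + a *+ p.+1).
Proof.
move=> aP bP ba bNa baP cP.
have bpP : b + a *+ p \in roots Phi.
  by apply: (string_unbroken Phi_reduced aP bP ba bNa cP).
have Ec : a + (b + a *+ p) = b + a *+ p.+1 by rewrite mulrS addrCA.
have := @lie_root_root _ _ _ D a (b + a *+ p) p aP bpP.
rewrite Ec; apply=> //; exact: string_length_bottom.
Qed.

(** A root whose pairing with the coroot of [a] is 1 suffices. If [b] is longer by the ratio 3, the
    root [b - a] has pairing 3 - 2. If the ratio is 2, applying ad e_a twice to e_c with c = b - 2 a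
    gives 2 e_b up to sign; so d ^ 2 divides 2 e_b, whence [d] divides e_b, and [a] has pairing 1
    with the coroot of [b]. *)
Lemma rvec_primitive a b (d : int) : a \in roots Phi -> b \in roots Phi ->
  b != a -> 0 < rform Phi a b -> (forall x y, (d %| rvec D a x y)%Z) -> (d %| 1)%Z.
Proof.
move=> aP bP ba ab0 dvd; have a0 := root_norm_gt0 aP; have b0 := root_norm_gt0 bP.
have [k kle [[Eb Ek]|[Ea Ek]]] := angle Phi_reduced aP bP ba ab0; last first.
  apply: (rvec_primitive1 aP bP) => //.
  by rewrite pairingE // rformC Ea divff // lt0r_neq0.
have pair_k : pairing b (coroot Phi a) = k%:R.
  by rewrite pairingE // rformC Eb Ek mulfK // lt0r_neq0.
have [k1|k1] := eqVneq k 1%N; first by apply: (rvec_primitive1 aP bP) => //; rewrite pair_k k1.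
have [k3|k3] := eqVneq k 3%N.
  have cP : b - a \in roots Phi.
    by apply: (root_sub Phi_reduced bP aP); rewrite 1?eq_sym // rformC.
  apply: (rvec_primitive1 aP cP) => //; rewrite /pairing mulmxBl mxE [X in _ + X]mxE.
  by rewrite [X in X - _]pair_k [X in _ - X](coroot2 aP) k3; lra.
have {kle k1 k3} k2 : k = 2%N by lia.
rewrite {}k2 {k pair_k} in Ek.
pose c := b - a *+ 2.
have cP : c \in roots Phi.
  have := reflect_root aP bP; rewrite rformC Eb Ek mulfK ?lt0r_neq0 //.
  by rewrite scaler_nat.
have [ca cNa] : c != a /\ c != - a.
  have bNa : b != - a by apply: contraTneq ab0 => ->; rewrite rformNr oppr_gt0 lt_gtF.
  have := string_notprop Phi_reduced (- 2) aP bP ba bNa.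
  by rewrite scaleNr scaler_nat => /andP.
have Ec : c + a *+ 2 = b by rewrite subrK.
(* [c - a] would have 5 times the square length of [a], which [angle] excludes. *)
have caP : c - a \notin roots Phi.
  apply/negP => caP; have Faa : rform Phi a (- (c - a)) = 2 * rform Phi a a.
    by rewrite /c !rformE; lra.
  have [||k _] := angle Phi_reduced aP (root_opp caP); last 1 first.
  - have -> : rform Phi (- (c - a)) (- (c - a)) = 5 * rform Phi a a.
      by rewrite /c !rformE (rformC _ b a); lra.
    rewrite Faa => -[[? _]|[? _]]; lra.
  - apply/eqP => /(congr1 (fun v => a - v)); rewrite opprB subKr subrr => c0.
    by have := root_neq0 cP; rewrite c0 eqxx.
  - by rewrite Faa mulr_gt0.
have Ec1 : c + a *+ 0 = c by rewrite addr0.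
have ca1P : c + a *+ 1 \in roots Phi.
  by apply: (string_unbroken Phi_reduced aP cP ca cNa _ (isT : 1 <= 2)%N); rewrite Ec.
have [s1 L1] := string_length_lie aP cP ca cNa caP ca1P.
have [s2 L2] : exists s : bool, lie (E a) (E (c + a *+ 1)) =
    ((-1) ^+ s * 2%:R) *: E (c + a *+ 2).
  by apply: string_length_lie => //; rewrite Ec.
rewrite Ec1 in L1; rewrite Ec in L2.
pose A := rvec D a; pose C := rvec D c; pose B := rvec D b.
pose M := A *m (A *m C - C *m A) - (A *m C - C *m A) *m A.
have EM : exists s : bool, M = ((-1) ^+ s * 2) *: B.
  exists (s1 (+) s2); apply: ratmx_inj.
  have -> : ratmx M = lie (E a) (lie (E a) (E c)).
    by rewrite /M !(ratmxB, ratmxM).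
  rewrite L1 mulr1 {1}/lie -scalemxAl -scalemxAr -scalerBr -/(lie _ _) L2 scalerA ratmxZ.
  by rewrite signr_addb !rmorphM /= !rmorph_sign mulrA.
have [s {}EM] := EM.
pose A' := map_mx (fun z => z %/ d)%Z A.
have EA : A = d *: A'.
  by apply/matrixP => x y; rewrite !mxE mulrC divzK.
have dvdM x y : (d * d %| M x y)%Z.
  rewrite /M EA; do ![rewrite -scalemxAl | rewrite -scalemxAr | rewrite -scalerBr].
  rewrite scalerA mxE.
  exact: dvdz_mulr.
apply: (rvec_primitive1 bP aP).
  by rewrite pairingE // Eb divff // lt0r_neq0.
move=> x y; have /dvdzP[q] := dvdM x y; rewrite EM !mxE => Eq.
apply: (@dvdz_sq_double d ((-1) ^+ s * q)).
by rewrite -mulrA -Eq -mulrA signrMK.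
Qed.

End Rep.

(** * The Chevalley commutator formula *)

Section Conjugation.
Variables (l : nat) (Phi : rootSystem l) (P : set 'rV[rat]_l).
Variable (D : chevalleyRep Phi P).
Local Notation n := (rdim D).
Local Notation E a := (ratmx (rvec D a)).
Local Notation dp z k := (ratmx (divided_power D z k)).
Variable z : 'rV[rat]_l.
Hypothesis zP : z \in roots Phi.
Implicit Types A : 'M[rat]_n.

Lemma rvecM_dp k : E z *m dp z k = k.+1%:R *: dp z k.+1.
Proof.
rewrite -ratmxM -(divided_power1 D z) divided_powerM // ratmxZ add1n bin1.
by rewrite -pmulrn.
Qed.

Lemma dpM_rvec k : dp z k *m E z = k.+1%:R *: dp z k.+1.
Proof.
rewrite -ratmxM -(divided_power1 D z) divided_powerM // ratmxZ addn1 binSn.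
by rewrite -pmulrn.
Qed.

(* The k-th divided power of the derivation ad (e_z), applied to A. *)
Definition adk A k : 'M[rat]_n :=
  \sum_(i < k.+1) (-1) ^+ (k - i) *: (dp z i *m A *m dp z (k - i)).

Lemma adk0 A : adk A 0 = A.
Proof.
rewrite /adk big_ord1 expr0 scale1r divided_power0.
have -> : ratmx 1%:M = 1%:M :> 'M[rat]_n by rewrite /ratmx map_scalar_mx.
by rewrite mul1mx mulmx1.
Qed.

(** The two halves of the bracket weigh the term of index [i] by [i] and [k.+1 - i], which add up to
    [k.+1]. *)
Lemma lie_adk A k : lie (E z) (adk A k) = k.+1%:R *: adk A k.+1.
Proof.
pose g i j := (-1) ^+ j *: (dp z i *m A *m dp z j) : 'M[rat]_n.
have Eg i j : E z *m g i j = i.+1%:R *: g i.+1 j.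
  by rewrite /g -scalemxAr !mulmxA rvecM_dp -!scalemxAl scalerA mulrC -scalerA.
have gE i j : g i j *m E z = - (j.+1%:R *: g i j.+1).
  rewrite /g -scalemxAl -mulmxA dpM_rvec -scalemxAr !scalerA exprS mulN1r.
  by rewrite mulrN scaleNr opprK mulrC.
rewrite /adk; under eq_bigr do rewrite -/(g _ _).
under [in RHS]eq_bigr do rewrite -/(g _ _).
transitivity (\sum_(i < k.+2) (i%:R *: g i (k.+1 - i)%N)
    + \sum_(i < k.+2) ((k.+1 - i)%:R *: g i (k.+1 - i)%N)); last first.
  rewrite -big_split scaler_sumr; apply: eq_bigr => i _ /=.
  by rewrite -scalerDl -natrD subnKC // -ltnS.
rewrite [in RHS]big_ord_recl scale0r add0r.
rewrite [X in _ = _ + X]big_ord_recr /= subnn scale0r addr0.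
rewrite /lie mulmx_sumr mulmx_suml -sumrN; congr (_ + _); apply: eq_bigr => i _.
  by rewrite Eg.
by rewrite gE opprK subSn // -ltnS.
Qed.

Lemma adkS A k : adk A k.+1 = k.+1%:R^-1 *: lie (E z) (adk A k).
Proof. by rewrite lie_adk scalerA mulVf ?scale1r // pnatr_eq0. Qed.

(** This is exp(ad) in divided powers. From [n + n] on, every omitted term contains a divided power
    of index at least [n], which vanishes. *)
Lemma root_mx_conj A (c : rat) m : (n + n <= m)%N ->
  root_mx D z c *m A *m root_mx D z (- c) = \sum_(k < m.+1) c ^+ k *: adk A k.
Proof.
move=> nm; have lenm : (n <= m)%N by apply: leq_trans nm; apply: leq_addr.
rewrite !(root_mx_widen _ (m := m) zP) // !big_mkord.
rewrite !mulmx_suml.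
pose f i j := (c ^+ i * (- c) ^+ j) *: (dp z i *m A *m dp z j).
transitivity (\sum_(i < m.+1) \sum_(j < m.+1) f i j).
  apply: eq_bigr => i _; rewrite mulmx_sumr; apply: eq_bigr => j _.
  by rewrite -!scalemxAl -scalemxAr scalerA.
rewrite triangle_sum => [|i j ij].
  apply: eq_bigr => k _; rewrite scaler_sumr; apply: eq_bigr => i _.
  by rewrite scalerA /f (exprNn c) mulrCA -exprD subnKC 1?mulrC // -ltnS.
have dp0 k : (n <= k)%N -> dp z k = 0.
  by move=> nk; rewrite divided_power_eq0 // /ratmx map_mx0.
rewrite /f; have [ni|ni] := leqP n i; first by rewrite dp0 // !mul0mx scaler0.
by rewrite (dp0 j) ?mulmx0 ?scaler0 //; lia.
Qed.

End Conjugation.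

(** * The index set of the commutator formula *)

Definition cone_row N : seq (nat * nat) := [seq (i, N.+2 - i)%N | i <- iota 1 N.+1].

Fixpoint cone_seq N : seq (nat * nat) :=
  if N is M.+1 then cone_seq M ++ cone_row M else [::].

Lemma cone_seqS N : cone_seq N.+1 = cone_seq N ++ cone_row N. Proof. by []. Qed.

Lemma mem_cone_row N p :
  (p \in cone_row N) = [&& 0 < p.1, 0 < p.2 & p.1 + p.2 == N.+2]%N.
Proof.
apply/mapP/and3P => [[i]|[p1 p2 /eqP pN]].
  by rewrite mem_iota => ? ->; split; rewrite /=; lia.
exists p.1; first by rewrite mem_iota; lia.
by case: p p1 p2 pN => i j /= *; congr (_, _); lia.
Qed.

Lemma mem_cone_seq N p :
  (p \in cone_seq N) = [&& 0 < p.1, 0 < p.2 & p.1 + p.2 <= N.+1]%N.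
Proof.
elim: N => [|N IHN]; first by case: p => -[|i] [|j] //=; rewrite in_nil; lia.
by rewrite cone_seqS mem_cat IHN mem_cone_row; lia.
Qed.

Lemma uniq_cone_seq N : uniq (cone_seq N).
Proof.
elim: N => // N IHN; rewrite cone_seqS cat_uniq IHN.
rewrite map_inj_uniq ?iota_uniq ?andbT => [|i j []//].
by apply/hasPn => p; rewrite /= mem_cone_row mem_cone_seq; lia.
Qed.

Lemma sorted_cone_seq N :
  pairwise (fun p q : nat * nat => p.1 + p.2 <= q.1 + q.2)%N (cone_seq N).
Proof.
elim: N => // N IHN; rewrite cone_seqS pairwise_cat IHN.
have rowE p : p \in cone_row N -> (p.1 + p.2 = N.+2)%N.
  by rewrite mem_cone_row => /and3P[_ _ /eqP].
apply/andP; split.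
  by apply/allrelP => p q; rewrite mem_cone_seq => /and3P[_ _ /leqW pN] /rowE ->.
by apply/(pairwiseP (0, 0)%N) => i j /(mem_nth (0, 0)%N)/rowE -> /(mem_nth (0, 0)%N)/rowE ->.
Qed.

(** The pairs (1, 1) and (1, 2) come first, so that the product of their two factors can be split
    off. *)
Lemma cone_seqE N : exists s, cone_seq N.+2 = [:: (1, 1), (1, 2) & s]%N.
Proof.
elim: N => [|N [s Es]]; first by exists [:: (2, 1)%N].
by rewrite cone_seqS Es; eexists.
Qed.

(** * Combinations of two non-proportional roots, and factorization over the integers *)

Section Cone.
Variables (l : nat) (Phi : rootSystem l) (P : set 'rV[rat]_l).
Variable (D : chevalleyRep Phi P).
Hypothesis Phi_reduced : reduced Phi.
Hypothesis P_lattice : intermediate_lattice Phi P.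
Local Notation n := (rdim D).
Local Notation E a := (ratmx (rvec D a)).
Variables (a b : 'rV[rat]_l).
Hypotheses (aP : a \in roots Phi) (bP : b \in roots Phi).
Hypotheses (ba : b != a) (bNa : b != - a).
Implicit Types (p q : nat * nat) (u v : 'rV[rat]_l) (A B : 'M[rat]_n).

Let det : rat := rform Phi a a * rform Phi b b - rform Phi a b ^+ 2.
Let det0 : det != 0.
Proof. by rewrite subr_eq0 gt_eqF // rform_cauchy. Qed.

(** [coord1] and [coord2] solve v = i a + j b by Cramer's rule with the Gram determinant [det];
    outside the plane of [a] and [b] they are the coordinates of the orthogonal projection. *)
Definition coord1 v : rat :=
  (rform Phi v a * rform Phi b b - rform Phi v b * rform Phi a b) / det.
Definition coord2 v : rat :=
  (rform Phi v b * rform Phi a a - rform Phi v a * rform Phi a b) / det.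
Definition height v : rat := coord1 v + coord2 v.

Definition comb p : 'rV[rat]_l := a *+ p.1 + b *+ p.2.

Lemma coord1_comb p : coord1 (comb p) = p.1%:R.
Proof.
rewrite /coord1 /comb !rformE (rformC _ b a).
set e := (X in X / _); have -> : e = p.1%:R * det by rewrite /e /det; ring.
by rewrite mulfK.
Qed.

Lemma coord2_comb p : coord2 (comb p) = p.2%:R.
Proof.
rewrite /coord2 /comb !rformE (rformC _ b a).
set e := (X in X / _); have -> : e = p.2%:R * det by rewrite /e /det; ring.
by rewrite mulfK.
Qed.

Lemma coord1D u v : coord1 (u + v) = coord1 u + coord1 v.
Proof. by rewrite /coord1 !rformE -mulrDl; congr (_ / _); ring. Qed.
Lemma coord2D u v : coord2 (u + v) = coord2 u + coord2 v.
Proof. by rewrite /coord2 !rformE -mulrDl; congr (_ / _); ring. Qed.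

Lemma coord1B u v : coord1 (u - v) = coord1 u - coord1 v.
Proof. by rewrite -[u in RHS](subrK v) [in RHS]coord1D addrK. Qed.
Lemma coord2B u v : coord2 (u - v) = coord2 u - coord2 v.
Proof. by rewrite -[u in RHS](subrK v) [in RHS]coord2D addrK. Qed.

Definition deg p := (p.1 + p.2)%N.

Lemma height_comb p : height (comb p) = (deg p)%:R.
Proof. by rewrite /height coord1_comb coord2_comb natrD. Qed.

Lemma comb_inj : injective comb.
Proof.
move=> [i j] [i' j'] Ec; congr (_, _); apply/eqP; rewrite -(eqr_nat rat).
  by rewrite -(coord1_comb (i, j)) Ec coord1_comb.
by rewrite -(coord2_comb (i, j)) Ec coord2_comb.
Qed.

Definition addp p q : nat * nat := (p.1 + q.1, p.2 + q.2)%N.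

Lemma combD p q : comb (addp p q) = comb p + comb q.
Proof. by rewrite /comb /addp /= !mulrnDr addrACA. Qed.

Lemma comb0 p : comb p = 0 -> p = (0, 0)%N.
Proof. by move=> p0; apply: comb_inj; rewrite p0 /comb !mulr0n addr0. Qed.

Definition rvecp p : 'M[rat]_n := if comb p \in roots Phi then E (comb p) else 0.

Lemma supp_rvecp p : supp (D := D) (eq (comb p)) (rvecp p).
Proof.
rewrite /rvecp; case: ifP => pP; last exact: supp0.
by apply: supp_map; [|apply: supp_rvec].
Qed.

Lemma lie_rvecp p q : comb p \in roots Phi ->
  exists c : rat, lie (E (comb p)) (rvecp q) = c *: rvecp (addp p q).
Proof.
move=> pP; rewrite /rvecp; case: ifP => qP; last first.
  by exists 0; rewrite scale0r /lie mulmx0 mul0mx subr0.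
rewrite combD; case: ifP => pqP.
  have [k kP] := string_length_exists pP qP.
  by have [s Es] := lie_root_root D pP qP pqP kP; exists ((-1) ^+ s * k.+1%:R).
exists 0; rewrite scale0r lie_root_root0 ?pqP // -combD.
(* The sum of the two combinations is not 0: otherwise [p] would be (0, 0) and [comb p] the root
   0. *)
apply: contraTneq (roots_neq0 Phi) => /comb0 [] /eqP; rewrite addn_eq0 => /andP[/eqP p1 _].
move=> /eqP; rewrite addn_eq0 => /andP[/eqP p2 _].
by move: pP; rewrite /comb p1 p2 !mulr0n addr0 => ->.
Qed.

Definition cone_span A := exists s : seq (rat * (nat * nat)),
  A = \sum_(h <- s) h.1 *: rvecp h.2.

Lemma cone_spanD A B : cone_span A -> cone_span B -> cone_span (A + B).
Proof. by move=> [s ->] [s' ->]; exists (s ++ s'); rewrite big_cat. Qed.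

Lemma cone_span_rvecp c p : cone_span (c *: rvecp p).
Proof. by exists [:: (c, p)]; rewrite big_seq1. Qed.

Lemma cone_span0 : cone_span 0.
Proof. by exists [::]; rewrite big_nil. Qed.

Lemma cone_spanZ c A : cone_span A -> cone_span (c *: A).
Proof.
move=> [s ->]; exists [seq (c * h.1, h.2) | h <- s].
by rewrite big_map scaler_sumr; apply: eq_bigr => h _; rewrite scalerA.
Qed.

Lemma cone_span_sum (I : Type) (s : seq I) (F : I -> 'M[rat]_n) :
  (forall i, cone_span (F i)) -> cone_span (\sum_(i <- s) F i).
Proof.
by move=> FP; elim/big_ind: _ => [|A B|i _]; [apply: cone_span0|apply: cone_spanD|].
Qed.

Lemma cone_span_lie p A : comb p \in roots Phi -> cone_span A ->
  cone_span (lie (E (comb p)) A).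
Proof.
move=> pP [s ->].
have -> : lie (E (comb p)) (\sum_(h <- s) h.1 *: rvecp h.2)
   = \sum_(h <- s) h.1 *: lie (E (comb p)) (rvecp h.2).
  rewrite /lie mulmx_sumr mulmx_suml -sumrB; apply: eq_bigr => h _.
  by rewrite -scalemxAr -scalemxAl scalerBr.
apply: cone_span_sum => h; apply: cone_spanZ.
by have [c ->] := lie_rvecp h.2 pP; apply: cone_span_rvecp.
Qed.

(** Apart from [A], the terms of the conjugate are iterated brackets that start from the bracket of
    e_p with [A]. So [A] itself may lie outside the span, as [height_mx] does. *)
Lemma cone_span_conj p c A : comb p \in roots Phi ->
  cone_span (lie (E (comb p)) A) ->
  cone_span (root_mx D (comb p) c *m A *m root_mx D (comb p) (- c) - A).
Proof.
move=> pP AP; rewrite (root_mx_conj _ _ _ (leqnn _)) // big_ord_recl expr0 scale1r adk0 addrC addKr.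
apply: cone_span_sum => k; apply: cone_spanZ => /=.
elim: {k}(k : nat) => [|k IHk]; rewrite adkS //; apply: cone_spanZ.
  by rewrite adk0.
exact: cone_span_lie.
Qed.

Lemma cone_span_comp A p : cone_span A -> exists c : rat,
  forall x y : 'I_n, wtd x y = comb p -> A x y = c * rvecp p x y.
Proof.
move=> [s ->]; exists (\sum_(h <- s | h.2 == p) h.1) => x y xy.
rewrite summxE mulr_suml [RHS]big_mkcond /=; apply: eq_bigr => h _; rewrite mxE.
case: eqVneq => [->//|qp].
have [->|/supp_rvecp] := eqVneq (rvecp h.2 x y) 0; first by rewrite mulr0.
by rewrite xy => /comb_inj/eqP; rewrite (negbTE qp).
Qed.

(** Its bracket with a root vector multiplies the vector by minus its degree, so conjugating it
    detects degrees. *)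
Definition height_mx : 'M[rat]_n := diag_mx (\row_i height (wt i)).

Lemma lie_height p : comb p \in roots Phi ->
  lie (E (comb p)) height_mx = - (deg p)%:R *: rvecp p.
Proof.
move=> pP; have EE : rvecp p = E (comb p) by rewrite /rvecp pP.
apply/matrixP => x y; rewrite /lie mul_mx_diag mul_diag_mx -EE !mxE.
have [->|/supp_rvecp Exy] := eqVneq (rvecp p x y) 0; first by rewrite !(mulr0, mul0r) subr0.
rewrite -height_comb Exy /wtd /height coord1B coord2B; ring.
Qed.

Definition cone v := exists p, v = comb p.

(* r' is meant to be the inverse of r; the last two conditions say that
   conjugation by r preserves the span and moves h into h + the span. *)
Definition unipotent_pair (r r' : 'M[int]_n) : Prop :=
  [/\ r *m r' = 1%:M, supp (D := D) cone r, supp (D := D) cone r',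
      forall A, cone_span A -> cone_span (ratmx r *m A *m ratmx r') &
      cone_span (ratmx r *m height_mx *m ratmx r' - height_mx)].

Lemma unipotent_pair1 : unipotent_pair 1%:M 1%:M.
Proof.
have s1 : supp (D := D) cone (1%:M : 'M[int]_n).
  apply: (suppS (@supp_scalar _ _ _ D _ (1 : int))) => v <-; exists (0, 0)%N.
  by rewrite /comb !mulr0n addr0.
have r1 : ratmx 1%:M = 1%:M :> 'M[rat]_n by rewrite /ratmx map_scalar_mx.
split; rewrite ?r1 ?mulmx1 //; first by move=> A; rewrite mul1mx mulmx1.
by rewrite mul1mx subrr; apply: cone_span0.
Qed.

Lemma cone_add u v : cone u -> cone v -> cone (u + v).
Proof. by move=> [p ->] [q ->]; exists (addp p q); rewrite combD. Qed.

Lemma unipotent_pairM r1 r1' r2 r2' : unipotent_pair r1 r1' ->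
  unipotent_pair r2 r2' -> unipotent_pair (r1 *m r2) (r2' *m r1').
Proof.
move=> [e1 s1 s1' L1 h1] [e2 s2 s2' L2 h2]; split.
- by rewrite mulmxA -(mulmxA r1) e2 mulmx1.
- exact: suppM cone_add s1 s2.
- exact: suppM cone_add s2' s1'.
- by move=> A /L2/L1; rewrite !ratmxM !mulmxA.
(* r1 r2 h r2' r1' - h is the conjugate by r1 of r2 h r2' - h, plus r1 h r1' - h. *)
have := cone_spanD (L1 _ h2) h1; rewrite !ratmxM mulmxBr mulmxBl.
by rewrite addrA subrK !mulmxA.
Qed.

Lemma root_mx_ratmx z (c : int) : ratmx (root_mx D z c) = root_mx D z c%:~R.
Proof. exact: root_mx_map. Qed.

Lemma supp_root_mx (R : comPzRingType) p (c : R) : comb p \in roots Phi ->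
  supp (D := D) cone (root_mx D (comb p) c).
Proof.
move=> pP; apply: supp_sum => k _ _; apply: suppZ; apply: supp_map => //.
apply: (suppS (@supp_divided_power _ _ _ D _ k pP)) => v <-.
by exists (p.1 * k, p.2 * k)%N; rewrite /comb mulrnDl -!mulrnA.
Qed.

Lemma unipotent_pair_root p (c : int) : (comb p \notin roots Phi -> c = 0) ->
  unipotent_pair (root_mx D (comb p) c) (root_mx D (comb p) (- c)).
Proof.
have [pP _|_ ->//] := boolP (comb p \in roots Phi); last first.
  by rewrite oppr0 !root_mx0; apply: unipotent_pair1.
split; first exact: root_mxN.
- exact: supp_root_mx.
- exact: supp_root_mx.
- move=> A AP; rewrite !root_mx_ratmx rmorphN /=.
  rewrite -[X in cone_span X](subrK A); apply: cone_spanD => //.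
  by apply: cone_span_conj => //; apply: cone_span_lie.
rewrite !root_mx_ratmx rmorphN /=; apply: cone_span_conj => //.
by rewrite lie_height //; apply: cone_span_rvecp.
Qed.

Lemma comb_notprop p : (0 < p.1)%N -> (0 < p.2)%N ->
  [/\ comb p != a, comb p != - a, comb p != b & comb p != - b].
Proof.
move=> p1 p2; split; apply/eqP => /(congr1 (fun v => (coord1 v, coord2 v))) [].
all: rewrite coord1_comb coord2_comb.
- have -> : a = comb (1, 0) by rewrite /comb mulr0n addr0.
  by rewrite coord2_comb => _ /eqP; rewrite pnatr_eq0 -leqn0 leqNgt p2.
- rewrite -[- a]sub0r coord1B coord2B.
  have -> : a = comb (1, 0) by rewrite /comb mulr0n addr0.
  have -> : 0 = comb (0, 0) by rewrite /comb !mulr0n addr0.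
  by rewrite !coord2_comb subr0 => _ /eqP; rewrite pnatr_eq0 -leqn0 leqNgt p2.
- have -> : b = comb (0, 1) by rewrite /comb mulr0n add0r.
  by rewrite coord1_comb => /eqP; rewrite pnatr_eq0 -leqn0 leqNgt p1.
- rewrite -[- b]sub0r coord1B coord2B.
  have -> : b = comb (0, 1) by rewrite /comb mulr0n add0r.
  have -> : 0 = comb (0, 0) by rewrite /comb !mulr0n addr0.
  by rewrite !coord1_comb subr0 => /eqP; rewrite pnatr_eq0 -leqn0 leqNgt p1.
Qed.

(** The square length of [comb p] is a combination of its products with [a] and [b], so one of these
    is nonzero and [rvec_primitive] applies with that root or its opposite. *)
Lemma rvec_comb_primitive p (d : int) : comb p \in roots Phi ->
  (0 < p.1)%N -> (0 < p.2)%N ->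
  (forall x y, (d %| rvec D (comb p) x y)%Z) -> (d %| 1)%Z.
Proof.
move=> pP p1 p2; have [pa pNa pb pNb] := comb_notprop p1 p2.
have gen z : z \in roots Phi -> comb p != z -> comb p != - z ->
  rform Phi (comb p) z != 0 ->
  (forall x y, (d %| rvec D (comb p) x y)%Z) -> (d %| 1)%Z.
  move=> zP pz pNz; rewrite neq_lt => /orP[z0|z0].
    apply: (rvec_primitive Phi_reduced P_lattice pP (root_opp zP)).
      by rewrite eq_sym.
    by rewrite rformNr oppr_gt0.
  by apply: (rvec_primitive Phi_reduced P_lattice pP zP); rewrite // eq_sym.
have [pa0|] := eqVneq (rform Phi (comb p) a) 0; last exact: gen.
have [pb0|] := eqVneq (rform Phi (comb p) b) 0; last exact: gen.
have := root_norm_gt0 pP.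
by rewrite {2}/comb rformDr !rformMnr pa0 pb0 !mulr0 addr0 ltxx.
Qed.

(** By coprimality the denominator of [c] divides every entry of the root vector, so it is 1. *)
Lemma primitive_coef p (c : rat) : comb p \in roots Phi ->
  (0 < p.1)%N -> (0 < p.2)%N ->
  (forall x y, exists m : int, c * (rvec D (comb p) x y)%:~R = m%:~R) ->
  exists k : int, c = k%:~R.
Proof.
move=> pP p1 p2 cint; exists (numq c).
have d0 : (denq c)%:~R != 0 :> rat by rewrite intr_eq0 denq_neq0.
suff d1 : denq c = 1 by rewrite -[LHS]divq_num_den d1 divr1.
suff : (denq c %| 1)%Z.
  by rewrite dvdz1 => /eqP d1; rewrite -[denq c]gez0_abs ?denq_ge0 // d1.
apply: (rvec_comb_primitive pP p1 p2) => x y.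
have [m] := cint x y; rewrite -[c in LHS]divq_num_den => Em.
have cop : coprimez (denq c) (numq c).
  by rewrite coprimezE coprime_sym coprime_num_den.
rewrite -(Gauss_dvdzr _ cop); apply/dvdzP; exists m.
by apply: (@intr_inj rat); rewrite !rmorphM /= -Em; field.
Qed.

Definition degset d v := exists2 p, (d <= deg p)%N & v = comb p.

Lemma degset_cone d u v : degset d u -> cone v -> degset d (u + v).
Proof.
move=> [p dp ->] [q ->]; exists (addp p q); rewrite ?combD // /deg /addp /=.
by move: dp; rewrite /deg; lia.
Qed.

Lemma degsetD d d' u v : degset d u -> degset d' v -> degset (d + d') (u + v).
Proof.
move=> [p dp ->] [q dq ->]; exists (addp p q); rewrite ?combD // /deg /addp /=.
by move: dp dq; rewrite /deg; lia.
Qed.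

(** Put q1 = r - 1 and L = r h r' - h. Then q1 h - h q1 = L r = L + L q1, and L q1 starts only in
    twice the lowest degree d. In degree [p] the left side is -d times q1, while L is a multiple of
    the root vector; the multiple is integral by primitivity. *)
Lemma lowest_coef p r r' : (0 < p.1)%N -> (0 < p.2)%N ->
  unipotent_pair r r' -> supp (D := D) (degset (deg p)) (r - 1%:M) ->
  exists2 c : int, (comb p \notin roots Phi -> c = 0) &
    forall x y, wtd x y = comb p -> r x y = c * rvec D (comb p) x y.
Proof.
move=> p1 p2 [rr' sr sr' Lr hr] s1.
set d := deg p; have d0 : (0 < d)%N by rewrite addn_gt0 p1.
pose h := height_mx; pose q : 'M[rat]_n := ratmx r; pose q' : 'M[rat]_n := ratmx r'.
have ratmx1 : ratmx 1%:M = 1%:M :> 'M[rat]_n by rewrite /ratmx map_scalar_mx.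
have q'q : q' *m q = 1%:M by rewrite -ratmxM (mulmx1C rr') ratmx1.
pose q1 := q - 1%:M.
have sq1 : supp (D := D) (degset d) q1.
  by rewrite /q1 -ratmx1 -ratmxB; apply: supp_map.
pose L := q *m h *m q' - h; have Lspan : cone_span L := hr.
have Lq : L *m q = q1 *m h - h *m q1.
  rewrite /L mulmxBl -!mulmxA q'q mulmx1 /q1 mulmxBl mulmxBr mul1mx mulmx1.
  by rewrite opprB addrA subrK.
have qq' : q *m q' = 1%:M by rewrite -ratmxM rr' ratmx1.
have LE : L = (q1 *m h - h *m q1) *m q' by rewrite -Lq -mulmxA qq' mulmx1.
have sh : supp (D := D) (eq 0) h by apply: supp_diag.
have sL : supp (D := D) (degset d) L.
  rewrite LE; apply: suppM (@degset_cone d) _ (supp_map _ sr') => //.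
  apply: suppB.
    by apply: suppM sq1 sh => u v + <-; rewrite addr0.
  by apply: suppM sh sq1 => u v <-; rewrite add0r.
have sLq1 : supp (D := D) (degset (d + d)) (L *m q1).
  exact: suppM (@degsetD d d) sL sq1.
have [c0 Ec0] := cone_span_comp p Lspan.
have rE x y : wtd x y = comb p -> (r x y)%:~R = - c0 / d%:R * rvecp p x y.
  move=> xy; have /matrixP/(_ x y) : q1 *m h - h *m q1 = L + L *m q1.
    by rewrite -Lq -{1}[q](subrK 1%:M) -/q1 mulmxDr mulmx1 addrC.
  have L0 : (L *m q1) x y = 0.
    apply/eqP; apply: contraTT isT => /sLq1; rewrite xy => -[p' dp' /comb_inj pp'].
    by move: dp'; rewrite -pp' -/d; lia.
  have xy_neq : (x == y) = false.
    apply: contraTF isT => /eqP exy; move: xy; rewrite exy /wtd subrr.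
    by move/esym/comb0 => pE; move: p1; rewrite pE.
  rewrite mul_mx_diag mul_diag_mx [in LHS]mxE [in RHS]mxE L0 addr0 (Ec0 x y xy).
  rewrite !mxE xy_neq /= mulr0n subr0.
  move=> E1; have dE : height (wt x) - height (wt y) = d%:R.
    by rewrite -height_comb -xy /wtd /height coord1B coord2B; ring.
  have dn0 : d%:R != 0 :> rat by rewrite pnatr_eq0 -lt0n.
  apply: (mulfI dn0); rewrite -{1}dE mulrA mulrCA divff // mulr1 mulNr -E1; ring.
have [pP|pP] := boolP (comb p \in roots Phi); last first.
  exists 0 => // x y xy; rewrite mul0r; apply: (@intr_inj rat).
  by rewrite (rE x y xy) /rvecp (negbTE pP) mxE mulr0.
have pE : rvecp p = E (comb p) by rewrite /rvecp pP.
have [x y|k Ek] := @primitive_coef p (- c0 / d%:R) pP p1 p2.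
  have [xy|xy] := eqVneq (wtd x y) (comb p).
    by exists (r x y); rewrite (rE x y xy) pE mxE.
  exists 0; suff -> : rvec D (comb p) x y = 0 by rewrite mulr0.
  apply/eqP; apply: contraNT xy => /(supp_rvec pP) <- //.
exists k => [//|x y xy].
by apply: (@intr_inj rat); rewrite (rE x y xy) Ek pE mxE rmorphM.
Qed.

Definition multiples p m v := exists2 k, (m <= k)%N & v = comb p *+ k.

Lemma supp_root_mx2 p (c : int) : (comb p \notin roots Phi -> c = 0) ->
  supp (D := D) (multiples p 2)
    (root_mx D (comb p) c - 1%:M - c *: rvec D (comb p)).
Proof.
have [pP _|_ ->//] := boolP (comb p \in roots Phi); last first.
  by rewrite root_mx0 subrr scale0r subrr; apply: supp0.
rewrite (root_mx_widen _ (m := n.+1) pP) // 2?big_ltn //.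
rewrite divided_power0 divided_power1 expr0 scale1r expr1.
have -> : map_mx intr 1%:M = 1%:M :> 'M[int]_n by rewrite map_scalar_mx.
have -> : map_mx intr (rvec D (comb p)) = rvec D (comb p).
  by apply/matrixP => x y; rewrite mxE intz.
rewrite [1%:M + _]addrC addrK [_ *: _ + _]addrC addrK.
rewrite big_seq; apply: supp_sum => k; rewrite mem_index_iota => k2 _.
apply: suppZ; apply: supp_map => //.
apply: (suppS (@supp_divided_power _ _ _ D _ k pP)) => v <-.
by exists k; case/andP: k2.
Qed.

Lemma supp_root_mx1 p (c : int) : (comb p \notin roots Phi -> c = 0) ->
  supp (D := D) (multiples p 1) (root_mx D (comb p) c - 1%:M).
Proof.
move=> pc; rewrite -[X in supp _ X](subrK (c *: rvec D (comb p))).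
apply: suppD.
  by apply: (suppS (supp_root_mx2 pc)) => v [k k2 ->]; exists k => //; apply: ltnW.
have [pP|pP] := boolP (comb p \in roots Phi); last first.
  by rewrite pc // scale0r; apply: supp0.
by apply: suppZ; apply: (suppS (supp_rvec pP)) => v <-; exists 1%N.
Qed.

Lemma deg_multiple p k : (0 < p.1)%N -> (0 < p.2)%N -> (1 < k)%N ->
  (deg p < deg (p.1 * k, p.2 * k))%N && (0 < p.1 * k)%N && (0 < p.2 * k)%N.
Proof.
case: p k => i j [|[|k]] //= i0 j0 _; rewrite /deg /= !muln_gt0 i0 j0 !andbT.
by rewrite !mulnS; lia.
Qed.

Lemma combMn p k : comb p *+ k = comb (p.1 * k, p.2 * k)%N.
Proof. by rewrite /comb mulrnDl -!mulrnA. Qed.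

(** Only pairs that occur as a weight difference can carry nonzero entries, and there are finitely
    many of them. *)
Definition realized p :=
  [/\ (0 < p.1)%N, (0 < p.2)%N & exists x y : 'I_n, wtd x y = comb p].

(** Induction on the list. By [lowest_coef] the component of r - 1 at the first pair is a multiple c
    of a root vector; multiplying on the left by the root element of parameter -c removes it and
    adds terms of larger degree only. *)
Lemma unipotent_factor s : uniq s -> pairwise (fun p q => deg p <= deg q)%N s ->
  (forall p, p \in s -> (0 < p.1)%N && (0 < p.2)%N) ->
  (forall p q, q \in s -> realized p -> (deg q < deg p)%N -> p \in s) ->
  forall r r', unipotent_pair r r' ->
  supp (D := D) (fun v => exists2 p, p \in s & v = comb p) (r - 1%:M) ->
  exists2 c : nat * nat -> int, (forall p, comb p \notin roots Phi -> c p = 0) &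
    r = \prod_(p <- s) root_mx D (comb p) (c p).
Proof.
elim: s => [|p s IHs] /=.
  move=> _ _ _ _ r r' _ sr; exists (fun=> 0) => //; rewrite big_nil.
  apply/eqP; rewrite -subr_eq0; apply/eqP/matrixP => x y; rewrite [RHS]mxE.
  by apply/eqP; apply: contraTT isT => /sr[].
move=> /andP[ps us] /andP[/allP ds pws] pos clos r r' up sr.
have /andP[p1 p2] := pos p (mem_head _ _).
have sdeg : supp (D := D) (degset (deg p)) (r - 1%:M).
  apply: (suppS sr) => v [q qs ->]; exists q => //.
  by move: qs; rewrite inE => /predU1P[->|/ds].
have [c pc Ec] := lowest_coef p1 p2 up sdeg.
have pNc : comb p \notin roots Phi -> - c = 0 by move/pc->; rewrite oppr0.
have := unipotent_pairM (unipotent_pair_root pNc) up; rewrite opprK => up1.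
set X := root_mx D (comb p) (- c) in up1.
have [|||c' c'0 Ec'] := IHs us pws _ _ _ _ up1.
- by move=> q qs; apply: pos; rewrite inE qs orbT.
- move=> q q' q's rq qq'.
  have : q \in p :: s by apply: (clos q q') => //; rewrite inE q's orbT.
  rewrite inE => /predU1P[Eq|//].
  by have := ds _ q's; rewrite -Eq leqNgt qq'.
- move=> x y.
  pose Z := X - 1%:M - (- c) *: rvec D (comb p).
  pose e := rvec D (comb p).
  (* The first two summands live in degrees above that of [p]; the last one vanishes at weight
     difference [comb p]. *)
  have -> : X *m r - 1%:M = ((X - 1%:M) *m (r - 1%:M) + Z) + ((r - 1%:M) - c *: e).
    rewrite /Z mulmxBl mulmxBr mul1mx mulmx1 scaleNr opprK -/e.
    move: (X *m r) (c *: e) => U V; apply/matrixP => i j; rewrite !mxE; ring.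
  have big u : (exists2 q, (deg p < deg q)%N && (0 < q.1)%N && (0 < q.2)%N & u = comb q) ->
      wtd x y = u -> exists2 q, q \in s & wtd x y = comb q.
    move=> [q /andP[/andP[pq q1] q2] ->] xyq; exists q => //.
    have : q \in p :: s.
      by apply: (clos q p); rewrite ?mem_head //; split=> //; exists x, y.
    by rewrite inE => /predU1P[Eq|//]; rewrite Eq ltnn in pq.
  have sZ : supp (D := D) (fun u => exists2 q,
      (deg p < deg q)%N && (0 < q.1)%N && (0 < q.2)%N & u = comb q)
      ((X - 1%:M) *m (r - 1%:M) + Z).
    apply: suppD.
      apply: suppM (supp_root_mx1 pNc) sr => u v [k k1 ->] [q qs ->].
      have /andP[q1 q2] := pos q qs.
      have dq : (deg p <= deg q)%N by move: qs; rewrite inE => /predU1P[->|/ds].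
      exists (addp (p.1 * k, p.2 * k) q)%N; last by rewrite combD combMn.
      have ? : (p.1 <= p.1 * k)%N by rewrite leq_pmulr.
      have ? : (p.2 <= p.2 * k)%N by rewrite leq_pmulr.
      by move: dq; rewrite /deg /addp /=; lia.
    apply: (suppS (supp_root_mx2 pNc)) => u [k k2 ->].
    exists (p.1 * k, p.2 * k)%N; last by rewrite combMn.
    exact: (deg_multiple p1 p2 k2).
  rewrite mxE; have [->|/sZ/big/(_ erefl)//] :=
    eqVneq (((X - 1%:M) *m (r - 1%:M) + Z) x y) 0.
  rewrite add0r; have [xyp|xyp] := eqVneq (wtd x y) (comb p).
    have xy_neq : (x == y) = false.
      apply: contraTF isT => /eqP exy; move: xyp; rewrite exy /wtd subrr.
      by move/esym/comb0 => pE; move: p1; rewrite pE.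
    by rewrite !mxE (Ec x y xyp) xy_neq subr0 /e subrr eqxx.
  have ce0 : c * e x y = 0.
    have [pP|/pc->] := boolP (comb p \in roots Phi); last by rewrite mul0r.
    have [->|/(supp_rvec pP) exy] := eqVneq (e x y) 0; first by rewrite mulr0.
    by rewrite -exy eqxx in xyp.
  rewrite mxE [X in _ + X]mxE [X in _ - X]mxE ce0 subr0 => /sr[q qs xyq].
  exists q => //; move: qs; rewrite inE => /predU1P[Eq|//].
  by rewrite xyq Eq eqxx in xyp.
exists (fun q => if q == p then c else c' q).
  by move=> q; case: eqP => [->|_ /c'0].
rewrite big_cons eqxx; transitivity (root_mx D (comb p) c *m (X *m r)).
  rewrite mulmxA /X; have [pP|/pc->] := boolP (comb p \in roots Phi).
    by rewrite root_mxN // mul1mx.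
  by rewrite oppr0 !root_mx0 !mul1mx.
rewrite Ec'; congr (_ *m _); rewrite big_seq [RHS]big_seq.
apply: eq_bigr => q qs; case: eqP => // Eq; by rewrite -Eq qs in ps.
Qed.

Lemma comb_fst : comb (1, 0)%N = a. Proof. by rewrite /comb mulr0n addr0. Qed.
Lemma comb_snd : comb (0, 1)%N = b. Proof. by rewrite /comb mulr0n add0r. Qed.

Lemma supp_root_mxB (R : comPzRingType) z (t : R) : z \in roots Phi ->
  supp (D := D) (fun v => exists2 k, (0 < k)%N & v = z *+ k) (root_mx D z t - 1%:M).
Proof.
move=> zP; rewrite (root_mx_widen _ (m := n) zP) // big_ltn //.
rewrite divided_power0 expr0 scale1r map_scalar_mx addrC addKr.
rewrite big_seq; apply: supp_sum => k; rewrite mem_index_iota => k1 _.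
apply: suppZ; apply: supp_map => //.
apply: (suppS (@supp_divided_power _ _ _ D _ k zP)) => v <-.
by exists k; case/andP: k1.
Qed.

Lemma unipotent_commutator : exists N, exists2 c : nat * nat -> int,
  (forall p, comb p \notin roots Phi -> c p = 0) &
  root_mx D a (1 : int) *m root_mx D b 1 *m (root_mx D a (- 1) *m root_mx D b (- 1)) =
  \prod_(p <- cone_seq N.+2) root_mx D (comb p) (c p).
Proof.
have Ua c : unipotent_pair (root_mx D a c) (root_mx D a (- c)).
  by rewrite -comb_fst; apply: unipotent_pair_root; rewrite comb_fst aP.
have Ub c : unipotent_pair (root_mx D b c) (root_mx D b (- c)).
  by rewrite -comb_snd; apply: unipotent_pair_root; rewrite comb_snd bP.
have up := unipotent_pairM (unipotent_pairM (Ua 1) (Ub 1))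
  (unipotent_pairM (Ua (- 1)) (Ub (- 1))).
(* The largest degree a weight difference can have; [Num.truncn] reads the natural number back from
   the rational height. *)
pose N := \max_(xy : 'I_n * 'I_n) Num.truncn (height (wtd xy.1 xy.2)).
exists N.
have bnd p : realized p -> (deg p <= N)%N.
  move=> [_ _ [x [y xy]]].
  have <- : Num.truncn (height (wtd x y)) = deg p by rewrite xy height_comb natrK.
  exact: (leq_bigmax (F := fun xy => Num.truncn (height (wtd xy.1 xy.2))) (x, y)).
have memN p : realized p -> p \in cone_seq N.+2.
  move=> rp; have /leqW/leqW/leqW pN := bnd p rp.
  by case: rp => p1 p2 _; rewrite mem_cone_seq p1 p2.
apply: unipotent_factor up _.
- exact: uniq_cone_seq.
- exact: sorted_cone_seq.
- by move=> p; rewrite mem_cone_seq => /and3P[-> ->].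
- by move=> p q _ /memN.
set Xa := root_mx D a 1; set Xb := root_mx D b 1.
set Xa' := root_mx D a (- 1); set Xb' := root_mx D b (- 1).
(* In this form both coordinates of every nonzero entry are positive, since [Xa - 1] and [Xb - 1]
   each contribute a positive multiple of their root. *)
have -> : Xa *m Xb *m (Xa' *m Xb') - 1%:M =
  ((Xa - 1%:M) *m (Xb - 1%:M) - (Xb - 1%:M) *m (Xa - 1%:M)) *m (Xa' *m Xb').
  have -> : (Xa - 1%:M) *m (Xb - 1%:M) - (Xb - 1%:M) *m (Xa - 1%:M) = Xa *m Xb - Xb *m Xa.
    rewrite !(mulmxBl, mulmxBr) !mulmx1 !mul1mx.
    move: (Xa *m Xb) (Xb *m Xa) => U V; apply/matrixP => i j; rewrite !mxE; ring.
  rewrite mulmxBl; congr (_ - _).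
  by rewrite -mulmxA (mulmxA Xa) root_mxN // mul1mx root_mxN.
move=> x y nz.
pose S v := exists2 p, (0 < p.1)%N && (0 < p.2)%N & v = comb p.
have sab : supp (D := D) S ((Xa - 1%:M) *m (Xb - 1%:M) - (Xb - 1%:M) *m (Xa - 1%:M)).
  apply: suppB.
    apply: suppM (supp_root_mxB aP) (supp_root_mxB bP) => u v [i i0 ->] [j j0 ->].
    by exists (i, j); rewrite //= i0.
  apply: suppM (supp_root_mxB bP) (supp_root_mxB aP) => u v [i i0 ->] [j j0 ->].
  by exists (j, i); rewrite /comb //= ?j0 // addrC.
have [_ scone _ _ _] := unipotent_pairM (Ua (- 1)) (Ub (- 1)).
have sM : supp (D := D) S (((Xa - 1%:M) *m (Xb - 1%:M) - (Xb - 1%:M) *m (Xa - 1%:M))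
    *m (Xa' *m Xb')).
  apply: suppM sab scone => u v [p /andP[p1 p2] ->] [q ->].
  by exists (addp p q); rewrite ?combD //= !addn_gt0 p1 p2.
have [p p12 xyp] := sM x y nz.
case/andP: p12 => p1 p2.
by exists p => //; apply: memN; split=> //; exists x, y.
Qed.

(** * From integral identities to parameters in R *)

Section Specialization.
Variables (R : comPzRingType) (s t : R).

(* Over the torus s, t act on an entry of weight i a + j b by s ^ i * t ^ j. *)
Definition specialize (A : 'M[int]_n) : 'M[R]_n :=
  \matrix_(x, y) ((A x y)%:~R *
    (s ^+ Num.truncn (coord1 (wtd x y)) * t ^+ Num.truncn (coord2 (wtd x y)))).

Lemma specializeE (A : 'M[int]_n) x y p : (A x y != 0 -> wtd x y = comb p) ->
  specialize A x y = (A x y)%:~R * (s ^+ p.1 * t ^+ p.2).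
Proof.
rewrite mxE; have [->|_ /(_ isT)->] := eqVneq (A x y) 0; first by rewrite !mul0r.
by rewrite coord1_comb coord2_comb !natrK.
Qed.

(** On the cone both coordinates are natural numbers and add in products, so the monomials multiply;
    outside it [Num.truncn] is not additive. *)
Lemma specializeM (A B : 'M[int]_n) : supp (D := D) cone A -> supp (D := D) cone B ->
  specialize (A *m B) = specialize A *m specialize B.
Proof.
move=> sA sB; apply/matrixP => x y; rewrite [LHS]mxE [RHS]mxE [(A *m B) x y]mxE.
rewrite rmorph_sum mulr_suml; apply: eq_bigr => z _; rewrite rmorphM /=.
have [A0|/sA[p xz]] := eqVneq (A x z) 0; first by rewrite mxE A0 !mul0r.
have [B0|/sB[q zy]] := eqVneq (B z y) 0; first by rewrite B0 mulr0 [specialize B _ _]mxE B0 !(mul0r, mulr0).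
rewrite (specializeE (fun _ => xz)) (specializeE (fun _ => zy)).
rewrite -(wtdD x z y) xz zy -combD coord1_comb coord2_comb !natrK /= !exprD; ring.
Qed.

Lemma specialize1 : specialize 1%:M = 1%:M.
Proof.
apply/matrixP => x y; rewrite (specializeE (p := (0, 0)%N)).
  by rewrite !expr0 !mulr1 !mxE; case: (x == y).
rewrite mxE; have [->|] := eqVneq x y; last by rewrite eqxx.
by rewrite /wtd subrr /comb !mulr0n addr0.
Qed.

Lemma specialize_root p c : (comb p \notin roots Phi -> c = 0) ->
  specialize (root_mx D (comb p) c) =
  root_mx D (comb p) (c%:~R * (s ^+ p.1 * t ^+ p.2)).
Proof.
have [pP _|_ ->//] := boolP (comb p \in roots Phi); last first.
  by rewrite mul0r !root_mx0 specialize1.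
apply/matrixP => x y; rewrite [LHS]mxE /root_mx !summxE rmorph_sum mulr_suml.
apply: eq_bigr => k _; rewrite mxE [RHS]mxE [map_mx _ _ x y]mxE [in RHS]mxE intz rmorphM rmorphXn /=.
have [->|/(supp_divided_power pP) <-] := eqVneq (divided_power D (comb p) k x y) 0.
  by rewrite !mulr0 mul0r.
rewrite combMn coord1_comb coord2_comb !natrK /= !exprMn !exprM; ring.
Qed.

End Specialization.

(** * Degree in [a], and the coefficients at the pairs (1, k) *)

Definition slice m (A : 'M[int]_n) : 'M[int]_n :=
  \matrix_(x, y) (if coord1 (wtd x y) == m%:R then A x y else 0).

Lemma slice0M (A B : 'M[int]_n) : supp (D := D) cone A -> supp (D := D) cone B ->
  slice 0 (A *m B) = slice 0 A *m slice 0 B.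
Proof.
move=> sA sB; apply/matrixP => x y; rewrite [LHS]mxE [RHS]mxE [(A *m B) x y]mxE.
transitivity (\sum_z (if coord1 (wtd x y) == 0 then A x z * B z y else 0)).
  by case: ifP; rewrite // big1.
apply: eq_bigr => z _; rewrite !mxE.
have [->|/sA[p xz]] := eqVneq (A x z) 0; first by rewrite !if_same !mul0r if_same.
have [->|/sB[q zy]] := eqVneq (B z y) 0; first by rewrite !if_same !mulr0 if_same.
rewrite -(wtdD x z y) xz zy -combD !coord1_comb /= !(eqr_nat rat _ 0) addn_eq0.
by case: eqP; case: eqP; rewrite /= ?mul0r ?mulr0.
Qed.

(** Degrees in [a] are nonnegative on the cone, so degree 1 arises only as 0 + 1 or 1 + 0. *)
Lemma slice1M (A B : 'M[int]_n) : supp (D := D) cone A -> supp (D := D) cone B ->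
  slice 1 (A *m B) = slice 0 A *m slice 1 B + slice 1 A *m slice 0 B.
Proof.
move=> sA sB; apply/matrixP => x y; rewrite [LHS]mxE [RHS]mxE [(A *m B) x y]mxE.
transitivity (\sum_z (if coord1 (wtd x y) == 1 then A x z * B z y else 0)).
  by case: ifP; rewrite // big1.
rewrite [X in _ = X + _]mxE [X in _ = _ + X]mxE -big_split /=.
apply: eq_bigr => z _; rewrite !mxE.
have [->|/sA[p xz]] := eqVneq (A x z) 0; first by rewrite !if_same !mul0r if_same.
have [->|/sB[q zy]] := eqVneq (B z y) 0; first by rewrite !if_same !mulr0 if_same.
rewrite -(wtdD x z y) xz zy -combD !coord1_comb /= !(eqr_nat rat _ 0) !(eqr_nat rat _ 1).
by case: p.1 q.1 => [|[|i]] [|[|j]] //=; rewrite ?mul0r ?mulr0 ?addr0 ?add0r.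
Qed.

Lemma slice_root p (c : int) : (0 < p.1)%N -> (comb p \notin roots Phi -> c = 0) ->
  slice 0 (root_mx D (comb p) c) = 1%:M /\
  slice 1 (root_mx D (comb p) c) = if p.1 == 1%N then c *: rvec D (comb p) else 0.
Proof.
move=> p1 pc.
have ce x y : (c * rvec D (comb p) x y != 0) -> wtd x y = comb p.
  have [pP|/pc->] := boolP (comb p \in roots Phi); last by rewrite mul0r eqxx.
  have [->|/(supp_rvec pP) <-//] := eqVneq (rvec D (comb p) x y) 0.
  by rewrite mulr0 eqxx.
pose Z := root_mx D (comb p) c - 1%:M - c *: rvec D (comb p).
have sZ : supp (D := D) (multiples p 2) Z by apply: supp_root_mx2.
have XE x y : root_mx D (comb p) c x y = (x == y)%:R + c * rvec D (comb p) x y + Z x y.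
  by rewrite /Z; move: (root_mx _ _ _) => X; rewrite !mxE; ring.
have Z0 m x y : (m < 2)%N -> coord1 (wtd x y) = m%:R -> Z x y = 0.
  move=> m2 xym; apply/eqP; apply: contraTT m2 => /sZ[k k2 xyk].
  move: xym; rewrite xyk combMn coord1_comb /= => /eqP; rewrite eqr_nat => /eqP <-.
  by rewrite -leqNgt (leq_trans k2) // leq_pmull.
have wtd0 x y : (x == y) -> coord1 (wtd x y) = 0.
  move=> /eqP->; have -> : wtd y y = comb (0, 0)%N.
    by rewrite /wtd subrr /comb !mulr0n addr0.
  exact: coord1_comb.
split; apply/matrixP => x y; rewrite mxE.
  case: eqP => [xy0|xyn0]; last first.
    by rewrite mxE; case: eqP => // /eqP/wtd0/xyn0.
  rewrite XE (Z0 0%N) // mxE addr0.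
  have [->|/ce xyp] := eqVneq (c * rvec D (comb p) x y) 0; first by rewrite addr0.
  move: xy0; rewrite xyp coord1_comb => /eqP.
  by rewrite (eqr_nat rat _ 0) => /eqP p10; rewrite p10 in p1.
case: eqP => [xy1|xyn1]; last first.
  case: eqP => p11; rewrite mxE //.
  by apply/esym/eqP; apply: contra_notT xyn1 => /ce->; rewrite coord1_comb p11.
rewrite XE (Z0 1%N) // addr0; case: eqP => [/eqP/wtd0|_].
  by rewrite xy1 => /eqP; rewrite oner_eq0.
rewrite add0r; case: eqP => [p11|p1n1]; rewrite mxE //.
apply/eqP; apply: contra_notT p1n1 => /ce xyp; move: xy1; rewrite xyp coord1_comb.
by move/eqP; rewrite (eqr_nat rat _ 1) => /eqP.
Qed.

Lemma supp_prod_root (s : seq (nat * nat)) (c : nat * nat -> int) :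
  (forall p, comb p \notin roots Phi -> c p = 0) ->
  supp (D := D) cone (\prod_(p <- s) root_mx D (comb p) (c p)).
Proof.
move=> c0; elim: s => [|p s IHs].
  rewrite big_nil; apply: (suppS (@supp_scalar _ _ _ D _ (1 : int))) => v <-.
  by exists (0, 0)%N; rewrite /comb !mulr0n addr0.
rewrite big_cons; apply: suppM IHs; first exact: cone_add.
by have [] := unipotent_pair_root (@c0 p).
Qed.

(** Every factor is 1 in degree 0, so in degree 1 the product becomes a sum. *)
Lemma slice_prod (s : seq (nat * nat)) (c : nat * nat -> int) :
  (forall p, comb p \notin roots Phi -> c p = 0) ->
  (forall p, p \in s -> (0 < p.1)%N) ->
  slice 0 (\prod_(p <- s) root_mx D (comb p) (c p)) = 1%:M /\
  slice 1 (\prod_(p <- s) root_mx D (comb p) (c p)) =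
    \sum_(p <- s | p.1 == 1%N) c p *: rvec D (comb p).
Proof.
move=> c0; elim: s => [|p s IHs] sP.
  have c10 (x : 'I_n) : coord1 (wtd x x) = 0.
    have <- : comb (0, 0)%N = wtd x x by rewrite /wtd subrr /comb !mulr0n addr0.
    exact: coord1_comb.
  rewrite !big_nil; split; apply/matrixP => x y; rewrite !mxE.
    by case: (eqVneq x y) => [->|_]; rewrite ?c10 ?eqxx ?if_same.
  case: (eqVneq x y) => [->|_]; rewrite ?if_same //.
  by rewrite c10 eq_sym oner_eq0.
have [|S0 S1] := IHs; first by move=> q qs; apply: sP; rewrite inE qs orbT.
have p1 : (0 < p.1)%N by apply: sP; rewrite mem_head.
have [R0 R1] := slice_root p1 (@c0 p).
have sp : supp (D := D) cone (root_mx D (comb p) (c p)).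
  by have [] := unipotent_pair_root (@c0 p).
rewrite !big_cons slice0M ?slice1M ?S0 ?S1 ?R0 ?R1; try exact: sp; try exact: supp_prod_root.
split; first by rewrite mul1mx.
rewrite mul1mx mulmx1 addrC; case: ifP => // _; by rewrite add0r.
Qed.

Lemma supp_adk z k : z \in roots Phi ->
  supp (D := D) (eq (a + z *+ k)) (adk z (E a) k).
Proof.
move=> zP; have sa : supp (D := D) (eq a) (E a) by apply: supp_map => //; apply: supp_rvec.
have sz i : supp (D := D) (eq (z *+ i)) (ratmx (divided_power D z i)).
  by apply: supp_map => //; apply: supp_divided_power.
apply: supp_sum => i _ _; apply: suppZ.
have ssa : supp (D := D) (eq (z *+ i + a)) (ratmx (divided_power D z i) *m E a).
  by apply: suppM (sz i) sa => u v <- <-.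
apply: suppM ssa (sz (k - i)%N) => u v <- <-.
by rewrite addrAC -mulrnDr subnKC 1?addrC // -ltnS.
Qed.

(** Above the bottom [a] of a b-string, the k-th bracket has structure constant k up to sign, which
    cancels the denominator k of the divided power. *)
Lemma adk_string k : a - b \notin roots Phi -> a + b *+ k \in roots Phi ->
  exists s : bool, adk b (E a) k = (-1) ^+ s *: E (a + b *+ k).
Proof.
move=> abP; elim: k => [|k IHk] kP.
  by exists false; rewrite adk0 expr0 scale1r mulr0n addr0.
have ab : a != b by rewrite eq_sym.
have aNb : a != - b by apply: contra_neq bNa => ->; rewrite opprK.
have [|s1 Es1] := IHk.
  exact: (string_unbroken Phi_reduced bP aP ab aNb kP).
have [s2 Es2] := string_length_lie D Phi_reduced bP aP ab aNb abP kP.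
exists (s1 (+) s2); rewrite adkS // Es1.
rewrite /lie -scalemxAl -scalemxAr -scalerBr -/(lie _ _) Es2 !scalerA signr_addb.
have k0 : k.+1%:R != 0 :> rat by rewrite pnatr_eq0.
by congr (_ *: _); move: (k.+1%:R) k0 => q q0; field.
Qed.

(** In degree 1 in [a], the identity r Xb Xa = Xa Xb says that [slice 1 r] is e_a minus its
    conjugate by Xb. That conjugate is the sum of the [adk b (E a) j], and its term at [j = k] is a
    root vector up to sign. The entries of weight difference a + k b are then compared. *)
Lemma leading_coef N (c : nat * nat -> int) k :
  (forall p, comb p \notin roots Phi -> c p = 0) ->
  root_mx D a (1 : int) *m root_mx D b 1 *m (root_mx D a (- 1) *m root_mx D b (- 1)) =
    \prod_(p <- cone_seq N) root_mx D (comb p) (c p) ->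
  (0 < k)%N -> a - b \notin roots Phi -> a + b *+ k \in roots Phi ->
  (1, k)%N \in cone_seq N /\ (c (1, k)%N = 1 \/ c (1, k)%N = - 1).
Proof.
move=> c0 Er k0 abP kP; set r := \prod_(p <- _) _ in Er.
pose Xa : 'M[int]_n := root_mx D a 1; pose Xb : 'M[int]_n := root_mx D b 1.
have Ec : r *m (Xb *m Xa) = Xa *m Xb.
  rewrite -Er -!mulmxA; congr (_ *m _).
  rewrite (mulmxA (root_mx D b (- 1)) Xb) root_mxVN // mul1mx root_mxVN // mulmx1 //.
have [S0 S1] : slice 0 r = 1%:M /\
    slice 1 r = \sum_(p <- cone_seq N | p.1 == 1%N) c p *: rvec D (comb p).
  by apply: slice_prod => // p; rewrite mem_cone_seq => /and3P[].
have Ea : a = comb (1, 0)%N by rewrite /comb mulr0n addr0.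
have [A0 A1] : slice 0 Xa = 1%:M /\ slice 1 Xa = rvec D a.
  have [||A0 A1] := @slice_root (1, 0)%N 1; rewrite -?Ea ?aP //.
  by move: A0 A1; rewrite -Ea scale1r.
have sb : supp (D := D) (fun v => exists k, v = b *+ k) Xb.
  apply: supp_sum => i _ _; apply: suppZ; apply: supp_map => //.
  by apply: (suppS (supp_divided_power bP)) => v <-; exists (i : nat).
have c1b i : coord1 (b *+ i) = 0.
  by have := coord1_comb (0, i)%N; rewrite /comb mulr0n add0r.
have B0 : slice 0 Xb = Xb.
  apply/matrixP => x y; rewrite mxE.
  have [->|/sb[i ->]] := eqVneq (Xb x y) 0; first by rewrite if_same.
  by rewrite c1b eqxx.
have B1 : slice 1 Xb = 0.
  apply/matrixP => x y; rewrite mxE [RHS]mxE.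
  have [->|/sb[i ->]] := eqVneq (Xb x y) 0; first by rewrite if_same.
  by rewrite c1b eq_sym oner_eq0.
have sXa : supp (D := D) cone Xa.
  have [|_ + _ _ _] := @unipotent_pair_root (1, 0)%N 1; rewrite -Ea ?aP //.
have sXb : supp (D := D) cone Xb.
  by apply: (suppS sb) => v [i ->]; exists (0, i)%N; rewrite /comb mulr0n add0r.
have sr : supp (D := D) cone r by apply: supp_prod_root.
have Y : slice 1 r *m Xb + Xb *m rvec D a = rvec D a *m Xb.
  move/(congr1 (slice 1)): Ec; rewrite !slice1M // ?slice0M //; last first.
    by apply: suppM sXb sXa; apply: cone_add.
  by rewrite S0 A0 A1 B0 B1 !(mulmx0, mul0mx, mulmx1, mul1mx, add0r, addr0) addrC.
(* [n + n] allows the expansion of the conjugate, and [k] puts the index k into the sum. *)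
pose m := (n + n + k)%N; pose y1 : 'M[rat]_n := ratmx (slice 1 r).
have EY : y1 = E a - \sum_(j < m.+1) adk b (E a) j.
  have <- : root_mx D b (1 : rat) *m E a *m root_mx D b (- 1) =
      \sum_(j < m.+1) adk b (E a) j.
    rewrite (@root_mx_conj _ _ _ _ _ bP _ _ m) ?leq_addr //.
    by apply: eq_bigr => j _; rewrite expr1n scale1r.
  have EXb : ratmx Xb = root_mx D b (1 : rat) by rewrite /Xb root_mx_ratmx.
  move/(congr1 (@ratmx n)): Y; rewrite {1}/ratmx map_mxD -!/(ratmx _) !ratmxM EXb -/y1.
  move=> /(canRL (addrK _)) /(congr1 (mulmxr (root_mx D b (- 1)))) /=.
  by rewrite mulmxBl -!(mulmxA _ (root_mx D b 1)) root_mxN // !mulmx1.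
have [s Es] := adk_string abP kP.
have Ek : a + b *+ k = comb (1, k)%N by [].
have [[x y] nz] : exists xy : 'I_n * 'I_n, rvec D (comb (1, k)%N) xy.1 xy.2 != 0.
  apply: contrapT => /forallNP z0.
  have := rvec_neq0 D P_lattice kP; rewrite Ek => /eqP; apply.
  apply/matrixP => x y; rewrite !mxE; have /negP := z0 (x, y).
  by rewrite negbK /= => /eqP->.
rewrite /= in nz; have kP' : comb (1, k)%N \in roots Phi by rewrite -Ek.
have xyk : wtd x y = comb (1, k)%N by have <- := supp_rvec kP' nz.
have lhs : slice 1 r x y = if (1, k)%N \in cone_seq N
    then c (1, k)%N * rvec D (comb (1, k)%N) x y else 0.
  rewrite S1 summxE big_mkcond /=.
  have other p : p != (1, k)%N -> (c p *: rvec D (comb p)) x y = 0.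
    move=> pk; rewrite mxE; have [pP|/c0->] := boolP (comb p \in roots Phi); last by rewrite mul0r.
    have [->|/(supp_rvec pP)] := eqVneq (rvec D (comb p) x y) 0; first by rewrite mulr0.
    by rewrite xyk => /comb_inj/eqP; rewrite (negbTE pk).
  case: ifP => kN.
    rewrite (bigD1_seq (1, k)%N) ?uniq_cone_seq //= big1 ?addr0 ?mxE // => p /other p0.
    by case: ifP.
  rewrite big_seq big1 // => p pN; case: ifP => // _; apply: other.
  by apply: contraTneq pN => ->; rewrite kN.
have rhs : y1 x y = - (-1) ^+ s * (rvec D (comb (1, k)%N) x y)%:~R.
  rewrite EY [LHS]mxE [X in X + _]mxE.
  have -> : rvec D a x y = 0.
    apply/eqP; apply: contraTT k0 => /(supp_rvec aP); rewrite xyk {1}Ea.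
    by move=> /comb_inj [<-].
  have km : (k < m.+1)%N by rewrite ltnS leq_addl.
  rewrite add0r mxE summxE (bigD1 (Ordinal km)) //= big1 ?addr0 => [|j jk].
    by rewrite Es !mxE mulNr.
  apply/eqP; apply: contraNT jk => /(supp_adk bP); rewrite xyk.
  move=> /(@comb_inj (1, nat_of_ord j) (1, k)%N) [jk]; apply/eqP.
  exact: val_inj.
move: rhs; rewrite /y1 mxE lhs; have nzq : (rvec D (comb (1, k)%N) x y)%:~R != 0 :> rat by rewrite intr_eq0.
case: ifP => kN.
  rewrite rmorphM /= => /(mulIf nzq) ck; split=> //.
  case: s {Es} ck => /= ck; [left|right]; apply: (@intr_inj rat); rewrite ck ?expr1 ?opprK //.
move=> /esym/eqP; rewrite mulf_eq0 (negbTE nzq) orbF oppr_eq0.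
by rewrite signr_eq0.
Qed.

(** [N] and the coefficients come from the integers and precede [R], [s] and [t]; [specialize]
    carries the integral identity to every ring. *)
Theorem chevalley_commutator : exists N, exists2 c : nat * nat -> int,
  forall k, (0 < k)%N -> a - b \notin roots Phi -> a + b *+ k \in roots Phi ->
    (1, k)%N \in cone_seq N.+2 /\ (c (1, k)%N = 1 \/ c (1, k)%N = - 1) &
  (forall p, comb p \notin roots Phi -> c p = 0) /\
  forall (R : comPzRingType) (s t : R),
    root_mx D a s *m root_mx D b t *m (root_mx D a (- s) *m root_mx D b (- t)) =
    \prod_(p <- cone_seq N.+2) root_mx D (comb p) ((c p)%:~R * (s ^+ p.1 * t ^+ p.2)).
Proof.
have [N [c c0 Ec]] := unipotent_commutator.
exists N, c; first by move=> k; apply: leading_coef c0 Ec.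
split=> // R s t.
have Ea : a = comb (1, 0)%N by rewrite /comb mulr0n addr0.
have Eb : b = comb (0, 1)%N by rewrite /comb mulr0n add0r.
have spa (m : int) : specialize s t (root_mx D a m) = root_mx D a (m%:~R * s).
  by rewrite {1}Ea specialize_root -?Ea ?aP //= expr1 expr0 mulr1.
have spb (m : int) : specialize s t (root_mx D b m) = root_mx D b (m%:~R * t).
  by rewrite {1}Eb specialize_root -?Eb ?bP //= expr1 expr0 mul1r.
have sa (m : int) : supp (D := D) cone (root_mx D a m).
  have [|_ + _ _ _] := @unipotent_pair_root (1, 0)%N m; rewrite -Ea ?aP //.
have sb (m : int) : supp (D := D) cone (root_mx D b m).
  have [|_ + _ _ _] := @unipotent_pair_root (0, 1)%N m; rewrite -Eb ?bP //.
have sM (A B : 'M[int]_n) : supp (D := D) cone A -> supp (D := D) cone B ->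
  supp (D := D) cone (A *m B) by apply: suppM; apply: cone_add.
move/(congr1 (specialize s t)): Ec.
rewrite specializeM; [|exact: sM|exact: sM].
rewrite specializeM // specializeM // !spa !spb !mulrN1z !mul1r !mulN1r => ->.
elim: (cone_seq _) => [|p L IHL].
  by rewrite !big_nil; apply: specialize1.
rewrite !big_cons specializeM ?IHL ?specialize_root //; last exact: supp_prod_root.
  by move=> ?; apply: c0.
by have [] := unipotent_pair_root (@c0 p).
Qed.

End Cone.

Local Open Scope classical_set_scope.
Local Open Scope ring_scope.

(** * Residue fields and ideals *)

Section BooleanQuotient.
Variable R : comPzRingType.
Implicit Types (I M : set R).

Lemma idealB I x y : ideal I -> I x -> I y -> I (x - y).
Proof. by move=> [_ ID IM] Ix Iy; apply: ID => //; rewrite -mulN1r; apply: IM. Qed.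

Lemma ideal1 I : ideal I -> I 1 -> I = setT.
Proof.
move=> [_ _ IM] I1; apply/seteqP; split=> // x _.
by rewrite -[x]mulr1; apply: IM.
Qed.

(** Zorn's lemma on the ideals over [I] avoiding 1: a nonempty chain is bounded by its union, the
    empty one by [I]. *)
Lemma maximal_ideal_exists I : ideal I -> ~ I 1 ->
  exists2 M, maximal_ideal M & I `<=` M.
Proof.
move=> Iid I1.
pose ok (M : set R) := [/\ ideal M, I `<=` M & ~ M 1].
pose T := {M : set R | ok M}.
have t0 : T by exists I; split.
have [|||M Mmax] := @ZL_preorder T t0 (fun A B => `[< sval A `<=` sval B >]).
- by move=> A; apply/asboolP.
- by move=> B A C' /asboolP BA /asboolP AC; apply/asboolP => x /BA/AC.
- move=> A Atot; have [[A0 AA0]|An0] := pselect (exists A0, A A0); last first.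
    by exists t0 => B AB; case: An0; exists B.
  have Uok : ok [set x | exists2 B : T, A B & sval B x].
    split; first split.
    - by exists A0 => //; have [[]] := svalP A0.
    - move=> x y [B AB Bx] [C' AC Cy].
      have [/asboolP BC|/asboolP CB] := Atot _ _ AB AC.
        by exists C' => //; have [[_ + _] _ _] := svalP C'; apply=> //; apply: BC.
      by exists B => //; have [[_ + _] _ _] := svalP B; apply=> //; apply: CB.
    - by move=> r x [B AB Bx]; exists B => //; have [[_ _ +] _ _] := svalP B; apply.
    - by move=> x Ix; exists A0 => //; have [_ + _] := svalP A0; apply.
    by move=> [B AB B1]; have [_ _] := svalP B; apply.
  exists (exist ok _ Uok) => B AB; apply/asboolP => x Bx; exists B => //.
have [Mid IM M1] := svalP M.
exists (sval M) => //; split=> //; first by apply: contra_not_neq M1 => ->.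
move=> B Bid MB; have [B1|B1] := pselect (B 1); first by right; apply: ideal1.
left; have Bok : ok B by split=> // x /IM/MB.
apply/seteqP; split=> //.
by have /asboolP := Mmax (exist ok _ Bok) (introT (asboolP _) MB).
Qed.

(* A residue field in which every element is idempotent is F_2. *)
Lemma boolean_ideal I : ideal I -> (forall r, I (r ^+ 2 - r)) ->
  ~ has_residue_field R 'F_2 -> I 1.
Proof.
move=> Iid Ibool; apply: contra_notP => I1.
have [M Mmax IM] := maximal_ideal_exists Iid I1.
have [Mid MnT Mm] := Mmax; have [M0 MD MM] := Mid.
have M1 : ~ M 1 by move=> /(ideal1 Mid) MT; rewrite MT eqxx in MnT.
(* If [x] is outside [M], then 1 = m + r x with m in [M]. Multiplying by 1 - x shows that 1 - x is
   in [M], since r (x ^ 2 - x) is. *)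
have idem x : M x \/ M (1 - x).
  have [|Mx] := pselect (M x); first by left.
  right; pose B := [set y | exists m r, M m /\ y = m + r * x].
  have Bid : ideal B.
    split.
    - by exists 0, 0; rewrite mul0r addr0.
    - move=> _ _ [m [r [Mm1 ->]]] [m' [r' [Mm2 ->]]].
      by exists (m + m'), (r + r'); split; [apply: MD|ring].
    - move=> r0 _ [m [r [Mm1 ->]]].
      by exists (r0 * m), (r0 * r); split; [apply: MM|ring].
  have [BM|BT] := Mm B Bid (fun y My => ex_intro _ y (ex_intro _ 0
      (conj My (esym (etrans (congr1 _ (mul0r x)) (addr0 y)))))).
    by case: Mx; rewrite -BM; exists 0, 1; rewrite add0r mul1r.
  have : B 1 by rewrite BT.
  move=> [m [r [Mm1 E1]]].
  have -> : 1 - x = (m - m * x) - r * (x ^+ 2 - x).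
    by rewrite {1}E1 -[X in _ - X = _]mul1r {1}E1; ring.
  apply: idealB => //; last by apply/MM/IM/Ibool.
  by apply: idealB => //; rewrite mulrC; apply: MM.
(* The quotient map: by [idem] the only cosets of [M] are [M] and 1 + [M]. *)
pose f x : 'F_2 := if `[< M x >] then 0 else 1.
have fM x : M x -> f x = 0 by move=> Mx; rewrite /f asboolT.
have fN x : ~ M x -> f x = 1 by move=> Mx; rewrite /f asboolF.
have NM x : ~ M x -> M (1 - x) by move=> Mx; case: (idem x).
have fD : {morph f : x y / x - y}.
  move=> x y; have [Mx|Mx] := pselect (M x); have [My|My] := pselect (M y).
  - by rewrite !fM ?subr0 //; apply: idealB.
  - rewrite (fM _ Mx) !fN ?sub0r //; first by apply/val_inj.
    by move=> Mxy; apply: My; rewrite -(subKr x y); apply: idealB.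
  - rewrite (fM _ My) !fN ?subr0 //.
    by move=> Mxy; apply: Mx; rewrite -(subrK y x); apply: MD.
  - rewrite (fN _ Mx) (fN _ My) subrr fM //.
    have -> : x - y = (1 - y) - (1 - x) by ring.
    by apply: idealB => //; apply: NM.
have fMul : {morph f : x y / x * y}.
  move=> x y; have [Mx|Mx] := pselect (M x).
    by rewrite (fM _ Mx) mul0r fM // mulrC; apply: MM.
  have [My|My] := pselect (M y); first by rewrite (fM _ My) mulr0 fM //; apply: MM.
  rewrite (fN _ Mx) (fN _ My) mulr1 fN // => Mxy; apply: My.
  have -> : y = y * (1 - x) + x * y by ring.
  by apply: MD => //; apply/MM/NM.
pose fz := GRing.isZmodMorphism.Build R 'F_2 f fD.
pose fm := GRing.isMonoidMorphism.Build R 'F_2 f (fN _ M1, fMul).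
pose g : {rmorphism R -> 'F_2} := HB.pack f fz fm.
exists M => //; exists g; split.
  move=> y; have [->|y0] := eqVneq y 0; first by exists 0; rewrite rmorph0.
  exists 1; rewrite rmorph1; apply/val_inj.
  by case: y y0 => -[|[|]].
move=> x; rewrite /= /f; split=> [|Mx]; last by rewrite asboolT.
by case: asboolP => // _ /eqP; rewrite oner_eq0.
Qed.

End BooleanQuotient.

Section IdealProduct.
Variables (R : comPzRingType) (I J : set R).

Lemma ideal_prod_ideal : ideal (ideal_prod I J).
Proof.
split.
- by move=> K [[K0 _ _] _].
- by move=> x y xP yP K [Kid KS]; have [_ KD _] := Kid; apply: KD; [apply: xP|apply: yP].
- by move=> r x xP K [Kid KS]; have [_ _ KM] := Kid; apply: KM; apply: xP.
Qed.

Lemma ideal_prod_mem x y : I x -> J y -> ideal_prod I J (x * y).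
Proof. by move=> Ix Jy; apply: sub_gen_smallest; exists x => //; exists y. Qed.

Lemma ideal_prod_sub (K : set R) : ideal K -> (forall x y, I x -> J y -> K (x * y)) ->
  ideal_prod I J `<=` K.
Proof.
by move=> Kid KP; apply: smallest_sub => // _ [x Ix [y Jy <-]]; apply: KP.
Qed.

Lemma ideal_pow (K : set R) x i : ideal K -> (0 < i)%N -> K x -> K (x ^+ i).
Proof. by case: i => // i [_ _ KM] _ Kx; rewrite exprSr; apply: KM. Qed.

End IdealProduct.

(** * Elementary subgroups *)

Section GroupTheory.
Variable G : groupType.
Local Open Scope group_scope.
Implicit Types (S H K N E T : set G) (g h k : G).

Lemma generated_subgroup S : subgroup (generated S).
Proof.
split.
- by move=> H [[H1 _ _] _].
- by move=> g h gS hS H [Hsub SH]; have [_ HM _] := Hsub; apply: HM; [apply: gS|apply: hS].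
- by move=> g gS H [Hsub SH]; have [_ _ HV] := Hsub; apply: HV; apply: gS.
Qed.

Lemma generated_sub S H : subgroup H -> S `<=` H -> generated S `<=` H.
Proof. by move=> Hsub SH; apply: smallest_sub. Qed.

Lemma sub_generated S : S `<=` generated S.
Proof. exact: sub_gen_smallest. Qed.

Lemma subgroup_prod H (I : eqType) (s : seq I) (f : I -> G) : subgroup H ->
  (forall i, i \in s -> H (f i)) -> H (\prod_(i <- s) f i).
Proof.
move=> [H1 HM _] Hf; rewrite big_seq; elim/big_ind: _ => // i; exact: Hf.
Qed.

Lemma subgroup_mulKl H g h : subgroup H -> H g -> H (g * h) -> H h.
Proof. by move=> [_ HM HV] Hg /(HM _ _ (HV _ Hg)); rewrite mulKg. Qed.

Lemma subgroup_mulKr H g h : subgroup H -> H h -> H (g * h) -> H g.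
Proof. by move=> [_ HM HV] Hh Hgh; rewrite -(mulgK h g); apply: HM => //; apply: HV. Qed.

Lemma subgroup_prod_factor H (I : eqType) (s : seq I) (f : I -> G) i0 : subgroup H ->
  uniq s -> i0 \in s -> (forall i, i \in s -> i != i0 -> H (f i)) ->
  H (\prod_(i <- s) f i) -> H (f i0).
Proof.
move=> Hsub + i0s; case/splitPr: i0s => s1 s2.
rewrite uniq_catC /= mem_cat negb_or => /andP[/andP[i02 i01] _] Hf.
have H1 : H (\prod_(i <- s1) f i).
  apply: subgroup_prod => // i is1; apply: Hf; first by rewrite mem_cat is1.
  by apply: contraNneq i01 => <-.
have H2 : H (\prod_(i <- s2) f i).
  apply: subgroup_prod => // i is2; apply: Hf; first by rewrite mem_cat inE is2 !orbT.
  by apply: contraNneq i02 => <-.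
by rewrite big_cat big_cons => /(subgroup_mulKl Hsub H1)/(subgroup_mulKr Hsub H2).
Qed.

Definition commutator g h : G := g * h * g^-1 * h^-1.

Lemma commutatorV g h : (commutator g h)^-1 = commutator h g.
Proof. by rewrite /commutator !invgM !invgK !mulgA. Qed.

Definition normalized K H := forall k h, K k -> H h -> H (k * h * k^-1).

Lemma normal_closure_min K H N : subgroup N -> normalized K N -> H `<=` N ->
  normal_closure K H `<=` N.
Proof.
move=> Nsub KN HN; apply: generated_sub => // _ [k Kk [h Hh <-]].
by apply: KN => //; apply: HN.
Qed.

Lemma sub_normal_closure K H : K 1 -> H `<=` normal_closure K H.
Proof.
move=> K1 h Hh; apply: sub_generated; exists 1 => //; exists h => //.
by rewrite mul1g invg1 mulg1.
Qed.

Lemma normalized_generated K S :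
  (forall k g, K k -> S g -> generated S (k * g * k^-1)) -> normalized K (generated S).
Proof.
move=> KS k h Kk; have [S1 SM SV] := generated_subgroup S.
suff sub : generated S `<=` [set g | generated S (k * g * k^-1)] by apply: sub.
apply: generated_sub => [|g Sg]; last exact: KS.
split=> [|g g' /= Sg Sg'|g /= Sg]; first by rewrite /= mulg1 mulgV.
  by have -> : k * (g * g') * k^-1 = (k * g * k^-1) * (k * g' * k^-1)
    by [rewrite !mulgA mulgVK]; apply: SM.
by have -> : k * g^-1 * k^-1 = (k * g * k^-1)^-1
    by [rewrite !invgM invgK mulgA]; apply: SV.
Qed.

Lemma normal_closure_normalized K H : subgroup K -> normalized K (normal_closure K H).
Proof.
move=> [_ KM _]; apply: normalized_generated => k _ Kk [k' Kk' [h Hh <-]].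
apply: sub_generated; exists (k * k'); first exact: KM.
by exists h => //; rewrite invgM !mulgA.
Qed.

Lemma conj_commutator k g h :
  k * commutator g h * k^-1 = commutator (k * g * k^-1) (k * h * k^-1).
Proof. by rewrite /commutator !invgM !invgK !mulgA !mulgVK. Qed.

Lemma commutator_subgroup_normalized K H N : normalized K H -> normalized K N ->
  normalized K (commutator_subgroup H N).
Proof.
move=> KH KN; apply: normalized_generated => k _ Kk [h Hh [n Nn <-]].
apply: sub_generated; exists (k * h * k^-1); first exact: KH.
exists (k * n * k^-1); first exact: KN.
by rewrite -[LHS]/(commutator _ _) -conj_commutator.
Qed.

(** The preimage in [E] of a centralizer in the quotient by [N], stated without the quotient. *)
Definition centralizer_mod E N T : set G :=
  [set g | E g /\ forall t, T t -> N (commutator g t)].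

Lemma centralizer_mod_subgroup E N T : subgroup E -> subgroup N ->
  normalized E N -> subgroup (centralizer_mod E N T).
Proof.
move=> [E1 EM EV] [N1 NM NV] EN; split.
- by split=> // t Tt; rewrite /commutator mul1g invg1 mulg1 mulgV.
- move=> g h [Eg gT] [Eh hT]; split=> [|t Tt]; first exact: EM.
  have -> : commutator (g * h) t = (g * commutator h t * g^-1) * commutator g t.
    by rewrite /commutator !invgM !mulgA !mulgVK.
  by apply: NM; [apply: EN => //; apply: hT|apply: gT].
move=> g [Eg gT]; split=> [|t Tt]; first exact: EV.
have -> : commutator g^-1 t = g^-1 * (commutator g t)^-1 * g^-1^-1.
  by rewrite commutatorV /commutator !invgK !mulgA mulgVK.
by apply: EN; [apply: EV|apply/NV/gT].
Qed.

Lemma centralizer_mod_sub E N T : subgroup N -> normalized E N ->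
  N `<=` E -> T `<=` E -> N `<=` centralizer_mod E N T.
Proof.
move=> [_ NM NV] EN NE TE g Ng; split=> [|t Tt]; first exact: NE.
have -> : commutator g t = g * (t * g^-1 * t^-1) by rewrite /commutator !mulgA.
by apply: NM => //; apply: EN; [apply: TE|apply: NV].
Qed.

Lemma centralizer_modC E N S T : subgroup N -> T `<=` E ->
  S `<=` centralizer_mod E N T -> T `<=` centralizer_mod E N S.
Proof.
move=> [_ _ NV] TE ST t Tt; split=> [|s Ss]; first exact: TE.
by rewrite -commutatorV; apply: NV; have [_] := ST s Ss; apply.
Qed.

Lemma centralizer_mod_normalized E N T : subgroup E ->
  normalized E N -> normalized E T -> normalized E (centralizer_mod E N T).
Proof.
move=> [_ EM EV] EN ET k g Ek [Eg gT]; split=> [|t Tt].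
  exact: EM (EM _ _ Ek Eg) (EV _ Ek).
have -> : commutator (k * g * k^-1) t = k * commutator g (k^-1 * t * k^-1^-1) * k^-1.
  by rewrite conj_commutator invgK !mulgA mulgV mul1g mulgK.
by apply: EN => //; apply: gT; apply: ET => //; apply: EV.
Qed.

End GroupTheory.

(** * Root elements and relative elementary subgroups *)

Section RootElements.
Variables (l : nat) (Phi : rootSystem l) (P : set 'rV[rat]_l).
Variables (D : chevalleyRep Phi P) (R : comPzRingType).
Implicit Types (a b : 'rV[rat]_l) (s t : R).

(** Trivial outside the roots, so that products over pairs need no proofs of root membership. *)
Definition xelt a t : GL R (rdim D) :=
  if pselect (a \in roots Phi) is left aP then root_elt D aP t else 1%g.

Lemma xeltE a (aP : a \in roots Phi) t : xelt a t = root_elt D aP t.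
Proof. by rewrite /xelt; case: pselect => // aP'; apply: GLmx_inj. Qed.

Lemma GLmx_xelt a t : a \in roots Phi -> GLmx (xelt a t) = root_mx D a t.
Proof. by move=> aP; rewrite (xeltE aP). Qed.

Lemma xelt_notin a t : a \notin roots Phi -> xelt a t = 1%g.
Proof. by move/negP; rewrite /xelt; case: pselect. Qed.

Lemma GLmxM (g h : GL R (rdim D)) : GLmx (g * h)%g = GLmx g *m GLmx h.
Proof. by []. Qed.

Lemma xeltD a s t : xelt a (s + t) = (xelt a s * xelt a t)%g.
Proof.
have [aP|aP] := boolP (a \in roots Phi); last by rewrite !xelt_notin // mulg1.
by apply: GLmx_inj; rewrite GLmxM !GLmx_xelt // root_mxD.
Qed.

Lemma xelt0 a : xelt a 0 = 1%g.
Proof.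
have [aP|aP] := boolP (a \in roots Phi); last by rewrite !xelt_notin.
by apply: GLmx_inj; rewrite GLmx_xelt // root_mx0.
Qed.

Lemma xeltN a t : xelt a (- t) = (xelt a t)^-1%g.
Proof. by apply: (mulgI (xelt a t)); rewrite mulgV -xeltD subrr xelt0. Qed.

Hypothesis Phi_reduced : reduced Phi.
Hypothesis P_lattice : intermediate_lattice Phi P.

Lemma xelt_commutator a b : a \in roots Phi -> b \in roots Phi ->
  b != a -> b != - a ->
  exists N, exists2 c : nat * nat -> int,
  forall k, (0 < k)%N -> a - b \notin roots Phi -> a + b *+ k \in roots Phi ->
    (1, k)%N \in cone_seq N.+2 /\ (c (1, k)%N = 1 \/ c (1, k)%N = - 1) &
  forall s t, commutator (xelt a s) (xelt b t) =
    (\prod_(p <- cone_seq N.+2)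
       xelt (comb a b p) ((c p)%:~R * (s ^+ p.1 * t ^+ p.2)))%g.
Proof.
move=> aP bP ba bNa.
have [N [c ck [c0 Ec]]] := chevalley_commutator D Phi_reduced P_lattice aP bP ba bNa.
exists N, c => // s t; apply: GLmx_inj.
rewrite /commutator -!xeltN !GLmxM !GLmx_xelt // -mulmxA Ec.
elim: (cone_seq _) => [|p L IHL]; first by rewrite !big_nil.
rewrite !big_cons GLmxM IHL; congr (_ *m _).
have [pP|pP] := boolP (comb a b p \in roots Phi); first by rewrite GLmx_xelt.
by rewrite xelt_notin // c0 // mul0r root_mx0.
Qed.

Local Notation elem := (@elementary l Phi P D R).
Local Notation relem := (@relative_elementary l Phi P D R).

Lemma elementary_subgroup (I : set R) : subgroup (elem I).
Proof. exact: generated_subgroup. Qed.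

Lemma elementary_xelt (I : set R) a t : I t -> elem I (xelt a t).
Proof.
move=> It; have [aP|aP] := boolP (a \in roots Phi); last first.
  by rewrite xelt_notin //; have [] := elementary_subgroup I.
by rewrite (xeltE aP); apply: sub_generated; exists a, aP, t.
Qed.

Lemma elementary_sub (I : set R) H : subgroup H ->
  (forall a t, a \in roots Phi -> I t -> H (xelt a t)) -> elem I `<=` H.
Proof.
move=> Hsub HI; apply: generated_sub => // _ [a [aP [t [It ->]]]].
by rewrite -xeltE; apply: HI.
Qed.

Lemma elementary_mono (I J : set R) : I `<=` J -> elem I `<=` elem J.
Proof.
move=> IJ; apply: elementary_sub; first exact: elementary_subgroup.
by move=> a t _ /IJ; apply: elementary_xelt.
Qed.

Lemma relative_subgroup (I : set R) : subgroup (relem I).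
Proof. exact: generated_subgroup. Qed.

Lemma relative_normalized (I : set R) : normalized (elem setT) (relem I).
Proof. by apply: normal_closure_normalized; apply: elementary_subgroup. Qed.

Lemma elementary_relative (I : set R) : elem I `<=` relem I.
Proof. by apply: sub_normal_closure; have [] := elementary_subgroup setT. Qed.

Lemma relative_sub_elementary (I : set R) : relem I `<=` elem setT.
Proof.
have [E1 EM EV] := elementary_subgroup setT.
apply: normal_closure_min; first exact: elementary_subgroup.
  by move=> k h Ek Eh; exact: EM (EM _ _ Ek Eh) (EV _ Ek).
exact: elementary_mono.
Qed.

End RootElements.

(** * Commutation modulo the relative elementary subgroup *)

Section Irreducible.
Variables (l : nat) (Phi : rootSystem l).
Hypothesis Phi_reduced : reduced Phi.
Hypothesis Phi_irreducible : irreducible Phi.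
Implicit Types (a b c d : 'rV[rat]_l).

(** Irreducibility as an induction principle: a set of roots closed under non-orthogonality is
    orthogonal to its complement. *)
Lemma irreducible_closed (S : pred 'rV[rat]_l) a : a \in roots Phi -> S a ->
  (forall b c, b \in roots Phi -> c \in roots Phi -> S b -> rform Phi b c != 0 -> S c) ->
  forall b, b \in roots Phi -> S b.
Proof.
move=> aP Sa SP; have [b c bP cP Sb nSc|//|Sn] := Phi_irreducible.2 S; last first.
  by have := Sn a aP; rewrite Sa.
have bc0 : rform Phi b c = 0 by apply/eqP; apply: contraNT nSc; apply: SP.
by rewrite !pairingE // (rformC _ c) bc0 mulr0 !mul0r.
Qed.

Hypothesis rank_ge2 : (2 <= l)%N.

(** If [a] were orthogonal to every root other than itself and its opposite, irreducibility would
    put all roots on one line, against rank at least 2. *)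
Lemma root_neighbor a : a \in roots Phi ->
  exists2 b, b \in roots Phi & [/\ b != a, b != - a & 0 < rform Phi a b].
Proof.
move=> aP; apply: contrapT => no.
have orth b : b \in roots Phi -> b != a -> b != - a -> rform Phi a b = 0.
  move=> bP ba bNa; apply/eqP; apply: contra_notT no; rewrite neq_lt => /orP[ab|ab].
    exists (- b); first exact: root_opp.
    split; [by apply: contra_neq bNa => <-; rewrite opprK | by rewrite (inj_eq oppr_inj) |].
    by rewrite rformNr oppr_gt0.
  by exists b.
pose S : pred 'rV[rat]_l := fun v => v \in <[a]>%VS.
have all_line b : b \in roots Phi -> S b.
  apply: (irreducible_closed aP (memv_line a)) => {}b c bP cP /vlineP[k bE] bc.
  change (c \in <[a]>%VS).
  have [->|ca] := eqVneq c a; first exact: memv_line.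
  have [->|cNa] := eqVneq c (- a); first by rewrite memvN memv_line.
  by move: bc; rewrite bE rformZl orth // mulr0 eqxx.
have : (<<roots Phi>> <= <[a]>)%VS by apply/span_subvP.
rewrite roots_span => /dimvS; rewrite dimvf dim_vline /dim /= mul1n.
by case: (a != 0); lia.
Qed.

(** Descend from [a] along a root [d] at an acute angle; [k] is positive because [a - d] is a
    root. *)
Lemma root_string_top a : a \in roots Phi -> exists c d k,
  [/\ c \in roots Phi, d \in roots Phi, (d != c) && (d != - c),
      (0 < k)%N & c - d \notin roots Phi /\ a = c + d *+ k].
Proof.
move=> /[dup] aP /root_neighbor[d dP [da dNa ad]].
have [k [kP kmax]] := string_length_exists dP aP.
have k0 : (0 < k)%N.
  by apply: (kmax 1%N); rewrite mulr1n; apply: root_sub.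
exists (a - d *+ k), d, k; split=> //.
- have ad' : a != d by rewrite eq_sym.
  have aNd : a != - d by apply: contra_neq dNa => ->; rewrite opprK.
  have := string_notprop Phi_reduced (- k%:R) dP aP ad' aNd.
  rewrite scaleNr scaler_nat => /andP[h1 h2]; apply/andP; split; first by rewrite eq_sym.
  by rewrite eq_sym eqr_oppLR.
- split; last by rewrite subrK.
  by apply/negP; rewrite -addrA -opprD -mulrSr => /kmax; rewrite ltnn.
Qed.

End Irreducible.

Section UpperBound.
Variables (l : nat) (Phi : rootSystem l) (P : set 'rV[rat]_l).
Variables (D : chevalleyRep Phi P) (R : comPzRingType) (I J : set R).
Hypothesis Phi_reduced : reduced Phi.
Hypothesis Phi_irreducible : irreducible Phi.
Hypothesis rank_ge2 : (2 <= l)%N.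
Hypothesis P_lattice : intermediate_lattice Phi P.
Hypotheses (I_ideal : ideal I) (J_ideal : ideal J) (IJ_comaximal : comaximal I J).
Implicit Types (a b c d : 'rV[rat]_l) (s t : R).

Local Notation elem := (@elementary l Phi P D R).
Local Notation relem := (@relative_elementary l Phi P D R).
Local Notation E := (elem setT).
Local Notation IJ := (ideal_prod I J).
Local Notation N := (relem IJ).
Local Notation x a t := (@xelt l Phi P D R a t).

Lemma comaximal_split : exists2 s, I s & exists2 t, J t & s + t = 1.
Proof. by have : (ideal_sum I J) 1 by rewrite IJ_comaximal. Qed.

Let Esub : subgroup E. Proof. exact: elementary_subgroup. Qed.
Let Nsub : subgroup N. Proof. exact: relative_subgroup. Qed.
Let EN : normalized E N. Proof. exact: relative_normalized. Qed.
Let NE : N `<=` E. Proof. exact: relative_sub_elementary. Qed.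
Let xE a t : E (x a t). Proof. exact: elementary_xelt. Qed.
Let NIJ a t : IJ t -> N (x a t).
Proof. by move=> IJt; apply: elementary_relative; apply: elementary_xelt. Qed.

Lemma commutator_notopp a b s t : a \in roots Phi -> b \in roots Phi -> b != - a ->
  I s -> J t -> N (commutator (x a s) (x b t)).
Proof.
move=> aP bP bNa Is Jt; have [->|ba] := eqVneq b a.
  by rewrite /commutator -xeltD addrC xeltD mulgK mulgV; have [] := Nsub.
have [n [c _ ->]] := xelt_commutator D R Phi_reduced P_lattice aP bP ba bNa.
apply: subgroup_prod => // p; rewrite mem_cone_seq => /and3P[p1 p2 _].
apply: NIJ; have [_ _ IJM] := ideal_prod_ideal I J.
exact: IJM _ _ (ideal_prod_mem (ideal_pow I_ideal p1 Is) (ideal_pow J_ideal p2 Jt)).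
Qed.

Lemma commutator_opp a s t : a \in roots Phi ->
  I s -> J t -> N (commutator (x a s) (x (- a) t)).
Proof.
move=> aP Is Jt; pose C := centralizer_mod E N [set x (- a) t].
have Csub : subgroup C by apply: centralizer_mod_subgroup.
have NC : N `<=` C.
  by apply: centralizer_mod_sub => // _ ->.
(* Root elements with parameter in [I], at a root other than [a], centralize x_(-a)(t) modulo [N] by
   [commutator_notopp]. *)
have other b u : b != a -> I u -> C (x b u).
  move=> ba Iu; have [bP|bP] := boolP (b \in roots Phi); last first.
    by rewrite xelt_notin //; have [] := Csub.
  split=> [|_ ->]; first exact: xE.
  by apply: commutator_notopp; rewrite ?root_opp // (inj_eq oppr_inj) eq_sym.
suff [] : C (x a s) by move=> _; apply.
have [c [d [k [cP dP /andP[dc dNc] k0 [cdP aE]]]]] :=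
  root_string_top Phi_reduced Phi_irreducible rank_ge2 aP.
have [s0 Is0 [t0 Jt0 st0]] := comaximal_split.
have [n [f fk Ef]] := xelt_commutator D R Phi_reduced P_lattice cP dP dc dNc.
have [|kn fk1] := fk k k0 cdP; first by rewrite -aE.
have caE : comb c d (1, k)%N = a by rewrite aE.
have [_ _ IM] := I_ideal; have [C1 CM CV] := Csub.
(* The commutator of x_c(u) and x_d(s0) lies in [C], and so do all its factors except possibly the
   one at (1, k); hence that one does too. *)
have step u : I u -> C (x a ((f (1, k)%N)%:~R * (u * s0 ^+ k))).
  move=> Iu; rewrite -{1}caE -[u]expr1.
  apply: (subgroup_prod_factor (f := fun p => x (comb c d p)
    ((f p)%:~R * (u ^+ p.1 * s0 ^+ p.2))) Csub (uniq_cone_seq n.+2) kn).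
    move=> p; rewrite mem_cone_seq => /and3P[p1 p2 _] pk; apply: other.
      by rewrite -caE (inj_eq (comb_inj Phi_reduced cP dP dc dNc)).
    by apply: (IM); rewrite mulrC; apply: (IM); apply: ideal_pow.
  have Cc : C (x c u).
    apply: other => //; rewrite -caE; apply/eqP => ca.
    have /(comb_inj Phi_reduced cP dP dc dNc) [k00] : comb c d (1, 0)%N = comb c d (1, k)%N.
      by rewrite -ca /comb mulr0n addr0.
    by rewrite -k00 in k0.
  have Cd : C (x d s0).
    apply: other => //; rewrite -caE; apply/eqP => da.
    have /(comb_inj Phi_reduced cP dP dc dNc) [//] : comb c d (0, 1)%N = comb c d (1, k)%N.
    by rewrite -da /comb mulr0n add0r.
  by rewrite -Ef; exact: CM (CM _ _ (CM _ _ Cc Cd) (CV _ Cc)) (CV _ Cd).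
have Ca : C (x a (s * s0 ^+ k)).
  have := step s Is; case: fk1 => ->; first by rewrite mul1r.
  by rewrite mulrN1z mulN1r xeltN => /CV; rewrite invgK.
(* [s0] is 1 modulo [J], so 1 - s0 ^ k lies in [J]. *)
have IJ1 : IJ (s * (1 - s0 ^+ k)).
  apply: ideal_prod_mem => //; have [J0 JD JM] := J_ideal.
  elim: {kn fk1 aE caE k0 step Ca}k => [|k IHk]; first by rewrite expr0 subrr.
  have -> : 1 - s0 ^+ k.+1 = (1 - s0 ^+ k) + s0 ^+ k * t0.
    by rewrite exprSr -[t0](addKr s0) st0; ring.
  by apply: JD => //; apply: JM.
have -> : s = s * s0 ^+ k + s * (1 - s0 ^+ k) by ring.
by rewrite xeltD; exact: CM _ _ Ca (NC _ (NIJ _ IJ1)).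
Qed.

Lemma elementary_commute : elem I `<=` centralizer_mod E N (elem J).
Proof.
have sub K : elem K `<=` E by apply: elementary_mono.
apply: centralizer_modC => //.
apply: elementary_sub; first exact: centralizer_mod_subgroup.
move=> b t bP Jt; split=> [|g Ig]; first exact: xE.
suff /(_ g Ig) [_] : elem I `<=` centralizer_mod E N [set x b t].
  by rewrite -commutatorV => /(_ _ erefl); have [_ _] := Nsub; apply.
apply: elementary_sub; first exact: centralizer_mod_subgroup.
move=> a s aP Is; split=> [|_ ->]; first exact: xE.
have [->|bNa] := eqVneq b (- a); first exact: commutator_opp.
exact: commutator_notopp.
Qed.

(* Since x_a(c) = x_a(cs) x_a(ct) with s in I and t in J, the whole of E
   normalizes the centralizer of E(I) modulo N. *)
Lemma relative_commute : relem I `<=` centralizer_mod E N (relem J).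
Proof.
have sub K : elem K `<=` E by apply: elementary_mono.
have [E1 EM EV] := Esub; have [N1 NM NV] := Nsub.
pose C := centralizer_mod E N (elem I).
have Csub : subgroup C by apply: centralizer_mod_subgroup.
have [C1 CM CV] := Csub.
have JC : elem J `<=` C.
  by apply: centralizer_modC elementary_commute => //.
have [s Is [t Jt st]] := comaximal_split.
have [_ _ IM] := I_ideal; have [_ _ JM] := J_ideal.
(* The part in [I] changes g by a commutator in [N]; the part in [J] conjugates inside the subgroup
   [C], which contains [elem J]. *)
have conjC b r g : C g -> C (x b r * g * (x b r)^-1)%g.
  have conjI u h : elem I u -> C h -> C (u * h * u^-1)%g.
    move=> Iu /[dup] Ch [_ /(_ u Iu) Nhu].
    have -> : (u * h * u^-1 = commutator u h * h)%g by rewrite /commutator mulgVK.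
    have Nuh : N (commutator u h) by rewrite -commutatorV; apply: NV.
    exact: CM _ _ (centralizer_mod_sub Nsub EN NE (sub I) Nuh) Ch.
  have conjJ v h : elem J v -> C h -> C (v * h * v^-1)%g.
    by move=> /JC Cv Ch; exact: CM (CM _ _ Cv Ch) (CV _ Cv).
  have -> : r = r * s + r * t by rewrite -mulrDr st mulr1.
  move=> Cg; rewrite xeltD; set u := x b (r * s); set v := x b (r * t).
  have -> : (u * v * g * (u * v)^-1 = u * (v * g * v^-1) * u^-1)%g.
    by rewrite invgM !mulgA.
  apply: conjI; first by apply: elementary_xelt; apply: IM.
  by apply: conjJ => //; apply: elementary_xelt; apply: JM.
have ENC : normalized E C.
  (* Invariance is asked of [k] and of its inverse, so that the set is closed under inverses. *)
  suff sub2 : E `<=` [set k | forall g, C g -> C (k * g * k^-1)%g /\ C (k^-1 * g * k)%g].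
    by move=> k g /sub2 kg /kg[].
  apply: elementary_sub.
    split=> [g|k k' /= kC k'C g Cg|k /= kC g Cg] /=.
    - by rewrite invg1 !mul1g !mulg1.
    - have [h1 _] := k'C g Cg; have [h2 _] := kC _ h1.
      have [_ h3] := kC g Cg; have [_ h4] := k'C _ h3.
      by rewrite invgM !mulgA in h2 h4 *.
    - by rewrite invgK; have [] := kC g Cg.
  move=> b r _ _ g Cg; split; first exact: conjC.
  by rewrite -[X in (_ * X)%g]invgK -xeltN; apply: conjC.
(* Now [relem J] commutes with [elem I] modulo [N]. With the roles exchanged, the centralizer of
   [relem J] contains [elem I] and is normalized by [E]. *)
have RJC : relem J `<=` C by apply: normal_closure_min.
apply: normal_closure_min.
- exact: centralizer_mod_subgroup.
- by apply: centralizer_mod_normalized => //; apply: relative_normalized.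
by apply: centralizer_modC.
Qed.

End UpperBound.

(** * Root elements in the commutator subgroup *)

Section LowerBound.
Variables (l : nat) (Phi : rootSystem l) (P : set 'rV[rat]_l).
Variables (D : chevalleyRep Phi P) (R : comPzRingType) (I J : set R).
Hypothesis Phi_reduced : reduced Phi.
Hypothesis P_lattice : intermediate_lattice Phi P.
Hypotheses (I_ideal : ideal I) (J_ideal : ideal J) (IJ_comaximal : comaximal I J).
Variable C : set (GL R (rdim D)).
Hypothesis C_subgroup : subgroup C.
Implicit Types (a b c d : 'rV[rat]_l) (s t : R) (p : nat * nat).
Local Notation x a t := (@xelt l Phi P D R a t).
Local Notation IJ := (ideal_prod I J).

(** Both orders are allowed because the exponents of s and t in the commutator formula are not
    symmetric. *)
Definition ideal_pair (K L : set R) := (K = I /\ L = J) \/ (K = J /\ L = I).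

Hypothesis C_commutator : forall (K L : set R) a b s t,
  ideal_pair K L -> K s -> L t -> C (commutator (x a s) (x b t)).

Definition contains_root a := forall t, IJ t -> C (x a t).

Lemma ideal_pairP K L : ideal_pair K L -> [/\ ideal K, ideal L &
  forall s t, K s -> L t -> IJ (s * t)].
Proof.
move=> [[-> ->]|[-> ->]]; split=> // s t Ks Lt; first exact: ideal_prod_mem.
by rewrite mulrC; apply: ideal_prod_mem.
Qed.

Lemma xelt_sign (e : int) a t : e = 1 \/ e = - 1 -> C (x a (e%:~R * t)) -> C (x a t).
Proof.
have [_ _ CV] := C_subgroup; case=> ->; first by rewrite mul1r.
by rewrite mulrN1z mulN1r xeltN => /CV; rewrite invgK.
Qed.

Lemma contains_root_prod a :
  (forall s t, I s -> J t -> C (x a (s * t))) -> contains_root a.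
Proof.
move=> Ca t; have [C1 CM CV] := C_subgroup; have [_ _ IM] := I_ideal.
(* The parameters t with x_a(t) in [C] form an additive group; asking for all multiples gives an
   ideal. *)
pose K : set R := [set u | forall r, C (x a (r * u))].
suff sub : IJ `<=` K by move=> /sub /(_ 1); rewrite mul1r.
apply: ideal_prod_sub.
  split=> [r|u v Ku Kv r|u v Kv r]; first by rewrite mulr0 xelt0.
    by rewrite mulrDr xeltD; apply: CM; [apply: Ku|apply: Kv].
  by rewrite mulrA; apply: Kv.
by move=> s u Is Ju r; rewrite mulrA; apply: Ca => //; apply: IM.
Qed.

(* 1 = (s + t) ^ 3 lies in the ideal generated by s ^ 2 and t ^ 2. *)
Lemma contains_root_squares a :
  (forall K L s t, ideal_pair K L -> K s -> L t -> C (x a (s * t ^+ 2))) ->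
  contains_root a.
Proof.
move=> sq; apply: contains_root_prod => s t Is Jt.
have [s0 Is0 [t0 Jt0 st0]] := comaximal_split IJ_comaximal.
have [_ CM _] := C_subgroup.
have [_ _ IM] := I_ideal; have [_ _ JM] := J_ideal.
have -> : s * t = (t * (s * (s0 + 3 * t0))) * s0 ^+ 2
    + (s * (t * (3 * s0 + t0))) * t0 ^+ 2.
  transitivity (s * t * (s0 + t0) ^+ 3); last by ring.
  by rewrite st0 expr1n mulr1.
rewrite xeltD; apply: CM.
  by apply: (sq J I) => //; [right|rewrite mulrC; apply: JM].
by apply: (sq I J) => //; [left|rewrite mulrC; apply: IM].
Qed.

(** The factors other than that at (1, k) are known to be in [C], and that one has coefficient 1 or
    -1 since [c] is the bottom of its d-string. *)
Lemma isolate_root c d k K L s t : c \in roots Phi -> d \in roots Phi ->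
  d != c -> d != - c -> c - d \notin roots Phi -> (0 < k)%N ->
  c + d *+ k \in roots Phi ->
  (forall p, (0 < p.1)%N -> (0 < p.2)%N -> comb c d p \in roots Phi ->
     p != (1, k)%N -> contains_root (comb c d p)) ->
  ideal_pair K L -> K s -> L t -> C (x (c + d *+ k) (s * t ^+ k)).
Proof.
move=> cP dP dc dNc cdP k0 kP other KL Ks Lt.
have [n [f fk Ef]] := xelt_commutator D R Phi_reduced P_lattice cP dP dc dNc.
have [kn fk1] := fk k k0 cdP kP.
apply: (xelt_sign fk1); rewrite -[s in X in C X]expr1.
apply: (subgroup_prod_factor (f := fun p => x (comb c d p)
    ((f p)%:~R * (s ^+ p.1 * t ^+ p.2))) C_subgroup (uniq_cone_seq n.+2) kn).
  move=> p; rewrite mem_cone_seq => /and3P[p1 p2 _] pk.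
  have [pP|pP] := boolP (comb c d p \in roots Phi); last first.
    by rewrite xelt_notin //; have [] := C_subgroup.
  apply: other => //; have [Kid Lid KLM] := ideal_pairP KL.
  have [_ _ IJM] := ideal_prod_ideal I J.
  by apply: (IJM); apply: KLM; apply: ideal_pow.
by have := C_commutator c d KL Ks Lt; rewrite Ef.
Qed.

Lemma contains_root_A c d : c \in roots Phi -> d \in roots Phi ->
  d != c -> d != - c -> c - d \notin roots Phi -> c + d \in roots Phi ->
  (forall p, (0 < p.1)%N -> (0 < p.2)%N -> comb c d p \in roots Phi ->
     p != (1, 1)%N -> contains_root (comb c d p)) ->
  contains_root (c + d).
Proof.
move=> cP dP dc dNc cdP dcP other; apply: contains_root_prod => s t Is Jt.
have := @isolate_root c d 1 I J s t cP dP dc dNc cdP isT.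
by rewrite mulr1n expr1; apply=> //; left.
Qed.

Lemma contains_root_B c d : c \in roots Phi -> d \in roots Phi ->
  d != c -> d != - c -> c - d \notin roots Phi -> c + d *+ 2 \in roots Phi ->
  (forall p, (0 < p.1)%N -> (0 < p.2)%N -> comb c d p \in roots Phi ->
     p != (1, 2)%N -> contains_root (comb c d p)) ->
  contains_root (c + d *+ 2).
Proof.
move=> cP dP dc dNc cdP dcP other; apply: contains_root_squares => K L s t KL Ks Lt.
exact: (isolate_root (K := K) (L := L)).
Qed.

(* Replacing s by r s and t by r t in the commutator [x_c(s), x_d(t)] changes
   the factor x_(c+2d) in different ways, which isolates (r ^ 2 - r) s t ^ 2. *)
Lemma contains_root_noF2 c d : c \in roots Phi -> d \in roots Phi ->
  d != c -> d != - c -> c - d \notin roots Phi -> c + d *+ 2 \in roots Phi ->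
  ~ has_residue_field R 'F_2 ->
  (forall p, (0 < p.1)%N -> (0 < p.2)%N -> comb c d p \in roots Phi ->
     p != (1, 1)%N -> p != (1, 2)%N -> contains_root (comb c d p)) ->
  contains_root (c + d *+ 2).
Proof.
move=> cP dP dc dNc cdP kP noF2 other.
apply: contains_root_squares => K L s t KL Ks Lt.
have [Kid Lid KLM] := ideal_pairP KL.
have [C1 CM CV] := C_subgroup.
have [n [f fk Ef]] := xelt_commutator D R Phi_reduced P_lattice cP dP dc dNc.
have [_ f2] := fk 2%N isT cdP kP.
(* The pairs (1, 1) and (1, 2) head the list, and all later factors are in [C]. *)
have prod2 s1 t1 : K s1 -> L t1 ->
    C (x (comb c d (1, 1)%N) ((f (1, 1)%N)%:~R * (s1 * t1)) *
       x (c + d *+ 2) ((f (1, 2)%N)%:~R * (s1 * t1 ^+ 2)))%g.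
  move=> Ks1 Lt1; have := C_commutator c d KL Ks1 Lt1; rewrite Ef.
  have [q qE] := cone_seqE n.
  have uq := uniq_cone_seq n.+2; have qmem := mem_cone_seq n.+2.
  rewrite qE in uq qmem *; rewrite !big_cons mulgA /= !expr1.
  apply: subgroup_mulKr => //; apply: subgroup_prod => // p pq.
  have := qmem p; rewrite !inE pq !orbT => /esym/and3P[p1 p2 _].
  have [pP|pP] := boolP (comb c d p \in roots Phi); last by rewrite xelt_notin.
  apply: other => //.
  - by apply: contraTneq uq => pE; rewrite /= -pE !inE pq !orbT.
  - by apply: contraTneq uq => pE; rewrite /= -pE pq andbF.
  have [_ _ IJM] := ideal_prod_ideal I J.
  by apply: (IJM); apply: KLM; apply: ideal_pow.
(* An ideal, since a factor [r0] is absorbed by [s1] in [K]. *)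
pose T : set R := [set r | forall s1 t1, K s1 -> L t1 ->
  C (x (c + d *+ 2) (r * (s1 * t1 ^+ 2)))].
have [_ _ KM] := Kid; have [_ _ LM] := Lid.
suff : T 1 by move=> /(_ s t Ks Lt); rewrite mul1r.
apply: (boolean_ideal (I := T)) noF2.
  split.
  - by move=> s1 t1 _ _; rewrite mul0r xelt0.
  - move=> r r' Tr Tr' s1 t1 Ks1 Lt1; rewrite mulrDl xeltD.
    by apply: CM; [apply: Tr|apply: Tr'].
  - move=> r0 r Tr s1 t1 Ks1 Lt1; rewrite [r0 * r]mulrC -mulrA [r0 * _]mulrA.
    by apply: Tr => //; apply: KM.
move=> r s1 t1 Ks1 Lt1; apply: (xelt_sign f2).
(* The two products share the factor at (1, 1), of parameter r s1 t1, which cancels in the quotient;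
   at (1, 2) they have r ^ 2 and r times s1 t1 ^ 2. *)
have h1 := prod2 _ _ Ks1 (LM r _ Lt1); have h2 := prod2 _ _ (KM r _ Ks1) Lt1.
have := CM _ _ (CV _ h2) h1; rewrite [s1 * (r * t1)]mulrCA mulrA invgM mulgA mulgVK.
rewrite -xeltN -xeltD; congr (C (x _ _)).
by rewrite exprMn; ring.
Qed.

End LowerBound.

(** * Configurations of roots *)

Section G2Arithmetic.
Implicit Types n M U V t : rat.

(** The inner products of two non-proportional roots when [n] is the larger square length. *)
Definition tri n t := [\/ t = 0, 2 * t = n | 2 * t = - n].

(* The possible inner products t of a root of square length M with a
   non-proportional root of square length 3 n, resp. n. *)
Definition long_product n M t := t = 0 \/
  [\/ M = 6 * n, 2 * M = 3 * n, M = 9 * n |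
    (M = 3 * n \/ M = n) /\ (2 * t = 3 * n \/ 2 * t = - (3 * n))].
Definition short_product n M t := t = 0 \/
  [\/ M = 2 * n, 2 * M = n, 3 * M = n |
    M = n /\ (2 * t = n \/ 2 * t = - n) \/
    M = 3 * n /\ (2 * t = 3 * n \/ 2 * t = - (3 * n))].

Lemma tri_3n n U V : 0 < n -> tri (3 * n) V -> tri (3 * n) U ->
  tri (3 * n) (U + 3 * V) -> V = 0.
Proof. by move=> n0 [] h1 [] h2 [] h3; lra. Qed.

Lemma tri_double n V : 0 < n -> tri n V -> tri n (2 * V) -> V = 0.
Proof. by move=> n0 [] h1 [] h2; lra. Qed.

Lemma tri_mixed n U V : 0 < n -> tri (3 * n) U -> tri n V -> tri n (U + V) -> U = 0.
Proof. by move=> n0 [] h1 [] h2 [] h3; lra. Qed.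

Lemma long_tri n M t : 0 < n -> M = 3 * n \/ M = n -> long_product n M t -> tri (3 * n) t.
Proof.
move=> n0 Mn [h|[h|h|h|[_ [h|h]]]]; [exact: Or31| | | |exact: Or32|exact: Or33];
  by exfalso; case: Mn => ?; lra.
Qed.

Lemma short_tri_long n M t : 0 < n -> M = 3 * n -> short_product n M t -> tri (3 * n) t.
Proof.
move=> n0 Mn [h|[h|h|h|[[h _]|[_ [h|h]]]]];
  [exact: Or31| | | | |exact: Or32|exact: Or33]; by exfalso; lra.
Qed.

Lemma short_tri_short n M t : 0 < n -> M = n -> short_product n M t -> tri n t.
Proof.
move=> n0 Mn [h|[h|h|h|[[_ [h|h]]|[h _]]]];
  [exact: Or31| | | |exact: Or32|exact: Or33|]; by exfalso; lra.
Qed.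

(** Each nonzero product restricts [M] to five values; only 3 n and n are common to both lists. *)
Lemma common_length n M t t' : 0 < n -> t <> 0 -> t' <> 0 ->
  long_product n M t -> short_product n M t' -> M = 3 * n \/ M = n.
Proof.
move=> n0 t0 t0' [//|hl] [//|hs].
by case: hl => [h|h|h|[h _]] //; case: hs => [h'|h'|h'|[[h' _]|[h' _]]]; lra.
Qed.

(** [U] and [V] are the products of a root with the long and the short simple root, and the
    hypotheses run over the six positive roots. Products are 0 or half a length up to sign, a set
    that the sums U + 3 V, 2 U or U + V leave unless both vanish. *)
Lemma G2_orthogonal n M U V : 0 < n ->
  long_product n M U -> long_product n M (U + 3 * V) -> long_product n M (2 * U + 3 * V) ->
  short_product n M V -> short_product n M (U + V) -> short_product n M (U + 2 * V) ->
  U = 0 /\ V = 0.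
Proof.
move=> n0 l1 l2 l3 s1 s2 s3; apply: contrapT => nz.
have [t t0 lt] : exists2 t, t <> 0 & long_product n M t.
  have [U0|U0] := eqVneq U 0; last by exists U => //; apply/eqP.
  by exists (U + 3 * V) => // h; apply: nz; split=> //; lra.
have [t' t0' st] : exists2 t, t <> 0 & short_product n M t.
  have [V0|V0] := eqVneq V 0; last by exists V => //; apply/eqP.
  by exists (U + V) => // h; apply: nz; split=> //; lra.
have Mn := common_length n0 t0 t0' lt st.
have L1 := long_tri n0 Mn l1; have L2 := long_tri n0 Mn l2; have L3 := long_tri n0 Mn l3.
apply: nz; case: Mn => Mn {lt st l1 l2 l3}.
  have V0 := tri_3n n0 (short_tri_long n0 Mn s1) L1 L2.
  split=> //; rewrite V0 mulr0 addr0 in L3.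
  by apply: tri_double L1 L3; rewrite mulr_gt0.
have S1 := short_tri_short n0 Mn s1; have S2 := short_tri_short n0 Mn s2.
have S3 := short_tri_short n0 Mn s3.
have U0 := tri_mixed n0 L1 S1 S2; split=> //; rewrite U0 add0r in S3.
exact: tri_double S1 S3.
Qed.

End G2Arithmetic.

(** * Propagation of a property of roots through an irreducible system *)

Section RootGeometry.
Variables (l : nat) (Phi : rootSystem l).
Hypothesis Phi_reduced : reduced Phi.
Hypothesis Phi_irreducible : irreducible Phi.
Hypothesis rank_ge2 : (2 <= l)%N.
Implicit Types (a b c d e m s : 'rV[rat]_l) (p : nat * nat).
Local Notation B := (rform Phi).

Lemma angle_cases a b : a \in roots Phi -> b \in roots Phi -> b != a -> 0 < B a b ->
  [\/ 2 * B a b = B a a /\ B a a = B b b,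
      2 * B a b = B a a /\ B a a = 2 * B b b,
      2 * B a b = B b b /\ B b b = 2 * B a a |
      2 * B a b = B a a /\ B a a = 3 * B b b \/
      2 * B a b = B b b /\ B b b = 3 * B a a].
Proof.
move=> aP bP ba ab0; have [k kle H] := angle Phi_reduced aP bP ba ab0.
have {kle} : k = 1%N \/ k = 2%N \/ k = 3%N by lia.
move: H => + kE; case: kE => [->|[->|->]] [[h1 h2]|[h1 h2]].
- by apply: Or41; split; lra.
- by apply: Or41; split; lra.
- by apply: Or43; split; lra.
- by apply: Or42; split; lra.
- by apply: Or44; right; split; lra.
- by apply: Or44; left; split; lra.
Qed.

(** The form is the square length of i c + j d for roots of equal length at angle 2 pi / 3, with
    that length as unit. *)
Lemma small_norm1 p : (0 < p.1)%N -> (0 < p.2)%N ->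
  (p.1%:R ^+ 2 + p.2%:R ^+ 2 - p.1%:R * p.2%:R : rat) <= 2 -> p = (1, 1)%N.
Proof.
case: p => i j /= i0 j0; rewrite lerBlDr -!natrX -natrM -!natrD ler_nat => h.
have h2 : (i * j <= 2)%N by nia.
have : (i <= 2)%N /\ (j <= 2)%N by nia.
by case: i j i0 j0 h h2 => [|[|[|i]]] [|[|[|j]]] //; lia.
Qed.

(** Four times the form is (2 j - 3 i) ^ 2 + 3 i ^ 2, which forces i = 1. *)
Lemma small_norm3 p : (0 < p.1)%N ->
  (3 * p.1%:R ^+ 2 + p.2%:R ^+ 2 - 3 * p.1%:R * p.2%:R : rat) = 1 ->
  p = (1, 1)%N \/ p = (1, 2)%N.
Proof.
case: p => i j /= i0 h.
have i1 : i = 1%N.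
  apply/eqP; rewrite eqn_leq i0 andbT leqNgt; apply/negP => i2.
  have I2 : 2 <= i%:R :> rat by rewrite ler_nat.
  have sq := sqr_ge0 (2 * j%:R - 3 * i%:R : rat).
  have : 3 * i%:R ^+ 2 <= 4 :> rat by nra.
  by nra.
have : (j%:R - 1) * (j%:R - 2) = 0 :> rat by move: h; rewrite i1; lra.
move/eqP; rewrite mulf_eq0 !subr_eq0 i1 (eqr_nat rat _ 1) (eqr_nat rat _ 2).
by case/orP => /eqP->; [left|right].
Qed.

(** A long and a short root at angle pi / 4, as in B2; [triple_pair] has the angle pi / 6 of G2. *)
Definition short_pair a b : Prop :=
  [/\ a \in roots Phi, b \in roots Phi, 2 * B a b = B a a & B a a = 2 * B b b].
Definition triple_pair a b : Prop :=
  [/\ a \in roots Phi, b \in roots Phi, 2 * B a b = B a a & B a a = 3 * B b b].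

Lemma is_base2 c d : c \in roots Phi -> d \in roots Phi -> d != c -> d != - c ->
  (forall e, e \in roots Phi -> exists i j, e = comb d c (i, j) \/ e = - comb d c (i, j)) ->
  is_base Phi [tuple d; c].
Proof.
move=> cP dP dc dNc H.
have span2 i j : comb d c (i, j) \in <<[tuple d; c]>>%VS.
  by rewrite memvD ?rpredMn // memv_span // !inE eqxx ?orbT.
split.
- rewrite basisEdim; apply/andP; split.
    apply/subvP => v _; have : (<<roots Phi>> <= <<[tuple d; c]>>)%VS.
      apply/span_subvP => e /H[i [j [->|->]]]; rewrite ?memvN; exact: span2.
    by rewrite roots_span => /subvP; apply; apply: memvf.
  by rewrite dimvf /dim /= mul1n.
- by move=> v; rewrite !inE => /orP[/eqP->|/eqP->].
move=> e /H[i [j Ee]]; exists (fun k : 'I_2 => if k == ord0 then i else j).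
by rewrite !big_ord_recl big_ord0 addr0 /=.
Qed.

Section Goodness.
Variable S : 'rV[rat]_l -> Prop.

(** What the commutator formula provides when [S] is [contains_root] and [k] is 1 or 2. *)
Definition propagates k := forall c d, c \in roots Phi -> d \in roots Phi ->
  d != c -> d != - c -> c - d \notin roots Phi -> c + d *+ k \in roots Phi ->
  (forall p, (0 < p.1)%N -> (0 < p.2)%N -> comb c d p \in roots Phi ->
     p != (1, k)%N -> S (comb c d p)) -> S (c + d *+ k).

Hypotheses (S1 : propagates 1) (S2 : propagates 2).

(** [a] is the sum of [a - b] and [b], of equal length at angle 2 pi / 3. Their difference a - 2 b
    has three times the square length of [a], so the bound excludes it; the bound also leaves no
    positive combination but (1, 1). *)
Lemma same_length_good a b : a \in roots Phi -> b \in roots Phi -> b != a ->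
  B a a = B b b -> 2 * B a b = B a a ->
  (forall e, e \in roots Phi -> B e a <> 0 \/ B e b <> 0 -> B e e <= 2 * B a a) -> S a.
Proof.
move=> aP bP ba ab Bab H; have a0 := root_norm_gt0 aP.
have Bba := rformC Phi b a.
have cP : a - b \in roots Phi by apply: root_sub => //; lra.
have aE : a = (a - b) + b *+ 1 by rewrite mulr1n subrK.
rewrite aE; apply: S1 => //; rewrite -?aE //.
- apply/eqP => E; have : B b (a - b) = B b b by rewrite -E.
  by rewrite !rformE; lra.
- apply/eqP => E; have : B b (- (a - b)) = B b b by rewrite -E.
  by rewrite !rformE; lra.
- apply/negP => eP; have := H _ eP; rewrite !rformE => h.
  have {}h := h (or_intror _); suff : False by [].
  have : B a a - B a b - B a b + (- B b a - - B b b - - B b b) +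
    (- B b a - - B b b - - B b b) <= 2 * B a a by apply: h; lra.
  lra.
move=> p p1 p2 pP /eqP []; apply: small_norm1 => //.
have i1 : 1 <= p.1%:R :> rat by rewrite ler1n.
have j1 : 1 <= p.2%:R :> rat by rewrite ler1n.
have Eab : B a b = B a a / 2 by lra.
have Ba : B (comb (a - b) b p) a = (p.1%:R + p.2%:R) * (B a a / 2).
  by rewrite /comb !rformE Bba Eab; field.
have Bp : B (comb (a - b) b p) (comb (a - b) b p)
    = (p.1%:R ^+ 2 + p.2%:R ^+ 2 - p.1%:R * p.2%:R) * B a a.
  by rewrite /comb !rformE Bba -ab Eab; field.
rewrite -(ler_pM2r a0) -Bp; apply: H => //; left.
by apply/eqP; rewrite Ba lt0r_neq0 // mulr_gt0 //; lra.
Qed.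

(** * Systems without roots at angle pi / 6 *)

Section NoTriple.
Hypothesis noTriple : forall a b, ~ triple_pair a b.

Lemma angle_cases2 a b : a \in roots Phi -> b \in roots Phi -> b != a -> 0 < B a b ->
  [\/ 2 * B a b = B a a /\ B a a = B b b,
      2 * B a b = B a a /\ B a a = 2 * B b b |
      2 * B a b = B b b /\ B b b = 2 * B a a].
Proof.
move=> aP bP ba ab0; have [|||[[h1 h2]|[h1 h2]]] := angle_cases aP bP ba ab0.
- exact: Or31. - exact: Or32. - exact: Or33.
- by case: (@noTriple a b).
by case: (@noTriple b a); split=> //; rewrite rformC.
Qed.

Lemma norm_le2 a e : a \in roots Phi -> e \in roots Phi -> B e a <> 0 ->
  B e e <= 2 * B a a.
Proof.
move=> aP eP ea; have a0 := root_norm_gt0 aP.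
have [->|en] := eqVneq e a; first by lra.
have [->|eNn] := eqVneq e (- a); first by rewrite !rformE; lra.
have [ea0|ea0] := ltP (B e a) 0; last first.
  have {}ea0 : 0 < B e a by rewrite lt_neqAle ea0 andbT eq_sym; apply/eqP.
  have ae : a != e by rewrite eq_sym.
  by have [] := angle_cases2 eP aP ae ea0; lra.
have ae : - a != e by rewrite eq_sym.
have := angle_cases2 eP (root_opp aP) ae; rewrite !rformE oppr_gt0 => /(_ ea0) [] [] *; lra.
Qed.

Lemma same_length_good2 a b : a \in roots Phi -> b \in roots Phi -> b != a ->
  0 < B a b -> B a a = B b b -> S a.
Proof.
move=> aP bP ba Bab0 ab; have a0 := root_norm_gt0 aP.
apply: (same_length_good aP bP ba ab).
  by have [] := angle_cases2 aP bP ba Bab0; lra.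
by move=> e eP [ea|eb]; [apply: norm_le2|rewrite ab; apply: norm_le2].
Qed.

(** Up to sign, [c] and [d] are the reflections of [m] in [s] and of [s] in [m]: simple roots of
    type B2. A root i c + j d has square length i ^ 2 + (j - i) ^ 2 in units of that of [s]; its
    angle with [d] or [- d] leaves only the two pairs. *)
Lemma short_pair_roots m s (c := s *+ 2 - m) (d := m - s) : short_pair m s ->
  [/\ c \in roots Phi, d \in roots Phi, (d != c) && (d != - c),
      c - d \notin roots Phi & c + d *+ 1 = s /\ c + d *+ 2 = m /\
      forall p, (0 < p.1)%N -> (0 < p.2)%N -> comb c d p \in roots Phi ->
        p = (1, 1)%N \/ p = (1, 2)%N].
Proof.
move=> [mP sP ms mm]; have s0 := root_norm_gt0 sP; have Bsm := rformC Phi s m.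
have m0 : B m m != 0 by rewrite lt0r_neq0 // root_norm_gt0.
have cP : c \in roots Phi.
  have := root_opp (reflect_root sP mP).
  by rewrite ms mm mulfK ?lt0r_neq0 // scaler_nat opprB.
have dP : d \in roots Phi.
  have := root_opp (reflect_root mP sP).
  by rewrite Bsm ms divff // scale1r opprB.
have Ecc : B c c = 2 * B s s by rewrite /c !rformE; lra.
have Edd : B d d = B s s by rewrite /d !rformE; lra.
have Ecd : B c d = - B s s by rewrite /c /d !rformE; lra.
have Edc : B d c = - B s s by rewrite rformC.
have dc : d != c by apply/eqP => E; move: Ecd; rewrite -E; lra.
have dNc : d != - c by apply/eqP => E; move: Edd; rewrite E !rformE; lra.
have E1 : c + d *+ 1 = s.
  by rewrite /c /d mulr1n mulr2n addrA subrK -addrA subrr addr0.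
have E2 : c + d *+ 2 = m by rewrite mulrS addrA -[c + d]/(c + d *+ 1) E1 /d mulr1n addrC subrK.
have Bes : B (c - d) s = B s s by rewrite /c /d !rformE; lra.
have Bee : B (c - d) (c - d) = 5 * B s s by rewrite /c /d !rformE; lra.
clearbody c d; split=> //; first by rewrite dc.
- apply/negP => eP.
  have es : s != c - d.
    by apply/eqP => E; move: Bee; rewrite -E; lra.
  by have := angle_cases2 eP sP es; rewrite Bes Bee => /(_ s0) [] [] *; lra.
split=> //; split=> // p p1 p2 pP.
have [i i1 iE] : exists2 i : rat, 1 <= i & i = p.1%:R by exists p.1%:R; rewrite // ler1n.
have [j j1 jE] : exists2 j : rat, 1 <= j & j = p.2%:R by exists p.2%:R; rewrite // ler1n.
have Bp : B (comb c d p) (comb c d p) = (i ^+ 2 + (j - i) ^+ 2) * B s s.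
  by rewrite /comb !rformE Ecc Edd Ecd Edc -iE -jE; ring.
have Bd : B (comb c d p) d = (j - i) * B s s.
  by rewrite /comb !rformE Edd Ecd -iE -jE; ring.
have [_ _ pd pNd] := comb_notprop Phi_reduced cP dP dc dNc p1 p2.
have cancel (u v : rat) : u * B s s = v * B s s -> u = v by apply/mulIf/lt0r_neq0.
(* [r] is the absolute value of j - i, when this is not 0. *)
have key r : 1 <= r -> [\/ 2 * (r * B s s) = (i ^+ 2 + r ^+ 2) * B s s /\
      (i ^+ 2 + r ^+ 2) * B s s = B s s,
    2 * (r * B s s) = (i ^+ 2 + r ^+ 2) * B s s /\
      (i ^+ 2 + r ^+ 2) * B s s = 2 * B s s |
    2 * (r * B s s) = B s s /\ B s s = 2 * ((i ^+ 2 + r ^+ 2) * B s s)] ->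
    r = 1 /\ i = 1.
  move=> r1 [] [h1 h2].
  - have e1 : 2 * r = 1 by apply: cancel; lra.
    lra.
  - have e1 : 2 * r = 2 by apply: cancel; lra.
    have e2 : i ^+ 2 + r ^+ 2 = 2 by apply: cancel; lra.
    have r1' : r = 1 by lra.
    by split=> //; rewrite r1' in e2; nra.
  have e1 : 2 * r = 1 by apply: cancel; lra.
  lra.
have [ji|ij|ij] := ltngtP p.2 p.1.
- have r1 : 1 <= i - j by rewrite iE jE -natrB ?ler1n ?subn_gt0 // ltnW.
  have pd' : - d != comb c d p by rewrite eq_sym.
  have := angle_cases2 pP (root_opp dP) pd'.
  have -> : B (comb c d p) (- d) = (i - j) * B s s by rewrite rformNr Bd; ring.
  have -> : B (- d) (- d) = B s s by rewrite rformNr rformNl opprK.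
  rewrite Bp -[(j - i) ^+ 2]sqrrN opprB => /(_ (mulr_gt0 (lt_le_trans ltr01 r1) s0))/(key _ r1) [? ?].
  by exfalso; lra.
- have r1 : 1 <= j - i by rewrite iE jE -natrB ?ler1n ?subn_gt0 // ltnW.
  have pd' : d != comb c d p by rewrite eq_sym.
  have := angle_cases2 pP dP pd'.
  rewrite Bd Bp Edd => /(_ (mulr_gt0 (lt_le_trans ltr01 r1) s0))/(key _ r1) [rE iE1].
  right; have /eqP : p.1%:R = 1 :> rat by rewrite -iE.
  have /eqP : p.2%:R = 2 :> rat by rewrite -jE; lra.
  rewrite (eqr_nat rat _ 2) (eqr_nat rat _ 1).
  by case: (p) => ? ? /= /eqP -> /eqP ->.
(* With equal coordinates the root is a multiple of c + d = s. *)
left; have := pP; rewrite /comb ij -mulrnDl -[c + d]/(c + d *+ 1) E1 -scaler_nat.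
move=> /(Phi_reduced sP) [/eqP|/eqP].
  by rewrite (eqr_nat rat _ 1) => /eqP p11; move: ij; case: (p) p11 => ? ? /= -> ->.
by move/eqP; rewrite -iE => iN; exfalso; lra.
Qed.

(** For equal lengths [S b] holds outright. Otherwise a B2 configuration has its short root at (1,
    1), its long root at (1, 2) and no further combination, so each follows from the other. *)
Lemma acute_good a b : a \in roots Phi -> b \in roots Phi -> b != a -> 0 < B a b ->
  S a -> S b.
Proof.
move=> aP bP ba ab Sa.
have Bba : 0 < B b a by rewrite rformC.
have ab' : a != b by rewrite eq_sym.
have [[_ h]|[h1 h2]|[h1 h2]] := angle_cases2 aP bP ba ab.
- exact: (same_length_good2 bP aP).
- have [cP dP /andP[dc dNc] cdP [E1 [E2 only]]] := @short_pair_roots a b (And4 aP bP h1 h2).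
  rewrite -{}E1 in bP *; apply: S1 => // p p1 p2 pP p11.
  by have [pE|pE] := only p p1 p2 pP; [rewrite pE eqxx in p11|rewrite pE /comb mulr1n E2].
have h3 : 2 * B b a = B b b by rewrite rformC.
have [cP dP /andP[dc dNc] cdP [E1 [E2 only]]] := @short_pair_roots b a (And4 bP aP h3 h2).
rewrite -{}E2 in bP *; apply: S2 => // p p1 p2 pP p12.
by have [pE|pE] := only p p1 p2 pP; [rewrite pE /comb mulr1n E1|rewrite pE eqxx in p12].
Qed.

(** In the chain a, a + b, a + 2 b, b consecutive roots are at acute angles. *)
Lemma obtuse_chain a b : a \in roots Phi -> b \in roots Phi ->
  2 * B a b = - B a a -> B a a = 2 * B b b -> S a <-> S b.
Proof.
move=> aP bP h1 h2; have b0 := root_norm_gt0 bP; have Bba := rformC Phi b a.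
have abP : a + b *+ 2 \in roots Phi.
  have := reflect_root bP aP.
  have -> : 2 * B a b / B b b = - 2 by rewrite h1 h2 mulNr mulfK // lt0r_neq0.
  by rewrite scaleNr opprK scaler_nat.
have a1P : a + b \in roots Phi.
  apply: (root_add Phi_reduced) => //; last by lra.
  have a0 := root_norm_gt0 aP.
  by apply/eqP => E; move: h2; rewrite E !rformE; lra.
have n1 : B (a + b) (a + b) = B b b by rewrite !rformE; lra.
have n2 : B (a + b *+ 2) (a + b *+ 2) = 2 * B b b by rewrite !rformE; lra.
have l1 : a + b != a by apply/eqP => E; move: n1; rewrite E; lra.
have l2 : a + b *+ 2 != a + b by apply/eqP => E; move: n2; rewrite E; lra.
have l3 : b != a + b *+ 2 by apply/eqP => E; move: n2; rewrite -E; lra.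
have p1 : 0 < B a (a + b) by rewrite !rformE; lra.
have p2 : 0 < B (a + b) (a + b *+ 2) by rewrite !rformE; lra.
have p3 : 0 < B (a + b *+ 2) b by rewrite !rformE; lra.
split=> [/(acute_good aP a1P l1 p1)/(acute_good a1P abP l2 p2)|]; first exact: acute_good.
rewrite rformC in p1; rewrite rformC in p2; rewrite rformC in p3.
rewrite eq_sym in l1; rewrite eq_sym in l2; rewrite eq_sym in l3.
by move=> /(acute_good bP abP l3 p3)/(acute_good abP a1P l2 p2); apply: acute_good.
Qed.

Lemma obtuse_good a b : a \in roots Phi -> b \in roots Phi -> b != - a -> B a b < 0 ->
  S a -> S b.
Proof.
move=> aP bP bNa ab Sa.
have ba : - b != a by rewrite eqr_oppLR.
have := angle_cases2 aP (root_opp bP) ba.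
rewrite !rformE opprK oppr_gt0 => /(_ ab) [[_ h]|[h1 h2]|[h1 h2]].
- apply: (same_length_good2 bP (root_opp aP)); rewrite ?rformE ?opprK //.
    by rewrite eq_sym.
  by rewrite rformC oppr_gt0.
- have e1 : 2 * B a b = - B a a by lra.
  by have [+ _] := obtuse_chain aP bP e1 h2; apply.
have e1 : 2 * B b a = - B b b by rewrite rformC; lra.
by have [_] := obtuse_chain bP aP e1 h2; apply.
Qed.

Lemma all_good a : a \in roots Phi -> S a -> forall b, b \in roots Phi -> S b.
Proof.
move=> aP Sa; suff H b : b \in roots Phi -> `[< S b >] by move=> b /H /asboolP.
apply: (irreducible_closed Phi_irreducible aP (S := fun v => `[< S v >])).
  exact/asboolP.
move=> {}b c bP cP /asboolP Sb bc; apply/asboolP.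
have [->//|cb] := eqVneq c b.
(* A neighbor e of d is good by [acute_good], and e is at an obtuse angle with -d. *)
have neg d : d \in roots Phi -> S d -> S (- d).
  move=> dP Sd; have [e eP [ed eNd de]] := root_neighbor Phi_irreducible rank_ge2 dP.
  apply: (obtuse_good eP (root_opp dP)); last exact: (acute_good dP eP).
    by rewrite (inj_eq oppr_inj) eq_sym.
  by rewrite rformNr oppr_lt0 rformC.
have [->|cNb] := eqVneq c (- b); first exact: neg.
by move: bc; rewrite neq_lt => /orP[bc|bc]; [apply: (obtuse_good bP)|apply: (acute_good bP)].
Qed.

End NoTriple.

Definition propagates12 := forall c d, c \in roots Phi -> d \in roots Phi ->
  d != c -> d != - c -> c - d \notin roots Phi -> c + d *+ 2 \in roots Phi ->
  (forall p, (0 < p.1)%N -> (0 < p.2)%N -> comb c d p \in roots Phi ->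
     p != (1, 1)%N -> p != (1, 2)%N -> S (comb c d p)) -> S (c + d *+ 2).

Section NoSameLength.
Hypothesis noTriple : forall a b, ~ triple_pair a b.
Hypothesis noSame : forall a b, a \in roots Phi -> b \in roots Phi -> b != a ->
  0 < B a b -> B a a <> B b b.

Lemma nonorth_norm e z : e \in roots Phi -> z \in roots Phi -> e != z -> e != - z ->
  B e z <> 0 -> B e e = 2 * B z z \/ B z z = 2 * B e e.
Proof.
move=> eP zP ez eNz eznz; have [ez0|ez0] := ltP (B e z) 0; last first.
  have {}ez0 : 0 < B e z by rewrite lt_neqAle ez0 andbT eq_sym; apply/eqP.
  have ze : z != e by rewrite eq_sym.
  have [[_ h]|[_ h]|[_ h]] := angle_cases2 noTriple eP zP ze ez0; [|by left|by right].
  by case: (noSame eP zP ze ez0).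
have ze : - z != e by rewrite eq_sym.
have ez0' : 0 < B e (- z) by rewrite rformNr oppr_gt0.
have Bz : B (- z) (- z) = B z z by rewrite rformNl rformNr opprK.
have := angle_cases2 noTriple eP (root_opp zP) ze ez0'.
rewrite Bz => -[[_ h]|[_ h]|[_ h]]; [|by left|by right].
by case: (noSame eP (root_opp zP) ze ez0'); rewrite Bz.
Qed.

(** A root outside the eight known ones is orthogonal to each of them or has square length ratio 2
    with it. The ratio cannot be 2 for a long and a short one together, so it is orthogonal to all
    long or to all short ones; either kind spans the plane, and irreducibility excludes such a
    root. *)
Lemma rank2_B2 m s : short_pair m s -> is_B2 Phi.
Proof.
move=> ms; have [cP dP /andP[dc dNc] cdP [E1 [E2 only]]] := short_pair_roots noTriple ms.
have [mP sP h1 h2] := ms.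
move: cP dP dc dNc cdP E1 E2 only.
have Ecc : B (s *+ 2 - m) (s *+ 2 - m) = 2 * B s s by rewrite !rformE (rformC _ s m); lra.
have Edd : B (m - s) (m - s) = B s s by rewrite !rformE (rformC _ s m); lra.
have Ecd : B (s *+ 2 - m) (m - s) = - B s s by rewrite !rformE (rformC _ s m); lra.
move: (s *+ 2 - m) (m - s) Ecc Edd Ecd => c d Ecc Edd Ecd cP dP dc dNc cdP E1 E2 only.
have Edc : B d c = - B s s by rewrite rformC.
have s0 := root_norm_gt0 sP.
pose L := [:: c; d; c + d *+ 1; c + d *+ 2].
have LP z : z \in L -> z \in roots Phi.
  by rewrite !inE E1 E2 => /or4P[] /eqP->.
have inL e : e \in roots Phi -> (e \in L) || (- e \in L).
  apply: (irreducible_closed Phi_irreducible cP (S := fun e => (e \in L) || (- e \in L))).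
    by rewrite inE eqxx.
  move=> b {}e bP eP bL; apply: contraNT => eL.
  have nn z : z \in L -> B e z <> 0 -> B e e = 2 * B z z \/ B z z = 2 * B e e.
    move=> zL; apply: nonorth_norm => //; first exact: LP.
      by apply: contraNneq eL => ->; rewrite zL.
    by apply: contraNneq eL => ->; rewrite opprK zL orbT.
  have e0 := root_norm_gt0 eP.
  have n1 : B (c + d *+ 1) (c + d *+ 1) = B s s by rewrite !rformE; lra.
  have n2 : B (c + d *+ 2) (c + d *+ 2) = 2 * B s s by rewrite !rformE; lra.
  have m1 : B e (c + d *+ 1) = B e c + B e d by rewrite !rformE; lra.
  have m2 : B e (c + d *+ 2) = B e c + 2 * B e d by rewrite !rformE; lra.
  have := nn c (mem_head _ _); have := nn d; have := nn (c + d *+ 1); have := nn (c + d *+ 2).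
  rewrite !inE !eqxx !orbT n1 n2 m1 m2 Ecc Edd => /(_ isT) q2 /(_ isT) q1 /(_ isT) qd qc.
  have ed0 : B e d = 0.
    apply: contrapT => ed; have {}qd := qd ed.
    have ec0 : B e c = 0 by apply: contrapT => /qc []; lra.
    have : B e c + 2 * B e d = 0 by apply: contrapT => /q2 []; lra.
    lra.
  have ec0 : B e c = 0.
    apply: contrapT => ec; have {}qc := qc ec.
    have : B e c + B e d = 0 by apply: contrapT => /q1 []; lra.
    lra.
  have zero z : z \in L -> B z e = 0.
    by rewrite rformC !inE => /or4P[] /eqP->; rewrite ?m1 ?m2 ?ec0 ?ed0 ?mulr0 ?addr0.
  apply/eqP; case/orP: bL => [/zero//|/zero].
  by rewrite rformNl => /eqP; rewrite oppr_eq0 => /eqP.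
(* The short root comes first: the pairing equal to -1 is that of [d] with the coroot of [c]. *)
exists d, c; split.
  apply: is_base2 => // e /inL; have gen z : z \in L -> exists i j, z = comb d c (i, j).
    rewrite !inE /comb => /or4P[] /eqP->.
    - by exists 0%N, 1%N; rewrite mulr0n add0r.
    - by exists 1%N, 0%N; rewrite mulr0n addr0.
    - by exists 1%N, 1%N; rewrite addrC.
    - by exists 2%N, 1%N; rewrite addrC.
  case/orP => /gen[i [j E]]; exists i, j; [by left|right].
  by rewrite -E opprK.
by rewrite !pairingE // Ecc Edd Ecd Edc; split; field; lra.
Qed.

End NoSameLength.

Lemma noTriple_good : (forall a b, ~ triple_pair a b) -> (is_B2 Phi -> propagates12) ->
  forall a, a \in roots Phi -> S a.
Proof.
move=> noT noF2; have [a0 a0P] := Phi_irreducible.1.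
have [[a [b [aP bP ba [ab h]]]]|noSame] := pselect (exists a b,
  [/\ a \in roots Phi, b \in roots Phi, b != a & 0 < B a b /\ B a a = B b b]).
  by apply: (all_good noT aP); apply: (same_length_good2 noT aP bP).
have noS a b : a \in roots Phi -> b \in roots Phi -> b != a ->
  0 < B a b -> B a a <> B b b.
  by move=> aP bP ba ab h; apply: noSame; exists a, b.
have [b bP [ba bNa ab]] := root_neighbor Phi_irreducible rank_ge2 a0P.
(* Without acute pairs of equal length, a root and a neighbor have square length ratio 2. *)
have [m [s ms]] : exists m s, short_pair m s.
  have [[_ h]|[h1 h2]|[h1 h2]] := angle_cases2 noT a0P bP ba ab.
  - by case: (noS _ _ a0P bP ba ab).
  - by exists a0, b.
  by exists b, a0; split; rewrite // rformC.
have [cP dP /andP[dc dNc] cdP [E1 [E2 only]]] := short_pair_roots noT ms.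
have [mP sP _ _] := ms; apply: (all_good noT mP); rewrite -E2.
apply: noF2 => //; [exact: (rank2_B2 noT noS ms)|by rewrite E2|].
by move=> p p1 p2 pP; have [->|->] := only p p1 p2 pP; rewrite eqxx.
Qed.


(** [d] is minus the reflection of [s] in [m], and [c] is the reflection of [m] in [d]: simple roots
    of type G2, with [c] long. *)
Lemma triple_pair_roots m s (c := s *+ 3 - m *+ 2) (d := m - s) : triple_pair m s ->
  [/\ c \in roots Phi, d \in roots Phi, (d != c) && (d != - c),
      [/\ B c c = 3 * B s s, B d d = B s s & 2 * B c d = - 3 * B s s] &
      c + d *+ 2 = s /\ c + d *+ 3 = m].
Proof.
move=> [mP sP ms mm]; have s0 := root_norm_gt0 sP; have Bsm := rformC Phi s m.
have m0 : B m m != 0 by rewrite lt0r_neq0 // root_norm_gt0.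
have Ecc : B c c = 3 * B s s by rewrite /c !rformE; lra.
have Edd : B d d = B s s by rewrite /d !rformE; lra.
have Ecd : 2 * B c d = - 3 * B s s by rewrite /c /d !rformE; lra.
have Emd : 2 * B m d = 3 * B s s by rewrite /d !rformE; lra.
have E2 : c + d *+ 2 = s.
  by rewrite /c /d mulrnBl addrA subrK mulrSr addrAC subrr add0r.
have E3 : c + d *+ 3 = m by rewrite mulrSr addrA E2 /d addrC subrK.
have dP : d \in roots Phi.
  have := root_opp (reflect_root mP sP).
  by rewrite Bsm ms divff // scale1r opprB.
have cP : c \in roots Phi.
  have := reflect_root dP mP.
  rewrite Emd Edd mulfK ?lt0r_neq0 // scaler_nat.
  by rewrite -{1}E3 addrK.
split=> //; apply/andP; split; apply/eqP => E.
  by move: Ecd; rewrite E Ecc; lra.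
by move: Edd; rewrite E rformNr rformNl opprK Ecc; lra.
Qed.

Lemma nonorth_vals e z : e \in roots Phi -> z \in roots Phi -> e != z -> e != - z ->
  B e z = 0 \/ exists2 w, B e z = w \/ B e z = - w &
   [\/ 2 * w = B e e /\ B e e = B z z,
      2 * w = B e e /\ B e e = 2 * B z z,
      2 * w = B z z /\ B z z = 2 * B e e |
      2 * w = B e e /\ B e e = 3 * B z z \/
      2 * w = B z z /\ B z z = 3 * B e e].
Proof.
move=> eP zP ez eNz; have [ez0|ez0|] := ltgtP (B e z) 0; last by left.
  right; exists (- B e z); first by right; rewrite opprK.
  have ze : - z != e by rewrite eq_sym.
  have ez0' : 0 < B e (- z) by rewrite rformNr oppr_gt0.
  have Bz : B (- z) (- z) = B z z by rewrite rformNl rformNr opprK.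
  by have := angle_cases eP (root_opp zP) ze ez0'; rewrite Bz rformNr.
right; exists (B e z); first by left.
by apply: angle_cases; rewrite // eq_sym.
Qed.

(** * Systems with a G2 configuration *)

Section Triple.
Variables c d : 'rV[rat]_l.
Variable n : rat.
Hypotheses (cP : c \in roots Phi) (dP : d \in roots Phi) (n0 : 0 < n).
Hypotheses (dc : d != c) (dNc : d != - c).
Hypotheses (Ecc : B c c = 3 * n) (Edd : B d d = n) (Ecd : 2 * B c d = - 3 * n).
Hypothesis c3P : c + d *+ 3 \in roots Phi.

(** The positive roots of G2 for the simple roots [c] and [d]. *)
Let L := [:: c; d; c + d; c + d *+ 2; c + d *+ 3; c *+ 2 + d *+ 3].

Lemma G2_positive_roots z : z \in L -> z \in roots Phi.
Proof.
have [Hcc Hdd Hcd n_gt0] := And4 Ecc Edd Ecd n0.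
have Hdc : 2 * B d c = - 3 * n by rewrite rformC.
have cd : c != d by rewrite eq_sym.
have cNd : c != - d by rewrite -eqr_oppLR eq_sym.
have str i : (i <= 3)%N -> c + d *+ i \in roots Phi.
  exact: (string_unbroken Phi_reduced dP cP cd cNd c3P).
have c23P : c *+ 2 + d *+ 3 \in roots Phi.
  have := reflect_root cP c3P.
  have -> : 2 * B (c + d *+ 3) c / B c c = - 1.
    have -> : 2 * B (c + d *+ 3) c = - B c c by rewrite !rformE; lra.
    by rewrite mulNr divff // lt0r_neq0 // root_norm_gt0.
  by rewrite scaleNr opprK scale1r addrC addrA -mulr2n.
rewrite !inE => /or4P[/eqP->|/eqP->|/eqP->|/or3P[]/eqP->] //.
- by have := str 1%N isT; rewrite mulr1n.
- exact: (str 2%N).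
Qed.

(** A root outside [L] and its opposite satisfies the constraints of [G2_orthogonal], hence is
    orthogonal to [L]; irreducibility leaves no such root. *)
Lemma G2_roots e : e \in roots Phi -> (e \in L) || (- e \in L).
Proof.
have [Hcc Hdd Hcd n_gt0] := And4 Ecc Edd Ecd n0.
have Hdc : 2 * B d c = - 3 * n by rewrite rformC.
apply: (irreducible_closed Phi_irreducible cP (S := fun e => (e \in L) || (- e \in L))).
  by rewrite inE eqxx.
move=> b {}e bP eP bL; apply: contraNT => eL.
have e0 := root_norm_gt0 eP.
have nn z : z \in L -> B e z = 0 \/ exists2 w, B e z = w \/ B e z = - w &
   [\/ 2 * w = B e e /\ B e e = B z z,
      2 * w = B e e /\ B e e = 2 * B z z,
      2 * w = B z z /\ B z z = 2 * B e e |
      2 * w = B e e /\ B e e = 3 * B z z \/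
      2 * w = B z z /\ B z z = 3 * B e e].
  move=> zL; apply: nonorth_vals => //; first exact: G2_positive_roots.
    by apply: contraNneq eL => ->; rewrite zL.
  by apply: contraNneq eL => ->; rewrite opprK zL orbT.
have long z : z \in L -> B z z = 3 * n -> long_product n (B e e) (B e z).
  move=> /nn [->|[w wE H]] zn; first by left.
  right; move: H n_gt0; rewrite zn; case: wE => ->;
  move: {Hcc Hdd Hcd Hdc e0 zn} (B e e) => M [[h1 h2]|[h1 h2]|[h1 h2]|[[h1 h2]|[h1 h2]]] n_gt0;
  by [apply: Or44; split; [left|left; lra]; lra | apply: Or41; lra | apply: Or42; lra
     |apply: Or43; lra | apply: Or44; split; [right|left; lra]; lra
     |apply: Or44; split; [left|right; lra]; lra|apply: Or44; split; [right|right; lra]; lra].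
have short z : z \in L -> B z z = n -> short_product n (B e e) (B e z).
  move=> /nn [->|[w wE H]] zn; first by left.
  right; move: H n_gt0; rewrite zn; case: wE => ->;
  move: {Hcc Hdd Hcd Hdc e0 zn} (B e e) => M [[h1 h2]|[h1 h2]|[h1 h2]|[[h1 h2]|[h1 h2]]] n_gt0;
  by [apply: Or44; left; split; [|left; lra]; lra | apply: Or41; lra | apply: Or42; lra
     |apply: Or43; lra | apply: Or44; right; split; [|left; lra]; lra
     |apply: Or44; left; split; [|right; lra]; lra|apply: Or44; right; split; [|right; lra]; lra].
have m1 : B e (c + d) = B e c + B e d by rewrite !rformE.
have m2 : B e (c + d *+ 2) = B e c + 2 * B e d by rewrite !rformE.
have m3 : B e (c + d *+ 3) = B e c + 3 * B e d by rewrite !rformE.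
have m4 : B e (c *+ 2 + d *+ 3) = 2 * B e c + 3 * B e d by rewrite !rformE.
have N1 : B (c + d) (c + d) = n by rewrite !rformE; lra.
have N2 : B (c + d *+ 2) (c + d *+ 2) = n by rewrite !rformE; lra.
have N3 : B (c + d *+ 3) (c + d *+ 3) = 3 * n by rewrite !rformE; lra.
have N4 : B (c *+ 2 + d *+ 3) (c *+ 2 + d *+ 3) = 3 * n by rewrite !rformE; lra.
have lc := long c; have l3 := long (c + d *+ 3); have l4 := long (c *+ 2 + d *+ 3).
have sd := short d; have s1 := short (c + d); have s2 := short (c + d *+ 2).
move: {long short nn} lc l3 l4 sd s1 s2.
rewrite m1 m2 m3 m4 !inE !eqxx !orbT => /(_ isT Ecc) lc /(_ isT N3) l3 /(_ isT N4) l4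
  /(_ isT Edd) sd /(_ isT N1) s1 /(_ isT N2) s2.
have [U0 V0] := G2_orthogonal n_gt0 lc l3 l4 sd s1 s2.
have zero z : z \in L -> B z e = 0.
  rewrite rformC !inE => /or4P[/eqP->|/eqP->|/eqP->|/or3P[]/eqP->] //;
    by rewrite ?m1 ?m2 ?m3 ?m4 ?U0 ?V0 ?mulr0 ?addr0.
apply/eqP; case/orP: bL => [/zero//|/zero].
by rewrite rformNl => /eqP; rewrite oppr_eq0 => /eqP.
Qed.

Lemma G2_norms e : e \in roots Phi -> B e e = 3 * n \/ B e e = n.
Proof.
have [Hcc Hdd Hcd n_gt0] := And4 Ecc Edd Ecd n0.
have Hdc : 2 * B d c = - 3 * n by rewrite rformC.
have gen z : z \in L -> B z z = 3 * n \/ B z z = n.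
  rewrite !inE => /or4P[/eqP->|/eqP->|/eqP->|/or3P[]/eqP->]; rewrite ?rformE;
    first [by left; lra | by right; lra].
by move=> /G2_roots/orP[/gen//|/gen]; rewrite rformNl rformNr opprK.
Qed.

(** The long roots form an A2 system, so each has a long neighbor at angle pi / 3, and no root is
    longer. *)
Lemma G2_long_good z : z \in roots Phi -> B z z = 3 * n -> S z.
Proof.
have [Hcc Hdd Hcd n_gt0] := And4 Ecc Edd Ecd n0.
have Hdc : 2 * B d c = - 3 * n by rewrite rformC.
move=> zP zz.
have gen y : y \in L -> B y y = 3 * n ->
    exists2 b, b \in L & B b b = 3 * n /\ 2 * B y b = 3 * n.
  rewrite {1}/L !inE => /or4P[/eqP->|/eqP->|/eqP->|/or3P[]/eqP->]; rewrite ?rformE => yy.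
  - by exists (c *+ 2 + d *+ 3); rewrite ?inE ?eqxx ?orbT // !rformE; split; lra.
  - by exfalso; lra.
  - by exfalso; lra.
  - by exfalso; lra.
  - by exists (c *+ 2 + d *+ 3); rewrite ?inE ?eqxx ?orbT // !rformE; split; lra.
  - by exists c; rewrite ?inE ?eqxx // !rformE; split; lra.
have [b bP [bb zb]] : exists2 b, b \in roots Phi & B b b = 3 * n /\ 2 * B z b = 3 * n.
  have /orP[/gen/(_ zz)[b bL [h1 h2]]|/gen] := G2_roots zP.
    by exists b => //; apply: G2_positive_roots.
  rewrite rformNl rformNr opprK => /(_ zz)[b bL [h1 h2]].
  exists (- b); first exact/root_opp/G2_positive_roots.
  by rewrite rformNl !rformNr opprK; rewrite rformNl in h2.
apply: (same_length_good zP bP); [|by rewrite zz bb|by rewrite zb zz|].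
  by apply/eqP => E; move: zb; rewrite E zz; lra.
by move=> e /G2_norms [->|->] _; rewrite zz; lra.
Qed.

Lemma G2_type : is_G2 Phi.
Proof.
exists d, c; split.
  apply: is_base2 => // e /G2_roots; have gen z : z \in L -> exists i j, z = comb d c (i, j).
    rewrite !inE /comb => /or4P[/eqP->|/eqP->|/eqP->|/or3P[]/eqP->].
    - by exists 0%N, 1%N; rewrite mulr0n add0r.
    - by exists 1%N, 0%N; rewrite mulr0n addr0.
    - by exists 1%N, 1%N; rewrite addrC.
    - by exists 2%N, 1%N; rewrite addrC.
    - by exists 3%N, 1%N; rewrite addrC.
    - by exists 3%N, 2%N; rewrite addrC.
  case/orP => /gen[i [j E]]; exists i, j; [by left|right].
  by rewrite -E opprK.
have [Hcc Hdd Hcd n_gt0] := And4 Ecc Edd Ecd n0.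
have Hdc : 2 * B d c = - 3 * n by rewrite rformC.
have [Ecd' Edc'] : B c d = - 3 * n / 2 /\ B d c = - 3 * n / 2 by split; lra.
by rewrite !pairingE // Ecc Edd Ecd' Edc'; split; field; exact: lt0r_neq0.
Qed.

(** A long root at angle pi / 6 yields simple roots c', d' with z = c' + 2 d'. Short combinations
    occur only at (1, 1) and (1, 2); the others are long and already good. *)
Lemma G2_short_good z : (is_G2 Phi -> propagates12) ->
  z \in roots Phi -> B z z = n -> S z.
Proof.
have [Hcc Hdd Hcd n_gt0] := And4 Ecc Edd Ecd n0.
have Hdc : 2 * B d c = - 3 * n by rewrite rformC.
move=> noF2 zP zz.
have gen y : y \in L -> B y y = n ->
    exists2 b, b \in L & B b b = 3 * n /\ 2 * B b y = 3 * n.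
  rewrite {1}/L !inE => /or4P[/eqP->|/eqP->|/eqP->|/or3P[]/eqP->]; rewrite ?rformE => yy.
  - by exfalso; lra.
  - by exists (c + d *+ 3); rewrite ?inE ?eqxx ?orbT // !rformE; split; lra.
  - by exists c; rewrite ?inE ?eqxx // !rformE; split; lra.
  - by exists (c + d *+ 3); rewrite ?inE ?eqxx ?orbT // !rformE; split; lra.
  - by exfalso; lra.
  - by exfalso; lra.
have [b bP [bb bz]] : exists2 b, b \in roots Phi & B b b = 3 * n /\ 2 * B b z = 3 * n.
  have /orP[/gen/(_ zz)[b bL [h1 h2]]|/gen] := G2_roots zP.
    by exists b => //; apply: G2_positive_roots.
  rewrite rformNl rformNr opprK => /(_ zz)[b bL [h1 h2]].
  exists (- b); first exact/root_opp/G2_positive_roots.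
  by rewrite !rformNl rformNr opprK; rewrite rformNr in h2.
have tr : triple_pair b z by split; rewrite // ?bb ?zz.
have [c'P d'P /andP[dc' dNc'] [Ecc' Edd' Ecd'] [E2 E3]] := triple_pair_roots tr.
have norm_comb c' d' p : B c' c' = 3 * n -> B d' d' = n -> 2 * B c' d' = - 3 * n ->
    B (comb c' d' p) (comb c' d' p)
      = (3 * p.1%:R ^+ 2 + p.2%:R ^+ 2 - 3 * p.1%:R * p.2%:R) * n.
  move=> h1 h2 h3; rewrite /comb !rformE h1 h2 (rformC _ d' c').
  have -> : B c' d' = - 3 * n / 2 by lra.
  by field.
rewrite -E2; apply: (noF2 G2_type) => //; last 2 first.
- by rewrite E2.
- move=> p p1 p2 pP p11 p12.
  have [long|short] := G2_norms pP; first exact: G2_long_good.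
  exfalso; suff [pE|pE] : p = (1, 1)%N \/ p = (1, 2)%N.
  - by rewrite pE eqxx in p11. - by rewrite pE eqxx in p12.
  apply: small_norm3 => //; apply: (mulIf (lt0r_neq0 n_gt0)).
  rewrite mul1r -[RHS]short norm_comb ?Ecc' ?Edd' ?Ecd' ?zz //.
(* The difference of the two simple roots has square length 7 n, while roots have n or 3 n. *)
have E7 : B (z *+ 3 - b *+ 2 - (b - z)) (z *+ 3 - b *+ 2 - (b - z)) = 7 * n.
  have Bbz := rformC Phi b z; rewrite !rformE; lra.
by apply/negP => /G2_norms; rewrite E7 => -[]; lra.
Qed.

End Triple.

Theorem all_roots_good : (is_B2 Phi \/ is_G2 Phi -> propagates12) ->
  forall a, a \in roots Phi -> S a.
Proof.
move=> noF2; have [[m [s ms]]|noT] := pselect (exists m s, triple_pair m s); last first.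
  apply: noTriple_good => [a b ab|B2]; last by apply: noF2; left.
  by apply: noT; exists a, b.
have [mP sP _ _] := ms.
have [cP dP /andP[dc dNc] [Ecc Edd Ecd] [E2 E3]] := triple_pair_roots ms.
rewrite -E3 in mP; have s0 := root_norm_gt0 sP.
move=> a aP; have [aa|aa] := G2_norms cP dP s0 dc dNc Ecc Edd Ecd mP aP.
  exact: (G2_long_good cP dP s0 dc dNc Ecc Edd Ecd mP).
by apply: (G2_short_good cP dP s0 dc dNc Ecc Edd Ecd mP) => // G2; apply: noF2; right.
Qed.

End Goodness.
End RootGeometry.

(** * The two inclusions between the commutator subgroup and the relative elementary subgroup *)

Theorem theorem3 (l : nat) (Phi : rootSystem l) (P : set 'rV[rat]_l)
    (D : chevalleyRep Phi P) (R : comPzRingType) (I J : set R)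
    (Phi_reduced : reduced Phi) (Phi_irreducible : irreducible Phi)
    (rank_ge2 : (2 <= l)%N) (P_lattice : intermediate_lattice Phi P)
    (no_F2 : is_B2 Phi \/ is_G2 Phi -> ~ has_residue_field R 'F_2)
    (I_ideal : ideal I) (J_ideal : ideal J) (IJ_comaximal : comaximal I J) :
  commutator_subgroup (relative_elementary D I) (relative_elementary D J) =
  relative_elementary D (ideal_prod I J).
Proof.
apply/seteqP; split.
  apply: generated_sub; first exact: relative_subgroup.
  move=> _ [g Ig [h Jh <-]].
  have [_] := relative_commute Phi_reduced Phi_irreducible rank_ge2 P_lattice
    I_ideal J_ideal IJ_comaximal Ig.
  exact.
set C := commutator_subgroup _ _.
have Csub : subgroup C by apply: generated_subgroup.
have [_ _ CV] := Csub.
have Ccomm g h : relative_elementary D I g -> relative_elementary D J h ->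
    C (commutator g h).
  by move=> Ig Jh; apply: sub_generated; exists g => //; exists h.
have Cpair (K L : set R) a b s t : ideal_pair I J K L -> K s -> L t ->
    C (commutator (xelt D a s) (xelt D b t)).
  have rel (M : set R) c u : M u -> relative_elementary D M (xelt D c u).
    by move=> Mu; apply: elementary_relative; apply: elementary_xelt.
  move=> [[-> ->]|[-> ->]] Ks Lt; first by apply: Ccomm; apply: rel.
  by rewrite -commutatorV; exact: CV _ (Ccomm _ _ (rel _ _ _ Lt) (rel _ _ _ Ks)).
(* [C] is normalized by E(R), so it suffices that it contains the root elements with parameter in
   the product ideal. *)
apply: normal_closure_min => //.
  by apply: commutator_subgroup_normalized; apply: relative_normalized.
apply: elementary_sub => // a t aP.
suff good : forall b, b \in roots Phi -> contains_root I J C b by apply: good.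
apply: (all_roots_good Phi_reduced Phi_irreducible rank_ge2)
  => [c d|c d|BG c d] cP dP dc dNc cdP kP.
- rewrite mulr1n in kP *.
  exact: (contains_root_A Phi_reduced P_lattice I_ideal J_ideal Csub Cpair).
- exact: (contains_root_B Phi_reduced P_lattice I_ideal J_ideal IJ_comaximal Csub Cpair).
apply: (contains_root_noF2 Phi_reduced P_lattice I_ideal J_ideal IJ_comaximal Csub Cpair) => //.
exact: no_F2.
Qed.
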